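(* Let $P$ be a probability measure on $\mathbb{R}^p$ that is absolutely continuous with respect to the Lebesgue measure, with continuous density $f$, and let $X_1,X_2,\dots$ be independent and identically distributed random vectors with law $P$. Let $x$ belong to $S=\{y\in\mathbb{R}^p:f(y)>0\}$ and let $\{\tau_n\}_{n=1}^\infty$ be a sequence of positive scalars converging to zero. If $\sqrt n\,\tau_n^{\frac32 p}\to\infty$ as $n\to\infty$, then $$\sqrt n\,\tau_n^{\frac12 p}\bigl(f_{\tau_n,n}(x)-f_{\tau_n}(x)\bigr)\xrightarrow[n\to\infty]{d}N\left(0,\frac{\Lambda_1^{*2}}{\Lambda_1^2}f(x)\right).$$
   Context: $p\ge 1$; $\|\cdot\|$ is the Euclidean norm on $\mathbb{R}^p$ and $\lambda$ the Lebesgue measure on $\mathbb{R}^p$. For $x\in\mathbb{R}^p$ and $\tau\in[0,\infty]$, $$Z_\tau(x)=\{(x_1,x_2)\in\mathbb{R}^p\times\mathbb{R}^p:\ \max_{i=1,2}\|x-x_i\|\le\|x_1-x_2\|\le\tau\}.$$ The local lens depth is $LLD(x,\tau)=\int_{\mathbb{R}^p\times\mathbb{R}^p}\mathbf{I}((x_1,x_2)\in Z_\tau(x))\,dP(x_1)\,dP(x_2)$, and its sample version, for $n\ge 2$, is $LLD_n(x,\tau)=\binom n2^{-1}\sum_{1\le i<j\le n}\mathbf{I}((X_i,X_j)\in Z_\tau(x))$. $\Lambda_1$ is the Lebesgue measure of $Z_1(0)$ in $\mathbb{R}^p\times\mathbb{R}^p$. For $0<\tau<\infty$, $$f_\tau(x)=\frac{\sqrt{LLD(x,\tau)}}{\tau^p\sqrt{\Lambda_1}},\qquad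 f_{\tau,n}(x)=\frac{\sqrt{LLD_n(x,\tau)}}{\tau^p\sqrt{\Lambda_1}}.$$ For $x_1\in\mathbb{R}^p$ let $Z_1(0)|_{x_1}=\{x_2\in\mathbb{R}^p:\max_{i=1,2}\|x_i\|\le\|x_1-x_2\|\le 1\}$, and set $\Lambda_1^{*2}=\int_{\mathbb{R}^p}\bigl(\lambda(Z_1(0)|_{x_1})\bigr)^2\,dx_1$. The support of $f$ is understood as the set $S$. *)

(* Defs.v *)
From HB Require Import structures.
From mathcomp Require Import all_boot all_order all_algebra.
From mathcomp Require Import all_classical all_reals all_analysis.
From mathcomp Require Import measurable_realfun.

Set Implicit Arguments.
Unset Strict Implicit.
Unset Printing Implicit Defensive.

Import Order.TTheory GRing.Theory Num.Theory.
Import numFieldNormedType.Exports.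

Local Open Scope classical_set_scope.
Local Open Scope ring_scope.

(* The sigma-algebra on R^p (row vectors) is the one generated by the
   coordinates, as for n.-tuple in measurable_structure.v; measurable_rVE shows
   that it is the Borel sigma-algebra. *)
Definition measure_rV_display : measure_display -> measure_display.
Proof. exact. Qed.

Section measurable_rV.
Context {R : realType}.
Variable p : nat.

Let coors : 'I_p -> 'rV[R]_p -> R := fun i x => x ord0 i.

Let rV_set0 : g_sigma_preimage coors set0.
Proof. exact: sigma_algebra0. Qed.

Let rV_setC A : g_sigma_preimage coors A -> g_sigma_preimage coors (~` A).
Proof. exact: sigma_algebraC. Qed.

Let rV_bigcup (F : _^nat) : (forall i, g_sigma_preimage coors (F i)) ->
  g_sigma_preimage coors (\bigcup_i (F i)).
Proof. exact: sigma_algebra_bigcup. Qed.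

HB.instance Definition _ :=
  @isMeasurable.Build (measure_rV_display default_measure_display)
    'rV[R]_p (g_sigma_preimage coors) rV_set0 rV_setC rV_bigcup.

End measurable_rV.

Lemma measurable_coord (R : realType) p (i : 'I_p) :
  measurable_fun [set: 'rV[R]_p] (fun x : 'rV[R]_p => x ord0 i).
Proof.
move=> _ Y mY; rewrite setTI; apply: sub_sigma_algebra => /=.
rewrite -bigcup_seq/=; exists i => /=; first by rewrite mem_index_enum.
by exists Y => //; rewrite setTI.
Qed.

Lemma measurable_fun_rVP d (T : measurableType d) (R : realType) p
    (f : T -> 'rV[R]_p) :
  measurable_fun [set: T] f <->
  forall i, measurable_fun [set: T] (fun t => f t ord0 i).
Proof.
split=> [mf i|mf].
  by apply: (measurableT_comp (@measurable_coord R p i)).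
move=> _ A mA; rewrite setTI.
suff : @measurable _ 'rV[R]_p `<=` image_set_system setT f measurable.
  by move/(_ _ mA); rewrite /image_set_system /= setTI.
apply: smallest_sub; first by apply: sigma_algebra_image; exact: sigma_algebra_measurable.
rewrite -bigcup_seq; apply: bigcup_sub => i _ _ [B mB <-].
by rewrite /image_set_system/= !setTI -[X in measurable X]setTI; exact: mf.
Qed.


Lemma measurable_rVE (R : realType) p :
  @measurable _ 'rV[R]_p = <<s [set U : set 'rV[R]_p | open U] >>.
Proof.
rewrite eqEsubset; split.
  apply: smallest_sub; first exact: smallest_sigma_algebra.
  rewrite -bigcup_seq; apply: bigcup_sub => i _ _ [B mB <-].
  pose c (x : g_sigma_algebraType [set U : set 'rV[R]_p | open U]) : R :=
    (x : 'rV[R]_p) ord0 i.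
  suff mc : measurable_fun setT c by exact: (mc measurableT B mB).
  apply: (measurability _ (RGenOpens.measurableE R)).
  move=> _ [_ [a [b ->] <-]]; rewrite setTI; apply: sub_sigma_algebra => /=.
  apply: open_comp; last exact: interval_open.
  by move=> x _; exact: coord_continuous.
apply: smallest_sub; first exact: sigma_algebra_measurable.
move=> U /= oU.
pose box (c : 'rV[rat * rat]_p) : set 'rV[R]_p :=
  \bigcap_(i in [set: 'I_p])
    ((fun x : 'rV[R]_p => x ord0 i) @^-1`
      `]ratr (c ord0 i).1, ratr (c ord0 i).2[%classic).
have mbox c : measurable (box c).
  apply: fin_bigcap_measurable => // i _.
  rewrite -[X in measurable X]setTI.
  by apply: measurable_coord => //; exact: measurable_itv.
have -> : U = \bigcup_(c in [set: 'rV[rat * rat]_p])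
    (if `[< box c `<=` U >] then box c else set0).
  apply/seteqP; split=> [x Ux|x [c _]]; last by case: ifPn => // /asboolP; apply.
  have /nbhs_ballP[e /= e0 eU] : nbhs x U by exact: open_nbhs_nbhs.
  have /choice[q qP] (i : 'I_p) : exists q : rat * rat,
      x ord0 i - e < ratr q.1 < x ord0 i /\
      x ord0 i < ratr q.2 < x ord0 i + e.
    have /rat_in_itvoo[q1] : x ord0 i - e < x ord0 i by rewrite ltrBlDr ltrDl.
    have /rat_in_itvoo[q2] : x ord0 i < x ord0 i + e by rewrite ltrDl.
    by rewrite !in_itv /= => ? ?; exists (q1, q2).
  exists (\row_i q i) => //.
  have /asboolP -> : box (\row_i q i) `<=` U.
    move=> y boxy; apply: eU; split => // i j; rewrite (ord1 i).
    have := boxy j Logic.I; rewrite /= in_itv /= mxE => /andP[h1 h2].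
    have [/andP[h3 h4] /andP[h5 h6]] := qP j.
    rewrite -ball_normE /ball_/= ltr_norml; apply/andP; split.
      by rewrite ltrBrDl ltrBlDr (lt_trans h2)// addrC.
    by rewrite ltrBlDr -ltrBlDl (lt_trans h3).
  move=> i _; rewrite /= in_itv /= mxE.
  by have [/andP[_ ->] /andP[-> _]] := qP i.
apply: countable_bigcupT_measurable => // c; case: ifPn => // _; exact: mbox.
Qed.

Definition cons_rV (R : realType) p (z : R * 'rV[R]_p) : 'rV[R]_p.+1 :=
  \row_i (if unlift ord0 i is Some j then z.2 ord0 j else z.1).

Lemma cons_rV0 (R : realType) p (z : R * 'rV[R]_p) :
  cons_rV z ord0 ord0 = z.1.
Proof. by rewrite mxE unlift_none. Qed.

Lemma cons_rVS (R : realType) p (z : R * 'rV[R]_p) (j : 'I_p) :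
  cons_rV z ord0 (lift ord0 j) = z.2 ord0 j.
Proof. by rewrite mxE liftK. Qed.

Lemma measurable_cons_rV (R : realType) p :
  measurable_fun [set: measurableTypeR R * 'rV[R]_p] (@cons_rV R p).
Proof.
apply/measurable_fun_rVP => i; have [j ->|->] := unliftP ord0 i.
  rewrite (_ : (fun _ => _) = (fun x : 'rV[R]_p => x ord0 j) \o snd).
    apply: measurableT_comp; first exact: measurable_coord.
    exact: measurable_snd.
  by apply/funext => z; rewrite /= cons_rVS.
rewrite (_ : (fun _ => _) = fst); first exact: measurable_fst.
by apply/funext => z; rewrite cons_rV0.
Qed.

(* Lebesgue measure on R^p: the p-fold product of lebesgue_measure. *)
Fixpoint lebesgue_rV (R : realType) p : set 'rV[R]_p -> \bar R :=
  match p with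
  | 0%N => dirac (0 : 'rV[R]_0)
  | q.+1 => pushforward (lebesgue_measure \x @lebesgue_rV R q)%E (@cons_rV R q)
  end.

Section lebesgue_rV_measure.
Context {R : realType}.
Local Open Scope ereal_scope.


Section cons_measure.
Variables (p : nat) (m : {sigma_finite_measure set 'rV[R]_p -> \bar R}).

Let m1 : {measure set (measurableTypeR R * 'rV[R]_p)%type -> \bar R} :=
  @lebesgue_measure R \x m.

Definition cons_measure : set 'rV[R]_p.+1 -> \bar R :=
  pushforward (@lebesgue_measure R \x m) (@cons_rV R p).

Let mpre (A : set 'rV[R]_p.+1) : measurable A ->
  measurable (@cons_rV R p @^-1` A : set (measurableTypeR R * 'rV[R]_p)).
Proof.
by move=> mA; rewrite -[X in measurable X]setTI; exact: measurable_cons_rV.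
Qed.

Let cons_measure0 : cons_measure set0 = 0.
Proof. by rewrite /cons_measure /pushforward preimage_set0 (measure0 m1). Qed.

Let cons_measure_ge0 A : 0 <= cons_measure A.
Proof. exact: (measure_ge0 m1). Qed.

Let cons_measure_sigma_additive : semi_sigma_additive cons_measure.
Proof.
move=> F mF tF mUF; rewrite /cons_measure /pushforward preimage_bigcup.
apply: (measure_semi_sigma_additive (s := m1)).
- by move=> n; exact: mpre.
- apply/trivIsetP => /= i j _ _ ij; rewrite -preimage_setI.
  by move/trivIsetP : tF => /(_ _ _ _ _ ij) ->//; rewrite preimage_set0.
- by rewrite -preimage_bigcup; exact: mpre.
Qed.

HB.instance Definition _ := isMeasure.Build _ _ _ cons_measure
  cons_measure0 cons_measure_ge0 cons_measure_sigma_additive.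

Let cons_measure_sigma_finite : sigma_finite setT cons_measure.
Proof.
have /sigma_finiteP[F [FT ndF Foo]] := sigma_finiteT (@lebesgue_measure R).
have /sigma_finiteP[G [GT ndG Goo]] := sigma_finiteT m.
pose h (x : 'rV[R]_p.+1) : (measurableTypeR R * 'rV[R]_p)%type :=
  (x ord0 ord0, \row_j x ord0 (lift ord0 j)).
have mh : measurable_fun setT h.
  apply: measurable_fun_pair; first exact: measurable_coord.
  apply/measurable_fun_rVP => i.
  rewrite (_ : (fun _ => _) = fun x : 'rV[R]_p.+1 => x ord0 (lift ord0 i)).
    exact: measurable_coord.
  by apply/funext => x; rewrite mxE.
have fK z : h (cons_rV z) = z.
  case: z => a b; rewrite /h cons_rV0; congr pair.
  by apply/rowP => j; rewrite mxE cons_rVS.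
exists (fun n => h @^-1` (F n `*` G n)).
  apply/esym; rewrite -subTset => x _.
  have [i _ Fi] : (\bigcup_i F i) (h x).1 by rewrite -FT.
  have [j _ Gj] : (\bigcup_i G i) (h x).2 by rewrite -GT.
  exists (maxn i j) => //; split.
    by move: Fi; exact/subsetPset/ndF/leq_maxl.
  by move: Gj; exact/subsetPset/ndG/leq_maxr.
move=> n; have [mFn Fnoo] := Foo n; have [mGn Gnoo] := Goo n.
have mFG : measurable (F n `*` G n) by exact: measurableX.
split; first by rewrite -[X in measurable X]setTI; exact: mh.
rewrite /cons_measure /pushforward -comp_preimage.
rewrite (_ : h \o _ = id) ?preimage_id; last exact/funext.
by rewrite product_measure1E// lte_mul_pinfty// ge0_fin_numE.
Qed.

HB.instance Definition _ := Measure_isSigmaFinite.Build _ _ _ cons_measure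
  cons_measure_sigma_finite.

End cons_measure.

Let lebesgue_rV_sig p :
  exists m : {sigma_finite_measure set 'rV[R]_p -> \bar R},
    @lebesgue_rV R p = m :> (set _ -> \bar R).
Proof.
elim: p => [|p [m IH]] /=; last by rewrite IH; exists (cons_measure m).
by exists (dirac (0%R : 'rV[R]_0)).
Qed.

Let lebesgue_rV0 p : @lebesgue_rV R p set0 = 0.
Proof. by have [m ->] := lebesgue_rV_sig p; exact: measure0. Qed.

Let lebesgue_rV_ge0 p A : 0 <= @lebesgue_rV R p A.
Proof. by have [m ->] := lebesgue_rV_sig p; exact: measure_ge0. Qed.

Let lebesgue_rV_sigma p : semi_sigma_additive (@lebesgue_rV R p).
Proof.
by have [m ->] := lebesgue_rV_sig p; exact: measure_semi_sigma_additive.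
Qed.

HB.instance Definition _ p := isMeasure.Build _ _ _ (@lebesgue_rV R p)
  (@lebesgue_rV0 p) (@lebesgue_rV_ge0 p) (@lebesgue_rV_sigma p).

Let lebesgue_rV_fin p : sigma_finite setT (@lebesgue_rV R p).
Proof. by have [m ->] := lebesgue_rV_sig p; exact: sigma_finiteT. Qed.

HB.instance Definition _ p := Measure_isSigmaFinite.Build _ _ _
  (@lebesgue_rV R p) (@lebesgue_rV_fin p).

Lemma lebesgue_rV_box p (A : 'I_p -> set R) : (forall i, measurable (A i)) ->
  @lebesgue_rV R p [set x | forall i, A i (x ord0 i)] =
  \prod_(i < p) lebesgue_measure (A i).
Proof.
elim: p A => [|p IH] A mA.
  rewrite big_ord0 [LHS]diracE mem_set//.
  by case.
rewrite big_ord_recl -(IH (fun i => A (lift ord0 i))); last by move=> i; exact: mA.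
set B := (X in _ = _ * lebesgue_rV X).
have mB : measurable B.
  rewrite (_ : B = \bigcap_(i in [set: 'I_p])
      ((fun x : 'rV[R]_p => x ord0 i) @^-1` A (lift ord0 i))).
    apply: fin_bigcap_measurable => // i _.
    by rewrite -[X in measurable X]setTI; apply: measurable_coord => //; exact: mA.
  by apply/seteqP; split=> [x xA i _|x xA i]; [exact: xA|exact: (xA i Logic.I)].
rewrite -(product_measure1E lebesgue_measure (@lebesgue_rV R p)) //; last exact: mA.
rewrite /= /pushforward; congr (product_measure1 _ _ _).
apply/seteqP; split=> [[a b] /= xA|[a b] /= [Aa Ab] i].
  split; first by have := xA ord0; rewrite cons_rV0.
  by move=> i; have := xA (lift ord0 i); rewrite cons_rVS.
by have [j ->|->] := unliftP ord0 i; rewrite ?cons_rVS ?cons_rV0.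
Qed.

End lebesgue_rV_measure.

Section local_lens_depth.
Context {R : realType} {p : nat}.
Implicit Types (x : 'rV[R]_p) (P : probability 'rV[R]_p R).

(* The canonical norm `|x| on 'rV[R]_p is the sup norm, hence enorm. *)
Definition enorm x : R := Num.sqrt (\sum_(i < p) x ord0 i ^+ 2).

Definition lens_pairs (tau : \bar R) x : set ('rV[R]_p * 'rV[R]_p) :=
  [set z | Num.max (enorm (x - z.1)) (enorm (x - z.2)) <= enorm (z.1 - z.2)
           /\ ((enorm (z.1 - z.2))%:E <= tau)%E].

Definition LLD P x (tau : \bar R) : R :=
  \int[(P \x P)%E]_z \1_(lens_pairs tau x) z.

(* The sample is X 0, ..., X n.-1: indices are shifted by one. *)
Definition sample_LLD (n : nat) (X : nat -> 'rV[R]_p) x (tau : \bar R) : R :=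
  'C(n, 2)%:R^-1 *
  \sum_(i < n) \sum_(j < n | (i < j)%N) \1_(lens_pairs tau x) (X i, X j).

Definition Lambda1 : R :=
  fine ((@lebesgue_rV R p \x @lebesgue_rV R p)%E (lens_pairs 1%:E 0)).

Definition Lambda1_star2 : R :=
  \int[@lebesgue_rV R p]_x1
    (fine (@lebesgue_rV R p (xsection (lens_pairs 1%:E 0) x1))) ^+ 2.

Definition lens_density P (tau : R) x : R :=
  Num.sqrt (LLD P x tau%:E) / (tau ^+ p * Num.sqrt Lambda1).

Definition sample_lens_density (n : nat) (X : nat -> 'rV[R]_p) (tau : R) x : R :=
  Num.sqrt (sample_LLD n X x tau%:E) / (tau ^+ p * Num.sqrt Lambda1).

Definition is_density P (f : 'rV[R]_p -> R) :=
  [/\ measurable_fun setT f, forall y, 0 <= f y &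
    forall A, measurable A -> P A = (\int[@lebesgue_rV R p]_(y in A) (f y)%:E)%E].

End local_lens_depth.

Arguments Lambda1 : clear implicits.
Arguments Lambda1_star2 : clear implicits.

Section random_sequences.
Context {R : realType} {d} {Om : measurableType d}.
Variable Q : probability Om R.

Definition mutually_independent d' (T : measurableType d')
    (X : nat -> {RV Q >-> T}) :=
  forall (s : seq nat) (A : nat -> set T), uniq s ->
    (forall i, measurable (A i)) ->
    Q (\bigcap_(i in [set` s]) (X i @^-1` A i)) =
    (\prod_(i <- s) Q (X i @^-1` A i))%E.

Definition identically_distributed d' (T : measurableType d')
    (X : nat -> {RV Q >-> T}) (P : probability T R) :=
  forall i A, measurable A -> distribution Q (X i) A = P A.

Definition cvg_in_distribution (Y : nat -> Om -> R) (mu : probability (measurableTypeR R) R) :=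
  (forall n, measurable_fun setT (Y n)) /\
  forall g : R -> R, continuous g -> bounded_fun g ->
    \int[Q]_w g (Y n w) @[n --> \oo] --> \int[mu]_y g y.

End random_sequences.

(* Main.v *)
Require Import Defs.
From HB Require Import structures.
From mathcomp Require Import all_boot all_order all_algebra.
From mathcomp Require Import all_classical all_reals all_analysis.
From mathcomp Require Import measurable_realfun.
From mathcomp Require Import ring lra.

(** The statement is a central limit theorem for the square root of a
U-statistic of order two whose kernel, the indicator h of the lens relation
at scale t = tau n, shrinks with n.

Hoeffding's decomposition splits LLD_n - LLD into the linear part
(2 / n) * sum_i (h1 (X_i) - theta), where h1 is the expectation of h in one
of its arguments and theta = E h1 = LLD, and a degenerate remainder of
second moment at most 16 theta / C(n, 2).  Taylor's inequality for the square
root turns sqrt LLD_n - sqrt LLD into half of (LLD_n - LLD) / sqrt theta, up to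
an error quadratic in LLD_n - LLD.  Both errors vanish in L^1 under the
normalization of the theorem, so that only a normalized sum of n independent
identically distributed terms is left
([sqrt_ustatistic_linearization]).

These terms are centred and uniformly small, and their total variance
converges; hence the characteristic functions of their sums converge to that of
a centred normal law ([char_fun_sum_small], [char_fun_normal]).  The continuity
theorem [continuity_theorem] converts this into convergence in distribution:
bounded continuous functions are approximated on a large segment by
trigonometric polynomials (Bernstein polynomials in a sine), and a uniform tail
bound takes care of the rest of the line.  This gives [ustatistic_sqrt_clt], for
an arbitrary sequence of symmetric kernels with values in [0, 1].

What depends on the lens is the size of theta and of E h1^2.  After the
substitution y = x + t u, the section of the lens relation at y is x plus t
times the section of the unit lens relation at u, and f is nearly constant at
the scale t because it is continuous.  Hence E h1^k is equivalent to
f(x)^(k + 1) * t^(p * (k + 1)) times the integral of the k-th power of the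
measure of the sections of the unit lens relation ([lens_moment_cvg]).  For
k = 1 this integral is Lambda_1, for k = 2 it is Lambda_1^{*2}; the asymptotic
variance and all the error terms follow from these two equivalents, and the
hypothesis that sqrt n * t^(3 p / 2) tends to infinity is what makes the errors
vanish. *)

Set Implicit Arguments.
Unset Strict Implicit.
Unset Printing Implicit Defensive.

Import Order.TTheory GRing.Theory Num.Theory.
Import numFieldNormedType.Exports.

Local Open Scope classical_set_scope.
Local Open Scope ring_scope.

(** * Bounded measurable functions and their expectations *)

Section bounded_measurable.
Context d (T : measurableType d) (R : realType).
Implicit Types f g : T -> R.

(** Expectations are only taken of such functions: the class is closed under all the
operations used, and integrability under a probability is automatic. *)
Definition bounded_mfun f :=
  measurable_fun setT f /\ exists M, forall x, `|f x| <= M.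

Lemma bounded_mfun_cst (c : R) : bounded_mfun (fun=> c).
Proof. by split; [exact: measurable_cst|exists `|c|]. Qed.

Lemma bounded_mfunD f g :
  bounded_mfun f -> bounded_mfun g -> bounded_mfun (fun x => f x + g x).
Proof.
move=> [mf [M fM]] [mg [N gN]]; split; first exact: measurable_funD.
by exists (M + N) => x; rewrite (le_trans (ler_normD _ _))// lerD.
Qed.

Lemma bounded_mfunM f g :
  bounded_mfun f -> bounded_mfun g -> bounded_mfun (fun x => f x * g x).
Proof.
move=> [mf [M fM]] [mg [N gN]]; split; first exact: measurable_funM.
by exists (M * N) => x; rewrite normrM ler_pM.
Qed.

Lemma bounded_mfunZ (c : R) f :
  bounded_mfun f -> bounded_mfun (fun x => c * f x).
Proof. by apply: bounded_mfunM; exact: bounded_mfun_cst. Qed.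

Lemma bounded_mfunN f : bounded_mfun f -> bounded_mfun (fun x => - f x).
Proof.
by move=> /(bounded_mfunZ (-1)); under eq_fun do rewrite mulN1r.
Qed.

Lemma bounded_mfunB f g :
  bounded_mfun f -> bounded_mfun g -> bounded_mfun (fun x => f x - g x).
Proof. by move=> bf /bounded_mfunN; exact: bounded_mfunD. Qed.

Lemma bounded_mfun_norm f : bounded_mfun f -> bounded_mfun (fun x => `|f x|).
Proof.
move=> [mf [M fM]]; split; first exact: measurableT_comp.
by exists M => x; rewrite normr_id.
Qed.

Lemma bounded_mfunX f n : bounded_mfun f -> bounded_mfun (fun x => f x ^+ n).
Proof.
move=> bf; elim: n => [|n ih].
  by under eq_fun do rewrite expr0; exact: bounded_mfun_cst.
by under eq_fun do rewrite exprS; exact: bounded_mfunM.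
Qed.

Lemma bounded_mfun_sum (I : Type) (s : seq I) (F : I -> T -> R) :
  (forall i, bounded_mfun (F i)) -> bounded_mfun (fun x => \sum_(i <- s) F i x).
Proof.
move=> bF; elim: s => [|i s ih].
  by under eq_fun do rewrite big_nil; exact: bounded_mfun_cst.
by under eq_fun do rewrite big_cons; exact: bounded_mfunD.
Qed.

Lemma bounded_mfun_comp (h : R -> R) f : measurable_fun setT h ->
  (exists M, forall x, `|h x| <= M) -> measurable_fun setT f ->
  bounded_mfun (fun x => h (f x)).
Proof.
move=> mh [M hM] mf; split; first exact: measurableT_comp.
by exists M => x.
Qed.

End bounded_measurable.

Lemma bounded_mfun_pull d d' (T : measurableType d) (T' : measurableType d')
    (R : realType) (h : T' -> R) (f : T -> T') :
  bounded_mfun h -> measurable_fun setT f -> bounded_mfun (fun x => h (f x)).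
Proof.
move=> [mh [M hM]] mf; split; first exact: measurableT_comp.
by exists M => x.
Qed.

Lemma measurable_cos (R : realType) : measurable_fun setT (@cos R).
Proof. by apply: continuous_measurable_fun; exact: continuous_cos. Qed.

Lemma measurable_sin (R : realType) : measurable_fun setT (@sin R).
Proof. by apply: continuous_measurable_fun; exact: continuous_sin. Qed.

Lemma norm_cos_le1 (R : realType) (x : R) : `|cos x| <= 1.
Proof. by rewrite ler_norml cos_geN1 cos_le1. Qed.

Lemma norm_sin_le1 (R : realType) (x : R) : `|sin x| <= 1.
Proof. by rewrite ler_norml sin_geN1 sin_le1. Qed.

Section bounded_measurable_trig.
Context d (T : measurableType d) (R : realType).
Implicit Types f : T -> R.

Lemma bounded_mfun_cos f :
  measurable_fun setT f -> bounded_mfun (fun x => cos (f x)).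
Proof.
move=> mf; apply: (bounded_mfun_comp (@measurable_cos R)) => //.
by exists 1 => x; exact: norm_cos_le1.
Qed.

Lemma bounded_mfun_sin f :
  measurable_fun setT f -> bounded_mfun (fun x => sin (f x)).
Proof.
move=> mf; apply: (bounded_mfun_comp (@measurable_sin R)) => //.
by exists 1 => x; exact: norm_sin_le1.
Qed.

End bounded_measurable_trig.

Section integral_bounded_measurable.
Context d (T : measurableType d) (R : realType) (P : probability T R).
Implicit Types f g : T -> R.

Lemma bounded_mfun_integrable f :
  bounded_mfun f -> P.-integrable setT (EFin \o f).
Proof.
move=> [mf [M fM]]; apply: measurable_bounded_integrable => //.
  by rewrite -ge0_fin_numE// fin_num_measure.
exists M; split; first exact: num_real.
by move=> r Mr x _; exact: (le_trans (fM x) (ltW Mr)).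
Qed.

Lemma expectD f g : bounded_mfun f -> bounded_mfun g ->
  \int[P]_x (f x + g x) = \int[P]_x f x + \int[P]_x g x.
Proof. by move=> bf bg; apply: RintegralD => //; exact: bounded_mfun_integrable. Qed.

Lemma expectB f g : bounded_mfun f -> bounded_mfun g ->
  \int[P]_x (f x - g x) = \int[P]_x f x - \int[P]_x g x.
Proof. by move=> bf bg; apply: RintegralB => //; exact: bounded_mfun_integrable. Qed.

Lemma expectZ c f : bounded_mfun f ->
  \int[P]_x (c * f x) = c * \int[P]_x f x.
Proof. by move=> bf; apply: RintegralZl => //; exact: bounded_mfun_integrable. Qed.

Lemma expect_cst (c : R) : \int[P]_x c = c.
Proof. by rewrite Rintegral_cst//= [X in fine X](_ : _ = 1%E) ?mulr1//; exact: probability_setT. Qed.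

Lemma expect_sum (I : Type) (s : seq I) (F : I -> T -> R) :
  (forall i, bounded_mfun (F i)) ->
  \int[P]_x (\sum_(i <- s) F i x) = \sum_(i <- s) \int[P]_x F i x.
Proof.
move=> bF; elim: s => [|i s ih].
  by under eq_Rintegral do rewrite big_nil; rewrite expect_cst big_nil.
under eq_Rintegral do rewrite big_cons.
by rewrite expectD ?ih ?big_cons//; exact: bounded_mfun_sum.
Qed.

Lemma le_expect f g : bounded_mfun f -> bounded_mfun g ->
  (forall x, f x <= g x) -> \int[P]_x f x <= \int[P]_x g x.
Proof.
by move=> bf bg fg; apply: le_Rintegral => //; exact: bounded_mfun_integrable.
Qed.

Lemma le_norm_expect f : bounded_mfun f ->
  `|\int[P]_x f x| <= \int[P]_x `|f x|.
Proof.
by move=> bf; apply: le_normr_Rintegral => //; exact: bounded_mfun_integrable.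
Qed.

Lemma norm_expect_le f M : bounded_mfun f -> (forall x, `|f x| <= M) ->
  `|\int[P]_x f x| <= M.
Proof.
move=> bf fM; rewrite (le_trans (le_norm_expect bf))//.
rewrite -[leRHS](expect_cst M) le_expect//; first exact: bounded_mfun_norm.
exact: bounded_mfun_cst.
Qed.

End integral_bounded_measurable.

(** * Independence of one observation from the others *)

Section expect_parameter.
Context (R : realType) d1 d2 (T1 : measurableType d1) (T2 : measurableType d2).
Variable P : probability T1 R.

(** Tonelli's theorem gives measurability of the partial integrals of a nonnegative
function, hence the shift by the bound M. *)
Lemma bounded_mfun_expect (F : T1 * T2 -> R) : bounded_mfun F ->
  bounded_mfun (fun y => \int[P]_x F (x, y)).
Proof.
move=> bF; have [mF [M FM]] := bF.
have bFy y : bounded_mfun (fun x => F (x, y)).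
  by apply: (bounded_mfun_pull bF); exact: measurable_fun_pair.
split; last by exists M => y; exact: norm_expect_le.
have mFE : measurable_fun setT (fun z => (F z + M)%:E).
  by apply/measurable_EFinP; exact: measurable_funD.
have F0 z : (0 <= (F z + M)%:E)%E.
  by rewrite lee_fin -lerBlDr sub0r; have := FM z; rewrite ler_norml => /andP[].
have := measurable_fun_fubini_tonelli_G (m1 := P) _ mFE F0.
rewrite (_ : fubini_G _ _ = fun y => (\int[P]_x F (x, y) + M)%:E).
  move/measurable_EFinP => h.
  rewrite (_ : (fun _ => _) = (fun y => (\int[P]_x F (x, y) + M) - M)).
    exact: measurable_funB.
  by apply/funext => y; rewrite addrK.
apply/funext => y; rewrite /fubini_G -{2}(expect_cst P M) -expectD//; last first.
  exact: bounded_mfun_cst.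
rewrite fineK//; apply: integrable_fin_num => //.
apply: bounded_mfun_integrable; apply: bounded_mfunD => //.
exact: bounded_mfun_cst.
Qed.

End expect_parameter.

Section independence.
Context (R : realType) d (Om : measurableType d) (Q : probability Om R).
Context d' (T : measurableType d') (P : probability T R).
Variable X : nat -> {RV Q >-> T}.

(** The pi-system that generates the sigma-algebra of the observations X i with i in s. *)
Definition cylinder (s : seq nat) : set (set Om) :=
  [set E | exists A : nat -> set T, (forall i, measurable (A i)) /\
    E = \bigcap_(i in [set` s]) (X i @^-1` A i)].

Let mX i (A : set T) : measurable A -> measurable (X i @^-1` A).
Proof. by move=> mA; rewrite -[X in measurable X]setTI; exact: measurable_funP. Qed.

Lemma cylinder_setI s : setI_closed (cylinder s).
Proof.
move=> _ _ [A [mA ->]] [B [mB ->]]; exists (fun i => A i `&` B i); split.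
  by move=> i; exact: measurableI.
by rewrite -bigcapI; apply: eq_bigcapr => i _; rewrite preimage_setI.
Qed.

Lemma measurable_cylinder s : <<s cylinder s >> `<=` @measurable _ Om.
Proof.
apply: smallest_sub; first exact: sigma_algebra_measurable.
move=> _ [A [mA ->]]; apply: fin_bigcap_measurable => //.
by move=> i _; exact: mX.
Qed.

Lemma cylinder_coord s i A : i \in s -> measurable A ->
  <<s cylinder s >> (X i @^-1` A).
Proof.
move=> si mA; apply: sub_sigma_algebra.
exists (fun j => if j == i then A else setT); split.
  by move=> j; case: ifP.
apply/seteqP; split=> [w /= Aw j _ /=|w /= /(_ i si) /=]; last by rewrite eqxx.
by case: ifPn => // /eqP ->.
Qed.

Lemma measurable_cylinder_coord s i : i \in s ->
  measurable_fun setT (X i : g_sigma_algebraType (cylinder s) -> T).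
Proof. by move=> si _ A mA; rewrite setTI; exact: cylinder_coord. Qed.

Lemma cylinder_measurable_fun s d2 (T2 : measurableType d2)
    (W : Om -> T2) :
  measurable_fun setT (W : g_sigma_algebraType (cylinder s) -> T2) ->
  measurable_fun setT W.
Proof.
move=> mW _ A mA; rewrite setTI; apply: (@measurable_cylinder s).
by have := mW measurableT _ mA; rewrite setTI.
Qed.

Hypothesis X_indep : mutually_independent X.

(** Mutual independence is the product rule on cylinders; by the pi-lambda theorem it
extends to every event that depends only on the observations indexed by s. *)
Lemma independent_cylinder a s (B : set T) E :
  uniq (a :: s) -> measurable B -> <<s cylinder s >> E ->
  Q (X a @^-1` B `&` E) = (Q (X a @^-1` B) * Q E)%E.
Proof.
move=> /[dup] uas /= /andP[sa us] mB sE.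
pose H := [set E | measurable E /\
  Q (X a @^-1` B `&` E) = (Q (X a @^-1` B) * Q E)%E].
suff : <<s cylinder s >> `<=` H by move=> /(_ E sE) [].
have mXB := mX a mB.
apply: lambda_system_subset => //; first exact: cylinder_setI.
- split => //.
  + by split=> //; rewrite setIT probability_setT mule1.
  + move=> A C CA [mA AE] [mC CE]; split; first exact: measurableD.
    rewrite setIDA measureD//; [|exact: measurableI| ]; last first.
      by rewrite -ge0_fin_numE// fin_num_measure//; exact: measurableI.
    rewrite -setIA (setIidr CA) [X in (X - _)%E]AE [X in (_ - X)%E]CE measureD//; last first.
      by rewrite -ge0_fin_numE// fin_num_measure.
    by rewrite (setIidr CA) muleBr// ?fin_num_measure// fin_num_adde_defr// fin_num_measure.
  + move=> F ndF HF; have mF i : measurable (F i) by case: (HF i).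
    have mUF : measurable (\bigcup_i F i) by exact: bigcup_measurable.
    split=> //.
    have h1 : (Q (X a @^-1` B `&` F n)) @[n --> \oo] -->
              (Q (X a @^-1` B `&` \bigcup_i F i)).
      rewrite setI_bigcupr; apply: nondecreasing_cvg_mu.
      * by move=> n; exact: measurableI.
      * by apply: bigcup_measurable => n _; exact: measurableI.
      * by move=> m n mn; apply/subsetPset; apply: setIS; exact/subsetPset/ndF.
    have h2 : (Q (X a @^-1` B) * Q (F n))%E @[n --> \oo] -->
              (Q (X a @^-1` B) * Q (\bigcup_i F i))%E.
      apply: cvgeZl; first by rewrite fin_num_measure.
      exact: nondecreasing_cvg_mu.
    apply: (cvg_unique _ h1) => //.
    by rewrite (_ : (fun n => _) = (fun n => Q (X a @^-1` B) * Q (F n))%E)//;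
      apply/funext => n; case: (HF n).
- move=> _ [A [mA ->]]; split.
    by apply: measurable_cylinder; apply: sub_sigma_algebra; exists A.
  have mBA i : measurable (if i == a then B else A i) by case: ifP.
  have QE := @X_indep (a :: s) (fun i => if i == a then B else A i) uas mBA.
  rewrite big_cons eqxx in QE.
  rewrite [X in _ = (_ * X)%E]X_indep//.
  rewrite [X in _ = (_ * X)%E](_ : _ =
      \prod_(i <- s) Q (X i @^-1` (if i == a then B else A i)))%E; last first.
    apply: eq_big_seq => i si; case: ifPn => // /eqP ia.
    by move: sa; rewrite -ia si.
  rewrite -[RHS]QE; congr (Q _); apply/seteqP; split=> [w [/= Bw Aw] i /=|w /= Aw].
    by rewrite inE => /predU1P[->|si]; [rewrite eqxx|case: ifPn => [/eqP ->//|_]; exact: Aw].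
  split; first by have := Aw a; rewrite /= mem_head eqxx; exact.
  move=> i /= si; have := Aw i; rewrite /= inE si orbT => /(_ isT).
  by case: ifPn => // /eqP ia; move: sa; rewrite -ia si.
Qed.

Hypothesis X_law : identically_distributed X P.

(** The joint law of X a and of any function W of the other observations is a product
measure, so that X a can be integrated out first. *)
Lemma law_coord_past a s d2 (T2 : measurableType d2) (W : Om -> T2)
    (F : T * T2 -> R) :
  uniq (a :: s) ->
  measurable_fun setT (W : g_sigma_algebraType (cylinder s) -> T2) ->
  bounded_mfun F ->
  \int[Q]_w F (X a w, W w) = \int[Q]_w \int[P]_y F (y, W w).
Proof.
move=> uas mWs bF; have mW := cylinder_measurable_fun mWs.
pose Wm : {mfun Om >-> T2} := HB.pack W (isMeasurableFun.Build _ _ _ _ _ mW).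
have mV : measurable_fun setT (fun w => (X a w, W w)).
  exact: measurable_fun_pair.
pose V : {mfun Om >-> (T * T2)%type} :=
  HB.pack (fun w => (X a w, W w)) (isMeasurableFun.Build _ _ _ _ _ mV).
have VE A : measurable A -> (P \x distribution Q Wm)%E A = distribution Q V A.
  apply: product_measure_unique => B C mB mC.
  have sWC : <<s cylinder s >> (W @^-1` C).
    by have := mWs measurableT _ mC; rewrite setTI.
  transitivity (Q (X a @^-1` B) * Q (W @^-1` C))%E.
    exact: (independent_cylinder uas mB sWC).
  by congr (_ * _)%E; exact: X_law.
have mF : measurable_fun setT (EFin \o F) by apply/measurable_EFinP; case: bF.
have bG := bounded_mfun_expect P bF.
have EG y : (\int[P]_x F (x, y))%:E = (\int[P]_x (F (x, y))%:E)%E.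
  rewrite fineK//; apply: integrable_fin_num => //.
  apply: bounded_mfun_integrable; apply: (bounded_mfun_pull bF).
  exact: measurable_fun_pair.
congr fine.
transitivity (\int[distribution Q V]_z (F z)%:E)%E.
  rewrite integral_pushforward//.
  by apply: bounded_mfun_integrable; exact: (bounded_mfun_pull bF).
transitivity (\int[P \x distribution Q Wm]_z (F z)%:E)%E.
  by apply: eq_measure_integral => A mA _; apply/esym; exact: VE.
rewrite -integral21_prod_meas1; last exact: bounded_mfun_integrable.
transitivity (\int[distribution Q Wm]_y (\int[P]_x F (x, y))%:E)%E.
  by apply: eq_integral => y _; rewrite EG.
rewrite integral_pushforward//.
- by apply/measurable_EFinP; case: bG.
- by apply: bounded_mfun_integrable; exact: (bounded_mfun_pull bG).
Qed.

End independence.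

(** * Elementary inequalities *)

Section trig_bounds.
Context (R : realType).
Implicit Types u v : R.

Lemma mean_value (f df : R -> R) (a b : R) : a <= b ->
  (forall x : R, is_derive x 1 f (df x)) ->
  exists2 c, a <= c <= b & f b - f a = df c * (b - a).
Proof.
move=> ab fdf; have [|c] := @MVT_segment _ f df a b ab (fun x _ => fdf x).
  apply: continuous_subspaceT => x.
  exact/differentiable_continuous/derivable1_diffP/ex_derive.
by rewrite in_itv/=; exists c.
Qed.

Lemma norm_cos_lip u v : `|cos u - cos v| <= `|u - v|.
Proof.
wlog uv : u v / u <= v.
  by move=> h; have [/h//|/ltW/h] := leP u v; rewrite (distrC (cos v)) (distrC v).
have [c _] := mean_value uv (@is_derive_cos R).
rewrite distrC (distrC u) => ->.
by rewrite normrM normrN ler_piMl// norm_sin_le1.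
Qed.

Lemma norm_sin_lip u v : `|sin u - sin v| <= `|u - v|.
Proof.
wlog uv : u v / u <= v.
  by move=> h; have [/h//|/ltW/h] := leP u v; rewrite (distrC (sin v)) (distrC v).
have [c _] := mean_value uv (@is_derive_sin R).
rewrite distrC (distrC u) => ->.
by rewrite normrM ler_piMl// norm_cos_le1.
Qed.

Lemma norm_sin_le u : `|sin u| <= `|u|.
Proof. by have := norm_sin_lip u 0; rewrite sin0 !subr0. Qed.

Lemma cos_half u : cos u = 1 - 2 * sin (u / 2) ^+ 2.
Proof.
rewrite {1}(splitr u) cosD -!expr2; have := cos2Dsin2 (u / 2); lra.
Qed.

Lemma cos_ge_quadratic u : 1 - u ^+ 2 / 2 <= cos u.
Proof.
rewrite cos_half; have := norm_sin_le (u / 2).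
rewrite -(ler_pXn2r (n := 2))// ?nnegrE//.
by rewrite !real_normK ?num_real// expr_div_n; lra.
Qed.

Lemma norm_sin_sub_le u : `|sin u - u| <= `|u| ^+ 3 / 2.
Proof.
wlog u0 : u / 0 <= u.
  move=> h; have [/h//|u0] := leP 0 u.
  have := h (- u); rewrite sinN -opprD !normrN => -> //.
  by rewrite oppr_ge0 ltW.
have [c /andP[c0 cu]] :=
  @mean_value (fun x : R => sin x - x) (fun x => cos x - 1) 0 u u0 _.
rewrite sin0 !subr0 => ->; rewrite normrM exprSr mulrAC (ger0_norm u0).
rewrite ler_wpM2r// ler_norml; have := cos_ge_quadratic c; have := cos_le1 c.
have : c ^+ 2 <= u ^+ 2 by rewrite ler_pXn2r.
by move=> *; apply/andP; split; lra.
Qed.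

(** Since 1 - cos u is twice the square of sin (u / 2), the cubic estimate of the sine
yields the fourth order estimate of the cosine. *)
Lemma norm_cos_sub_le u : `|cos u - (1 - u ^+ 2 / 2)| <= u ^+ 4 / 8.
Proof.
rewrite cos_half (_ : _ - _ =
    2 * ((u / 2 - sin (u / 2)) * (u / 2 + sin (u / 2)))); last by field.
rewrite !normrM (ger0_norm (ler0n _ 2)).
have h1 : `|u / 2 - sin (u / 2)| <= `|u / 2| ^+ 3 / 2.
  by rewrite distrC norm_sin_sub_le.
have h2 : `|u / 2 + sin (u / 2)| <= `|u|.
  rewrite (le_trans (ler_normD _ _))// (le_trans (lerD (lexx _) (norm_sin_le _)))//.
  by rewrite normf_div (ger0_norm (ler0n _ 2)); lra.
rewrite (le_trans (ler_wpM2l _ (ler_pM _ _ h1 h2)))//.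
have -> : u ^+ 4 = `|u| ^+ 4 by rewrite -normrX ger0_norm// exprn_even_ge0.
by rewrite normf_div (ger0_norm (ler0n _ 2)); lra.
Qed.

Lemma expR_neg_le (u : R) : 0 <= u -> `|expR (- u) - (1 - u)| <= u ^+ 2.
Proof.
move=> u0; have [|c /andP[c0 cu]] := @mean_value (fun x : R => expR (- x) + x)
    (fun x => 1 - expR (- x)) 0 u u0.
  move=> x; rewrite addrC; apply: is_deriveD.
  by apply: is_derive_eq; rewrite mulrN1.
rewrite oppr0 expR0 !addr0 => h.
rewrite (_ : _ - _ = (1 - expR (- c)) * u); last by rewrite -h; lra.
rewrite normrM (ger0_norm u0) expr2 ler_wpM2r//.
have := @expR_ge1Dx R (- c) => h1.
have : expR (- c) <= 1 by rewrite -expR0 ler_expR oppr_le0.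
by move=> ?; rewrite ger0_norm; lra.
Qed.

End trig_bounds.

(** * Characteristic functions of sums of small independent terms *)

Section char_fun_sum.
Context (R : realType) d (Om : measurableType d) (Q : probability Om R).
Context d' (T : measurableType d') (P : probability T R).
Variable X : nat -> {RV Q >-> T}.
Hypothesis X_indep : mutually_independent X.
Hypothesis X_law : identically_distributed X P.
Variable phi : T -> R.
Hypothesis mphi : measurable_fun setT phi.

Let S m w := \sum_(j < m) phi (X j w).
Let C m := \int[Q]_w cos (S m w).
Let D m := \int[Q]_w sin (S m w).
Let c := \int[P]_y cos (phi y).
Let s := \int[P]_y sin (phi y).

Lemma measurable_past_sum m :
  measurable_fun setT (S m : g_sigma_algebraType (cylinder X (iota 0 m)) -> R).
Proof.
have mj (j : 'I_m) : measurable_fun setT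
    ((fun w => phi (X j w)) : g_sigma_algebraType (cylinder X (iota 0 m)) -> R).
  apply: (measurableT_comp mphi).
  by apply: measurable_cylinder_coord; rewrite mem_iota add0n ltn_ord.
exact: (measurable_sum _ mj).
Qed.

Lemma measurable_iid_sum m : measurable_fun setT (S m).
Proof. exact: (cylinder_measurable_fun (@measurable_past_sum m)). Qed.

Let bcos : bounded_mfun (fun y => cos (phi y)).
Proof. exact: bounded_mfun_cos. Qed.
Let bsin : bounded_mfun (fun y => sin (phi y)).
Proof. exact: bounded_mfun_sin. Qed.
Let bC m : bounded_mfun (fun w => cos (S m w)).
Proof. exact/bounded_mfun_cos/measurable_iid_sum. Qed.
Let bD m : bounded_mfun (fun w => sin (S m w)).
Proof. exact/bounded_mfun_sin/measurable_iid_sum. Qed.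

Let uniq_past m : uniq (m :: iota 0 m).
Proof. by rewrite /= iota_uniq mem_iota/= add0n ltnn. Qed.

Let mshift : measurable_fun setT (fun z : T * measurableTypeR R => z.2 + phi z.1).
Proof.
apply: measurable_funD; first exact: measurable_snd.
by apply: measurableT_comp => //; exact: measurable_fst.
Qed.

(* The addition formulas and the independence of the last term give a recursion for
the real and imaginary parts of the characteristic function, which avoids
complex numbers. *)
Let expect_cosS m : C m.+1 = C m * c - D m * s.
Proof.
rewrite /C; under eq_Rintegral do rewrite /S big_ord_recr/=.
rewrite (law_coord_past (T2 := measurableTypeR R) X_indep X_law (W := S m)
  (F := fun z => cos (z.2 + phi z.1)) (uniq_past m))//; last 2 first.
- exact: measurable_past_sum.
- exact: bounded_mfun_cos.
rewrite (mulrC (C m)) (mulrC (D m)) /C /D -!expectZ// -expectB//; last 2 first.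
- exact: bounded_mfunZ.
- exact: bounded_mfunZ.
apply: eq_Rintegral => w _ /=; under eq_Rintegral do rewrite cosD.
rewrite expectB//; [|exact: bounded_mfunZ..].
by rewrite !expectZ// mulrC (mulrC (sin _)).
Qed.

Let expect_sinS m : D m.+1 = D m * c + C m * s.
Proof.
rewrite /D; under eq_Rintegral do rewrite /S big_ord_recr/=.
rewrite (law_coord_past (T2 := measurableTypeR R) X_indep X_law (W := S m)
  (F := fun z => sin (z.2 + phi z.1)) (uniq_past m))//; last 2 first.
- exact: measurable_past_sum.
- exact: bounded_mfun_sin.
rewrite (mulrC (C m)) (mulrC (D m)) /C /D -!expectZ// -expectD//; last 2 first.
- exact: bounded_mfunZ.
- exact: bounded_mfunZ.
apply: eq_Rintegral => w _ /=; under eq_Rintegral do rewrite sinD.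
rewrite expectD//; [|exact: bounded_mfunZ..].
by rewrite !expectZ// mulrC (mulrC (cos _)).
Qed.

(** If a single term has characteristic function c + i s close to the real number q, the
error made by replacing it with q adds up at most linearly over n terms, because
all the factors have modulus at most 1. *)
Lemma char_fun_sum_approx (q : R) n : 0 <= q <= 1 ->
  `|C n - q ^+ n| <= n%:R * (`|c - q| + `|s|) /\
  `|D n| <= n%:R * (`|c - q| + `|s|).
Proof.
move=> /andP[q0 q1]; elim: n => [|n [ihC ihD]].
  rewrite !mul0r /C /D; under eq_Rintegral do rewrite /S big_ord0 cos0.
  under [in X in _ /\ X]eq_Rintegral do rewrite /S big_ord0 sin0.
  by rewrite !expect_cst subrr normr0.
have C1 : `|C n| <= 1 by apply: norm_expect_le => // w; exact: norm_cos_le1.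
have D1 : `|D n| <= 1 by apply: norm_expect_le => // w; exact: norm_sin_le1.
have qle x : `|q * x| <= `|x| by rewrite normrM (ger0_norm q0) ler_piMl.
have Cle x : `|C n * x| <= `|x| by rewrite normrM ler_piMl.
have Dle x : `|D n * x| <= `|x| by rewrite normrM ler_piMl.
rewrite -natr1 mulrDl mul1r; split.
- rewrite expect_cosS (_ : _ - _ =
      q * (C n - q ^+ n) + (C n * (c - q) - D n * s)); last by rewrite exprS; ring.
  rewrite (le_trans (ler_normD _ _))// lerD//; first exact: le_trans (qle _) ihC.
  by rewrite (le_trans (ler_normB _ _))// lerD.
- rewrite expect_sinS (_ : _ + _ =
      q * D n + (D n * (c - q) + C n * s)); last by ring.
  rewrite (le_trans (ler_normD _ _))// lerD//; first exact: le_trans (qle _) ihD.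
  by rewrite (le_trans (ler_normD _ _))// lerD.
Qed.

End char_fun_sum.

Section char_fun_sum_small.
Context (R : realType) d (Om : measurableType d) (Q : probability Om R).
Context d' (T : measurableType d') (P : probability T R).
Variable X : nat -> {RV Q >-> T}.
Hypothesis X_indep : mutually_independent X.
Hypothesis X_law : identically_distributed X P.

(** Taylor expansion of the characteristic function of one term.  The number q of the
preceding lemma is the value exp (- t^2 v / 2) of the normal law with the same
variance v; the bound e on the terms controls the third and fourth moments by the
variance. *)
Lemma char_fun_sum_small (phi : T -> R) (e t : R) n :
  measurable_fun setT phi -> (forall y, `|phi y| <= e) ->
  \int[P]_y phi y = 0 ->
  let v := \int[P]_y (phi y ^+ 2) in
  let S w := \sum_(j < n) phi (X j w) in
  let err := n%:R * v * (t ^+ 4 * e ^+ 2 + `|t| ^+ 3 * e) in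
  `|\int[Q]_w cos (t * S w) - expR (- (t ^+ 2 * (n%:R * v) / 2))| <= err /\
  `|\int[Q]_w sin (t * S w)| <= err.
Proof.
move=> mphi phie phi0 v S err.
have bphi : bounded_mfun phi by split => //; exists e.
have b2 : bounded_mfun (fun y => phi y ^+ 2) by exact: bounded_mfunX.
have phi2e y : phi y ^+ 2 <= e ^+ 2.
  by rewrite -(real_normK (num_real (phi y))) ler_pXn2r ?nnegrE// (le_trans _ (phie y)).
have e0 : 0 <= e by have /(le_trans (normr_ge0 _)) := phie point.
have v0 : 0 <= v by apply: Rintegral_ge0 => y _; exact: sqr_ge0.
have ve : v <= e ^+ 2.
  rewrite -(expect_cst P (e ^+ 2)); apply: le_expect => //.
  exact: bounded_mfun_cst.
pose tphi y := t * phi y.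
have mtphi : measurable_fun setT tphi by exact: measurable_funM.
have SE w : t * S w = \sum_(j < n) tphi (X j w) by rewrite mulr_sumr.
pose q := expR (- (t ^+ 2 * v / 2)).
have tv0 : 0 <= t ^+ 2 * v / 2 by rewrite divr_ge0// mulr_ge0// sqr_ge0.
have q01 : 0 <= q <= 1 by rewrite expR_ge0/= -expR0 ler_expR oppr_le0.
have qn : q ^+ n = expR (- (t ^+ 2 * (n%:R * v) / 2)).
  by rewrite -expRM_natl; congr expR; rewrite -mulr_natl; field.
have bcos : bounded_mfun (fun y => cos (tphi y)) by exact: bounded_mfun_cos.
have bsin : bounded_mfun (fun y => sin (tphi y)) by exact: bounded_mfun_sin.
have cq : `|\int[P]_y cos (tphi y) - q| <= t ^+ 4 * e ^+ 2 * v / 8 + (t ^+ 2 * v / 2) ^+ 2.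
  rewrite (_ : _ - q = (\int[P]_y cos (tphi y) - (1 - t ^+ 2 * v / 2)) -
                       (q - (1 - t ^+ 2 * v / 2))); last by field.
  rewrite (le_trans (ler_normB _ _))// lerD//; last exact: expR_neg_le.
  have -> : 1 - t ^+ 2 * v / 2 = \int[P]_y (1 - t ^+ 2 / 2 * phi y ^+ 2).
    rewrite expectB; [|exact: bounded_mfun_cst|exact: bounded_mfunZ].
    by rewrite expectZ// expect_cst mulrAC.
  have bq : bounded_mfun (fun y => 1 - t ^+ 2 / 2 * phi y ^+ 2).
    by apply: bounded_mfunB; [exact: bounded_mfun_cst|exact: bounded_mfunZ].
  rewrite -expectB//; apply: (le_trans (le_norm_expect _ (bounded_mfunB _ _))) => //.
  have -> : t ^+ 4 * e ^+ 2 * v / 8 =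
      \int[P]_y (t ^+ 4 * e ^+ 2 / 8 * phi y ^+ 2) by rewrite expectZ// -/v; field.
  apply: le_expect; [|exact: bounded_mfunZ|].
    by apply: bounded_mfun_norm; exact: bounded_mfunB.
  move=> y; rewrite (_ : t ^+ 2 / 2 * phi y ^+ 2 = tphi y ^+ 2 / 2); last first.
    by rewrite /tphi; field.
  rewrite (le_trans (norm_cos_sub_le _))//.
  rewrite (_ : tphi y ^+ 4 / 8 = t ^+ 4 / 8 * phi y ^+ 2 * phi y ^+ 2); last first.
    by rewrite /tphi; field.
  rewrite (_ : t ^+ 4 * e ^+ 2 / 8 = t ^+ 4 / 8 * e ^+ 2); last by field.
  by rewrite ler_wpM2r ?sqr_ge0// ler_wpM2l// divr_ge0// exprn_even_ge0.
have sq : `|\int[P]_y sin (tphi y)| <= `|t| ^+ 3 * e * v / 2.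
  have btphi : bounded_mfun tphi by exact: bounded_mfunZ.
  have -> : \int[P]_y sin (tphi y) = \int[P]_y (sin (tphi y) - tphi y).
    by rewrite expectB// expectZ// phi0 mulr0 subr0.
  apply: (le_trans (le_norm_expect _ (bounded_mfunB _ _))) => //.
  have -> : `|t| ^+ 3 * e * v / 2 =
      \int[P]_y (`|t| ^+ 3 * e / 2 * phi y ^+ 2) by rewrite expectZ// -/v; field.
  apply: le_expect; [|exact: bounded_mfunZ|].
    by apply: bounded_mfun_norm; exact: bounded_mfunB.
  move=> y; rewrite (le_trans (norm_sin_sub_le _))//.
  rewrite normrM -(real_normK (num_real (phi y))).
  rewrite (_ : _ / 2 = `|t| ^+ 3 / 2 * `|phi y| * `|phi y| ^+ 2); last by field.
  rewrite (_ : `|t| ^+ 3 * e / 2 = `|t| ^+ 3 / 2 * e); last by field.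
  by rewrite ler_wpM2r ?sqr_ge0// ler_wpM2l// divr_ge0// exprn_ge0.
have [hC hD] := char_fun_sum_approx X_indep X_law mtphi n q01.
have tot : n%:R * (`|\int[P]_y cos (tphi y) - q| + `|\int[P]_y sin (tphi y)|) <= err.
  rewrite /err -mulrA ler_wpM2l//.
  rewrite (le_trans (lerD cq sq))//.
  have : t ^+ 4 * v * v <= t ^+ 4 * v * e ^+ 2.
    by rewrite ler_wpM2l// mulr_ge0// exprn_even_ge0.
  have : 0 <= `|t| ^+ 3 * e * v by rewrite !mulr_ge0// exprn_ge0.
  have : 0 <= t ^+ 4 * v * e ^+ 2.
    by apply: mulr_ge0; [apply: mulr_ge0 => //; exact: exprn_even_ge0|exact: sqr_ge0].
  rewrite (_ : (t ^+ 2 * v / 2) ^+ 2 = t ^+ 4 * v * v / 4); last by field.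
  lra.
rewrite -qn; split.
- under eq_Rintegral do rewrite SE.
  exact: le_trans hC tot.
- under eq_Rintegral do rewrite SE.
  exact: le_trans hD tot.
Qed.

End char_fun_sum_small.

(** * Integration against a density *)

Section density.
Context d (T : measurableType d) (R : realType).
Variables (mu nu : {measure set T -> \bar R}) (f : T -> R).
Hypothesis mf : measurable_fun setT f.
Hypothesis f0 : forall x, 0 <= f x.
Hypothesis nuE : forall A, measurable A ->
  nu A = (\int[mu]_(x in A) (f x)%:E)%E.

Import HBNNSimple.
Local Open Scope ereal_scope.

Let integral_nnsfun_density (h : {nnsfun T >-> R}) :
  \int[nu]_x (h x)%:E = \int[mu]_x ((h x)%:E * (f x)%:E).
Proof.
have mE : measurable_fun setT (EFin \o f) by exact/measurable_EFinP.
under eq_integral do rewrite fimfunE -fsumEFin//.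
rewrite ge0_integral_fsum//; last 2 first.
  - by move=> r; apply/measurable_EFinP; do 2 apply/measurableT_comp => //.
  - by move=> n x _; rewrite EFinM nnfun_muleindic_ge0.
under [RHS]eq_integral.
  move=> x xD; rewrite fimfunE -fsumEFin// ge0_mule_fsuml; last first.
    by move=> r; rewrite EFinM nnfun_muleindic_ge0.
  over.
rewrite [RHS]ge0_integral_fsum//; last 2 first.
  - move=> r; apply: emeasurable_funM => //.
    by apply/measurable_EFinP; do 2 apply/measurableT_comp => //.
  - move=> n x _; apply: mule_ge0; last by rewrite lee_fin.
    by rewrite EFinM nnfun_muleindic_ge0.
apply: eq_fsbigr => r _.
rewrite integralZl_indic_nnsfun// integral_indic// setIT nuE//.
have [r0|r0] := leP 0%R r; last first.
  by rewrite preimage_nnfun0// integral_set0 mule0 integral0_eq// => x _;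
    rewrite indic0 mulr0 mul0e.
rewrite -ge0_integralZl//; last 2 first.
  - exact: measurable_funTS.
  - by move=> x _; rewrite lee_fin.
rewrite integral_mkcond; apply: eq_integral => x _.
rewrite /patch indicE; case: ifPn => xr; rewrite ?mulr1 ?mulr0 ?mul0e//.
Qed.

Lemma ge0_integral_density (g : T -> \bar R) : measurable_fun setT g ->
  (forall x, 0 <= g x) -> \int[nu]_x g x = \int[mu]_x (g x * (f x)%:E).
Proof.
move=> mg g0; pose g_ := nnsfun_approx measurableT mg.
have mE : measurable_fun setT (EFin \o f) by exact/measurable_EFinP.
transitivity (limn (fun n => \int[nu]_x (g_ n x)%:E)).
  rewrite -monotone_convergence//=.
  - apply: eq_integral => x /[!inE] xD; apply/esym/cvg_lim => //=.
    exact: cvg_nnsfun_approx.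
  - by move=> n; exact/measurable_EFinP.
  - by move=> n x _; rewrite lee_fin.
  - by move=> x _ a b ab; rewrite lee_fin//; exact/lefP/nd_nnsfun_approx.
under eq_fun do rewrite integral_nnsfun_density.
rewrite -monotone_convergence//=.
- apply: eq_integral => x /[!inE] xD; apply/cvg_lim => //=.
  by apply: cvgeZr => //; exact: cvg_nnsfun_approx.
- by move=> n; apply: emeasurable_funM => //; exact/measurable_EFinP.
- by move=> n x _; rewrite mule_ge0// lee_fin.
- move=> x _ a b ab; rewrite lee_wpmul2r ?lee_fin//.
  exact/lefP/nd_nnsfun_approx.
Qed.

End density.

Section expect_density.
Context d (T : measurableType d) (R : realType).
Variables (mu : {measure set T -> \bar R}) (nu : probability T R) (f : T -> R).
Hypothesis mf : measurable_fun setT f.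
Hypothesis f0 : forall x, 0 <= f x.
Hypothesis nuE : forall A, measurable A ->
  nu A = (\int[mu]_(x in A) (f x)%:E)%E.

Lemma integrable_density : mu.-integrable setT (EFin \o f).
Proof.
apply/integrableP; split; first exact/measurable_EFinP.
under eq_integral do rewrite /= ger0_norm//.
by rewrite -nuE// -ge0_fin_numE// fin_num_measure.
Qed.

Lemma integrable_bounded_density (g : T -> R) :
  bounded_mfun g -> mu.-integrable setT (EFin \o (fun x => g x * f x)).
Proof.
move=> [mg [M gM]].
have mgf : measurable_fun setT (fun x => g x * f x) by exact: measurable_funM.
apply: (le_integrable measurableT _ _
  (integrableZl measurableT M integrable_density)).
  exact: (measurableT_comp (@EFin_measurable R setT) mgf).
move=> x _ /=; rewrite lee_fin !normrM ler_wpM2r//.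
by rewrite (le_trans (gM x))// ler_norm.
Qed.

Lemma expect_density (g : T -> R) : bounded_mfun g ->
  \int[nu]_x g x = \int[mu]_x (g x * f x).
Proof.
move=> bg; have [mg [M gM]] := bg.
have gM0 x : 0 <= g x + M by rewrite -lerBlDr sub0r; have := gM x; rewrite ler_norml => /andP[].
have bM := bounded_mfun_cst T M.
have -> : \int[nu]_x g x = \int[nu]_x (g x + M) - M.
  by rewrite expectD// expect_cst addrK.
rewrite {1}/Rintegral (ge0_integral_density mf f0 nuE)//; last first.
  by apply/measurable_EFinP; exact: measurable_funD.
under eq_integral do rewrite -EFinM mulrDl.
rewrite -/(Rintegral mu setT (fun x => g x * f x + M * f x)) RintegralD//.
- rewrite RintegralZl//; last exact: integrable_density.
  have -> : \int[mu]_x f x = 1.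
    by rewrite /Rintegral -nuE// probability_setT.
  by rewrite mulr1 addrK.
- exact: integrable_bounded_density.
- exact: integrable_bounded_density.
Qed.

End expect_density.

(** * The characteristic function of a centred normal law *)

Section integral_derivative_line.
Context (R : realType).
Notation mu := (@lebesgue_measure R).

(** The integral over [-n, n] is k n - k (- n); dominated convergence lets n tend to
infinity.  It replaces an integration by parts over the whole line. *)
Lemma integral_derive_eq0 (k k' : R -> R) :
  (forall x : R, is_derive x 1 k (k' x)) -> continuous k' ->
  mu.-integrable setT (EFin \o k') ->
  k n%:R @[n --> \oo] --> 0 -> k (- n%:R) @[n --> \oo] --> 0 ->
  \int[mu]_x k' x = 0.
Proof.
move=> dk ck' ik' ky kNy.
pose I (n : nat) : set R := `[- n%:R, n%:R]%classic.
have mk' : measurable_fun setT k' by exact: continuous_measurable_fun.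
have ck : continuous k.
  move=> x; exact/differentiable_continuous/derivable1_diffP/ex_derive.
have intI n : (\int[mu]_x (k' x * \1_(I n.+1) x)%:E)%E =
    (k n.+1%:R - k (- n.+1%:R))%:E.
  transitivity (\int[mu]_(x in I n.+1) (k' x)%:E)%E.
    rewrite [RHS]integral_mkcond; apply: eq_integral => x _.
    by rewrite /patch indicE; case: ifPn; rewrite ?mulr1 ?mulr0.
  rewrite (@continuous_FTC2 _ k' k)//.
  - by rewrite (@lt_trans _ _ 0)// ?oppr_lt0 ltr0n.
  - exact: continuous_subspaceT.
  - split.
    + by move=> x _; exact: ex_derive.
    + by apply: cvg_at_right_filter; exact: ck.
    + by apply: cvg_at_left_filter; exact: ck.
  - by move=> x _; rewrite derive1E; exact: derive_val.
have mIk n : measurable_fun setT (fun x => (k' x * \1_(I n.+1) x)%:E).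
  apply/measurable_EFinP; apply: measurable_funM => //.
  by apply: measurable_indic; exact: measurable_itv.
have Ik x : (k' x * \1_(I n.+1) x)%:E @[n --> \oo] --> (k' x)%:E.
  apply: cvg_near_cst; near=> n; rewrite indicE mem_set ?mulr1//.
  rewrite /I/= in_itv/= -ler_norml.
  have : `|x| <= n%:R by near: n; exact: nbhs_infty_ger.
  by move=> /le_trans; apply; rewrite ler_nat.
have Ik1 x n : (`|(k' x * \1_(I n.+1) x)%:E| <= `|k' x|%:E)%E.
  rewrite lee_fin normrM ler_piMr// indicE.
  by case: (_ \in _); rewrite ?normr1 ?normr0.
have [|||_ _] := @dominated_convergence _ _ _ mu setT measurableT
    (fun n x => (k' x * \1_(I n.+1) x)%:E) (EFin \o k')
    (abse \o (EFin \o k')) mIk (measurable_int _ ik').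
- by apply: aeW => x _; exact: Ik.
- exact: integrable_abse.
- by apply: aeW => x n _; exact: Ik1.
under eq_fun do rewrite intI.
move=> h; apply: EFin_inj.
rewrite fineK; last exact: integrable_fin_num.
apply: (cvg_unique _ h) => //.
apply: cvg_EFin; first exact: nearW.
rewrite -[X in _ --> X](subr0 0); apply: cvgB.
- by have := ky; rewrite -(cvg_shiftS (fun n => k n%:R)).
- by have := kNy; rewrite -(cvg_shiftS (fun n => k (- n%:R))).
Unshelve. all: end_near. Qed.

End integral_derivative_line.

Section normal_char_fun.
Context (R : realType).
Variable s : R.
Hypothesis s_gt0 : 0 < s.
Notation mu := (@lebesgue_measure R).
Let g := normal_pdf 0 s.

Let s_neq0 : s != 0. Proof. by rewrite gt_eqF. Qed.

Let gE z : g z = normal_peak s * expR (- z ^+ 2 / (s ^+ 2 * 2)).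
Proof. by rewrite /g normal_pdfE// /normal_fun subr0 mulr_natr. Qed.

Let g_ge0 z : 0 <= g z. Proof. exact: normal_pdf_ge0. Qed.

Let mg : measurable_fun setT g. Proof. exact: measurable_normal_pdf. Qed.

Let dg (z : R) : is_derive z 1 g (- (z / s ^+ 2 * g z)).
Proof.
have -> : g = fun z => normal_peak s * expR (- z ^+ 2 / (s ^+ 2 * 2)).
  by apply/funext => y; rewrite gE.
apply: is_derive_eq; rewrite /GRing.scale/=.
by set e := expR _; field.
Qed.

(* With u = |z| / s the claim is u * exp (- u^2 / 2) <= exp (- u^2 / 4), which holds
because u <= 1 + u^2 / 4.  The dominating function is a multiple of a normal
density, so its integral is known; it serves to differentiate under the integral
sign and to bound the tails. *)
Let absg_le z : `|z| * g z <=
  s * normal_peak s / normal_peak (Num.sqrt 2 * s) * normal_pdf 0 (Num.sqrt 2 * s) z.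
Proof.
have r2 : Num.sqrt 2 * s != 0 :> R by rewrite gt_eqF// mulr_gt0// sqrtr_gt0.
rewrite gE normal_pdfE// /normal_fun subr0.
have p2 : normal_peak (Num.sqrt 2 * s) != 0 by rewrite gt_eqF// normal_peak_gt0.
rewrite exprMn sqr_sqrtr//; set e2 := expR (_ / (2 * _ *+ 2)).
rewrite [X in _ <= X](_ : _ = normal_peak s * (s * e2)); last by field.
rewrite mulrCA ler_wpM2l ?normal_peak_ge0//.
pose u := `|z| / s.
have zu : `|z| = s * u by rewrite mulrC divfK.
have z2 : z ^+ 2 = s ^+ 2 * u ^+ 2 by rewrite -exprMn -zu real_normK// num_real.
have -> : - z ^+ 2 / (s ^+ 2 * 2) = - (u ^+ 2 / 4) + (- z ^+ 2 / (2 * s ^+ 2 *+ 2)).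
  by rewrite z2 -mulr_natr; field.
rewrite -/e2 zu -mulrA ler_wpM2l ?(ltW s_gt0)// expRD mulrA ler_piMl ?expR_ge0//.
rewrite expRN ler_pdivrMr ?expR_gt0// mul1r.
by have := expR_ge1Dx (u ^+ 2 / 4); have := sqr_ge0 (u / 2 - 1); nra.
Qed.

Let ig : mu.-integrable setT (EFin \o g).
Proof. exact: integrable_normal_pdf. Qed.

Let izg : mu.-integrable setT (EFin \o (fun z => z * g z)).
Proof.
set K := s * normal_peak s / normal_peak (Num.sqrt 2 * s).
apply: (le_integrable measurableT _ _
  (integrableZl measurableT K (integrable_normal_pdf 0 (Num.sqrt 2 * s)))).
  by apply/measurable_EFinP; exact: measurable_funM.
move=> z _ /=; rewrite lee_fin normrM (ger0_norm (g_ge0 z)).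
by rewrite (le_trans (absg_le z))// ler_norm.
Qed.

Let integrable_bounded_mul (h k : R -> R) : measurable_fun setT h ->
  (forall z, `|h z| <= 1) -> mu.-integrable setT (EFin \o k) ->
  mu.-integrable setT (EFin \o (fun z => h z * k z)).
Proof.
move=> mh h1 ik; apply: (le_integrable measurableT _ _ ik).
  apply/measurable_EFinP; apply: measurable_funM => //.
  by apply/measurable_EFinP; exact: (measurable_int _ ik).
by move=> z _ /=; rewrite lee_fin normrM ler_piMl.
Qed.

Let maff (t c : R) : measurable_fun setT (fun z : R => t * z + c).
Proof. by apply: measurable_funD => //; exact: measurable_funM. Qed.

Let mcos t c : measurable_fun setT (fun z : R => cos (t * z + c)).
Proof. exact: (measurableT_comp (@measurable_cos R)). Qed.

Let msin t c : measurable_fun setT (fun z : R => sin (t * z + c)).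
Proof. exact: (measurableT_comp (@measurable_sin R)). Qed.

(* The phase c treats the real part (c = 0) and the imaginary part (c = - pi / 2) of the
characteristic function at once. *)
Let F c t := \int[mu]_z (cos (t * z + c) * g z).

Let dF c (t : R) : is_derive t 1 (F c) (- \int[mu]_z (sin (t * z + c) * (z * g z))).
Proof.
pose f t z := cos (t * z + c) * g z.
have df (x z : R) : is_derive x 1 (f^~ z) (- (sin (x * z + c) * (z * g z))).
  rewrite /f; apply: is_derive_eq; rewrite /GRing.scale/=.
  by ring.
have intf (x : R) : `]t - 1, t + 1[%classic x -> mu.-integrable setT (EFin \o f x).
  by move=> _; apply: integrable_bounded_mul => // z; exact: norm_cos_le1.
have It : `]t - 1, t + 1[%classic t by rewrite /= in_itv/=; apply/andP; split; lra.
have derf (x z : R) : `]t - 1, t + 1[%classic x -> setT z -> derivable (f^~ z) x 1.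
  by move=> _ _; case: (df x z).
have d1E (x z : R) : partial1of2 f x z = - (sin (x * z + c) * (z * g z)).
  by rewrite /partial1of2 derive1E; case: (df x z).
have ub (x z : R) : `]t - 1, t + 1[%classic x -> setT z -> `|partial1of2 f x z| <= `|z * g z|.
  by move=> _ _; rewrite d1E normrN normrM ler_piMl// norm_sin_le1.
have iabs : mu.-integrable setT (EFin \o (fun z => `|z * g z|)).
  exact: (integrable_norm izg).
have nn (z : R) : 0 <= `|z * g z| by [].
apply: DeriveDef.
  exact: (derivable_under_integral measurableT It intf derf nn iabs ub).
rewrite -derive1E (differentiation_under_integral measurableT It intf derf nn iabs ub).
rewrite -[RHS]mulN1r -RintegralZl//; last first.
  by apply: integrable_bounded_mul => // z; exact: norm_sin_le1.
by apply: eq_Rintegral => z _; rewrite d1E mulN1r.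
Qed.

Let g_inv : exists K, forall n : nat, g n.+1%:R <= K / n.+1%:R /\ g (- n.+1%:R) <= K / n.+1%:R.
Proof.
set K := s * normal_peak s / normal_peak (Num.sqrt 2 * s).
have r2 : Num.sqrt 2 * s != 0 :> R by rewrite gt_eqF// mulr_gt0// sqrtr_gt0.
have K0 : 0 <= K by rewrite divr_ge0 ?normal_peak_ge0// mulr_ge0 ?normal_peak_ge0// ltW.
exists (K * normal_peak (Num.sqrt 2 * s)) => n.
have n0 : 0 < n.+1%:R :> R by [].
have h (z : R) : `|z| = n.+1%:R -> g z <= K * normal_peak (Num.sqrt 2 * s) / n.+1%:R.
  move=> zn; rewrite ler_pdivlMr// mulrC -zn (le_trans (absg_le z))//.
  by rewrite ler_wpM2l// normal_pdf_ub.
by split; apply: h; rewrite ?normrN ger0_norm// ltW.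
Qed.

Let cvg_bounded_mul (h : R -> R) (z : nat -> R) K : (forall x, `|h x| <= 1) ->
  (forall n, g (z n.+1) <= K / n.+1%:R) -> h (z n) * g (z n) @[n --> \oo] --> 0.
Proof.
move=> h1 gK; rewrite -(cvg_shiftS (fun n => h (z n) * g (z n))).
apply/norm_cvg0P; apply: (@squeeze_cvgr _ _ _ _ (cst 0) (fun n => K * n.+1%:R^-1)).
- near=> n; rewrite /= normr_ge0/= normrM (ger0_norm (g_ge0 _)).
  by rewrite (le_trans _ (gK n))// ler_piMl.
- exact: cvg_cst.
- by rewrite -(mulr0 K); apply: cvgMr; exact: cvg_harmonic.
Unshelve. all: end_near. Qed.

(* Integrating the derivative of sin (t z + c) * g z, and using g' z = - z / s^2 * g z,
shows with dF that F c solves the equation F' = - s^2 t F. *)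
Let F_ode c t : \int[mu]_z (sin (t * z + c) * (z * g z)) = s ^+ 2 * t * F c t.
Proof.
have ic : mu.-integrable setT (EFin \o (fun z => cos (t * z + c) * g z)).
  by apply: integrable_bounded_mul => // z; exact: norm_cos_le1.
have is_ : mu.-integrable setT (EFin \o (fun z => sin (t * z + c) * (z * g z))).
  by apply: integrable_bounded_mul => // z; exact: norm_sin_le1.
pose k z := sin (t * z + c) * g z.
pose k' z := t * (cos (t * z + c) * g z) - (s ^+ 2)^-1 * (sin (t * z + c) * (z * g z)).
have dk (z : R) : is_derive z 1 k (k' z).
  have dgz := dg z; rewrite /k; apply: is_derive_eq; rewrite /GRing.scale/= /k'.
  by field.
have cg : continuous g by exact: continuous_normal_pdf.
have caff : continuous (fun z : R => t * z + c).
  by move=> z; apply: cvgD; [apply: cvgM; [exact: cvg_cst|exact: cvg_id]|exact: cvg_cst].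
have ck' : continuous k'.
  move=> z; apply: cvgB; apply: cvgM; [exact: cvg_cst| |exact: cvg_cst|]; apply: cvgM.
  - by apply: continuous_comp; [exact: caff|exact: continuous_cos].
  - exact: cg.
  - by apply: continuous_comp; [exact: caff|exact: continuous_sin].
  - by apply: cvgM; [exact: cvg_id|exact: cg].
have itc : mu.-integrable setT (EFin \o (fun z => t * (cos (t * z + c) * g z))).
  exact: (integrableZl measurableT t ic).
have iss : mu.-integrable setT
    (EFin \o (fun z => (s ^+ 2)^-1 * (sin (t * z + c) * (z * g z)))).
  exact: (integrableZl measurableT _ is_).
have ik' : mu.-integrable setT (EFin \o k').
  exact: (integrableB measurableT itc iss).
have [K gK] := g_inv.
have := integral_derive_eq0 dk ck' ik' _ _.
rewrite RintegralB// !RintegralZl// => h.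
have {}h : t * F c t - (s ^+ 2)^-1 * \int[mu]_z (sin (t * z + c) * (z * g z)) = 0.
  apply: h.
  - by apply: (cvg_bounded_mul (h := fun z => sin (t * z + c)) (z := fun n => n%:R) (K := K)) =>
      [z|n]; [exact: norm_sin_le1|case: (gK n)].
  - by apply: (cvg_bounded_mul (h := fun z => sin (t * z + c)) (z := fun n => - n%:R) (K := K)) =>
      [z|n]; [exact: norm_sin_le1|case: (gK n)].
by move/eqP : h; rewrite subr_eq0 -mulrA => /eqP ->; rewrite mulVKf// expf_neq0.
Qed.

(** The product of F c t and exp (s^2 t^2 / 2) has derivative zero in t. *)
Lemma char_fun_normal_lebesgue c t :
  \int[mu]_z (cos (t * z + c) * g z) = cos c * expR (- (t ^+ 2 * s ^+ 2 / 2)).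
Proof.
pose H t := F c t * expR (s ^+ 2 * t ^+ 2 / 2).
have dH (u : R) : is_derive u 1 H 0.
  have := dF c u; rewrite F_ode => dFu.
  by apply: is_derive_eq; rewrite /GRing.scale/=; field.
have := @is_derive_0_is_cst _ H t 0 dH; rewrite /H.
have -> : F c 0 = cos c.
  rewrite /F; under eq_Rintegral do rewrite mul0r add0r.
  rewrite RintegralZl// [X in _ * X](_ : _ = 1) ?mulr1//.
  by rewrite /Rintegral integral_normal_pdf.
rewrite expr0n/= mulr0 mul0r expR0 mulr1 => <-.
by rewrite (mulrC (t ^+ 2)) expRN mulfK// gt_eqF// expR_gt0.
Qed.

Let normal_probE (A : set (measurableTypeR R)) : measurable A ->
  normal_prob 0 s A = (\int[mu]_(x in A) (g x)%:E)%E.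
Proof. by []. Qed.

Lemma char_fun_normal c t :
  \int[normal_prob 0 s]_z cos (t * z + c) =
  cos c * expR (- (t ^+ 2 * s ^+ 2 / 2)).
Proof.
rewrite -char_fun_normal_lebesgue.
refine (expect_density (mu := mu) (nu := normal_prob 0 s) mg g_ge0 normal_probE (bounded_mfun_cos (maff t c))).
Qed.

Lemma normal_tail : exists C, forall K, 0 < K ->
  \int[normal_prob 0 s]_z Num.min 1 (`|z| / K) <= C / K.
Proof.
set C := s * normal_peak s / normal_peak (Num.sqrt 2 * s).
exists C => K K0.
have mtail : measurable_fun setT (fun z : R => Num.min 1 (`|z| / K)).
  by apply: measurable_minr => //; apply: measurable_funM.
have tail01 (z : R) : 0 <= Num.min 1 (`|z| / K) <= 1.
  by rewrite le_min ler01 divr_ge0 ?(ltW K0)//= ge_min lexx.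
have btail : bounded_mfun (fun z : measurableTypeR R => Num.min 1 (`|z| / K)).
  split => //; exists 1 => z; have /andP[h1 h2] := tail01 z.
  by rewrite ger0_norm.
rewrite (expect_density (T := measurableTypeR R) (mu := mu)
  (nu := normal_prob 0 s) mg g_ge0 normal_probE)//.
have i2 := integrable_normal_pdf 0 (Num.sqrt 2 * s).
apply: (@le_trans _ _ (\int[mu]_z (C / K * normal_pdf 0 (Num.sqrt 2 * s) z))).
  apply: le_Rintegral => //.
  - exact: (integrable_bounded_density (T := measurableTypeR R) (mu := mu)
      (nu := normal_prob 0 s) mg g_ge0 normal_probE btail).
  - exact: (integrableZl measurableT (C / K) i2).
  - move=> z _; rewrite mulrAC ler_pdivlMr// (le_trans _ (absg_le z))//.
    rewrite mulrAC ler_wpM2r//.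
    by rewrite -ler_pdivlMr// ge_min lexx orbT.
rewrite RintegralZl// [X in _ * X](_ : _ = 1) ?mulr1//.
by rewrite /Rintegral integral_normal_pdf.
Qed.

End normal_char_fun.

(** * Uniform approximation by trigonometric polynomials *)

Section bernstein.
Context (R : realType).
Implicit Types (g h : nat -> R) (x v : R).

(** The expectation of g (S_n), for a sum S_n of n independent Bernoulli variables of
parameter x, computed by conditioning on the first one.  This form of the Bernstein
polynomial makes it obvious that any class of functions stable under linear
combinations and under multiplication by x contains it. *)
Fixpoint bernstein n g x : R :=
  if n is m.+1 then
    (1 - x) * bernstein m g x + x * bernstein m (fun k => g k.+1) x
  else g 0%N.

Lemma ler_bernstein n g h x : 0 <= x <= 1 ->
  (forall k, (k <= n)%N -> g k <= h k) -> bernstein n g x <= bernstein n h x.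
Proof.
move=> /[dup] x01 /andP[x0 x1]; elim: n g h => [|n ih] g h gh /=; first exact: gh.
rewrite lerD// ler_wpM2l ?subr_ge0// ih// => k kn; apply: gh => //.
exact: leqW.
Qed.

Lemma bernstein_affine n a b h x :
  bernstein n (fun k => a + b * h k) x = a + b * bernstein n h x.
Proof.
elim: n h => [//|n ih] h /=; rewrite ih (ih (fun k => h k.+1)); ring.
Qed.

(** The second moment of the binomial law around an arbitrary point. *)
Lemma bernstein_sqr n a x :
  bernstein n (fun k => (k%:R + a) ^+ 2) x = n%:R * x * (1 - x) + (n%:R * x + a) ^+ 2.
Proof.
elim: n a => [|n ih] a /=; first by ring.
rewrite ih.
have -> : bernstein n (fun k => (k.+1%:R + a) ^+ 2) x =
    bernstein n (fun k => (k%:R + (1 + a)) ^+ 2) x.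
  congr (bernstein n _ x); apply/funext => k.
  by rewrite -[in LHS]addn1 natrD addrA.
by rewrite ih -[in RHS](addn1 n) natrD; ring.
Qed.

(** Chebyshev's argument: the average of (k / n - x)^2 is x (1 - x) / n, at most 1 / n. *)
Lemma bernstein_approx n g x v e c : (0 < n)%N -> 0 <= x <= 1 -> 0 <= c ->
  (forall k, (k <= n)%N -> `|g k - v| <= e + c * (k%:R / n%:R - x) ^+ 2) ->
  `|bernstein n g x - v| <= e + c / n%:R.
Proof.
move=> n0 /[dup] x01 /andP[x0 x1] c0 gv.
have nn0 : n%:R != 0 :> R by rewrite pnatr_eq0 -lt0n.
pose q k : R := (k%:R + - (n%:R * x)) ^+ 2.
have qE k : c * (k%:R / n%:R - x) ^+ 2 = c / n%:R ^+ 2 * q k.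
  by rewrite /q; field.
have bq b a : a + b * bernstein n q x = a + b * (n%:R * x * (1 - x)).
  by rewrite bernstein_sqr addrN expr0n/= addr0.
have le1 : c / n%:R ^+ 2 * (n%:R * x * (1 - x)) <= c / n%:R.
  rewrite (_ : _ * (_ * _) = c / n%:R * (x * (1 - x))); last by field.
  rewrite ler_piMr ?divr_ge0//; have := sqr_ge0 x; nra.
rewrite ler_distl; apply/andP; split.
- apply: (@le_trans _ _ (bernstein n (fun k => (v - e) + (- (c / n%:R ^+ 2)) * q k) x)).
    rewrite bernstein_affine bq; lra.
  apply: ler_bernstein => // k kn; have := gv k kn.
  rewrite ler_distl qE => /andP[+ _]; lra.
- apply: (@le_trans _ _ (bernstein n (fun k => (v + e) + (c / n%:R ^+ 2) * q k) x)); last first.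
    rewrite bernstein_affine bq; lra.
  apply: ler_bernstein => // k kn; have := gv k kn.
  rewrite ler_distl qE => /andP[_]; lra.
Qed.

Lemma bernstein_bounded n g x M : 0 <= x <= 1 ->
  (forall k, `|g k| <= M) -> `|bernstein n g x| <= M.
Proof.
move=> x01 gM; have cst (a : R) : bernstein n (fun _ => a) x = a.
  rewrite -[RHS]addr0 -[X in _ + X](mul0r (bernstein n g x)) -bernstein_affine.
  by congr (bernstein n _ x); apply/funext => k; rewrite mul0r addr0.
rewrite ler_norml; apply/andP; split.
  by rewrite -(cst (- M)); apply: ler_bernstein => // k _; have := gM k; rewrite ler_norml => /andP[].
by rewrite -[leRHS](cst M); apply: ler_bernstein => // k _; have := gM k; rewrite ler_norml => /andP[].
Qed.

End bernstein.

Section sine_chart.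
Context (R : realType).
Variable K : R.
Hypothesis K_gt0 : 0 < K.

(** A chart of [-K, K] in [0, 1] which is at the same time a bounded trigonometric
function on the whole line.  The frequency keeps y / (2 * K) within [-1/2, 1/2], far
from the critical points of the sine. *)
Definition sine_chart (y : R) : R := (1 + sin (y / (2 * K))) / 2.

Lemma sine_chart01 y : 0 <= sine_chart y <= 1.
Proof.
rewrite /sine_chart; have := sin_le1 (y / (2 * K)); have := sin_geN1 (y / (2 * K)).
by move=> *; apply/andP; split; lra.
Qed.

(** A difference of sines is twice a product of a cosine and a sine of angles of absolute
value at most 1/2; there the cosine is at least 1/2 and |sin u| >= |u| / 2. *)
Lemma sine_chart_expansive y z : `|y| <= K -> `|z| <= K ->
  `|y - z| <= 16 * K * `|sine_chart y - sine_chart z|.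
Proof.
move=> yK zK; set a := y / (4 * K); set b := z / (4 * K).
have k4 : 0 < 4 * K by rewrite mulr_gt0.
have a4 : `|a| <= 1 / 4.
  rewrite normf_div (gtr0_norm k4) ler_pdivrMr//. rewrite div1r mulKf ?gt_eqF//.
have b4 : `|b| <= 1 / 4.
  rewrite normf_div (gtr0_norm k4) ler_pdivrMr//. rewrite div1r mulKf ?gt_eqF//.
have chartE : sine_chart y - sine_chart z = cos (a + b) * sin (a - b).
  have -> : sine_chart y - sine_chart z = (sin (y / (2 * K)) - sin (z / (2 * K))) / 2.
    by rewrite /sine_chart; field.
  have -> : y / (2 * K) = (a + b) + (a - b) by rewrite /a /b; field; rewrite gt_eqF.
  have -> : z / (2 * K) = (a + b) - (a - b) by rewrite /a /b; field; rewrite gt_eqF.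
  by rewrite sinB sinD; field.
have s2 : `|a + b| <= 1 / 2 by rewrite (le_trans (ler_normD _ _))//; lra.
have d2 : `|a - b| <= 1 / 2 by rewrite (le_trans (ler_normB _ _))//; lra.
have sqs (x : R) : `|x| <= 1 / 2 -> x ^+ 2 <= 1 / 4.
  by move=> x2; rewrite -(real_normK (num_real x)); have := normr_ge0 x; nra.
have c12 : 1 / 2 <= `|cos (a + b)|.
  rewrite (le_trans _ (ler_norm _))//.
  by have := cos_ge_quadratic (a + b); have := sqs _ s2; lra.
have s12 : `|a - b| / 2 <= `|sin (a - b)|.
  have h := norm_sin_sub_le (a - b).
  have : `|a - b| <= `|sin (a - b)| + `|sin (a - b) - (a - b)|.
    have -> : `|a - b| = `|sin (a - b) - (sin (a - b) - (a - b))| by rewrite subKr.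
    exact: ler_normB.
  have h3 : `|a - b| ^+ 3 <= `|a - b| / 4.
    rewrite exprSr -normrX ger0_norm ?sqr_ge0// mulrC ler_wpM2l//.
    by have := sqs _ d2; lra.
  have := normr_ge0 (a - b); lra.
rewrite chartE normrM.
have -> : y - z = 4 * K * (a - b) by rewrite /a /b; field; rewrite gt_eqF.
rewrite normrM (gtr0_norm k4).
have -> : 16 * K * (`|cos (a + b)| * `|sin (a - b)|) =
  4 * K * (4 * (`|cos (a + b)| * `|sin (a - b)|)) by ring.
rewrite ler_wpM2l ?(ltW k4)//.
have := ler_pM _ _ c12 s12; rewrite ?divr_ge0// => /(_ isT isT); lra.
Qed.

Lemma continuous_sine_chart : continuous sine_chart.
Proof.
move=> y; apply: cvgM; last exact: cvg_cst.
apply: cvgD; first exact: cvg_cst.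
apply: continuous_comp; last exact: continuous_sin.
by apply: cvgM; [exact: cvg_id|exact: cvg_cst].
Qed.

(** An approximate inverse of the chart.  The points k / n at which a Bernstein polynomial
samples its function need not be values of the chart on [-K, K]; minimizing the
distance to z costs a factor 2 only. *)
Lemma sine_chart_nearest z : exists y, `|y| <= K /\
  forall u, `|u| <= K -> `|y - u| <= 32 * K * `|z - sine_chart u|.
Proof.
have [||y yK ymin] := @EVT_min R (fun y => `|sine_chart y - z|) (- K) K.
- by move: K_gt0; lra.
- apply: continuous_subspaceT => y.
  by apply: cvg_norm; apply: cvgB; [exact: continuous_sine_chart|exact: cvg_cst].
have yK' : `|y| <= K by rewrite ler_norml; move: yK; rewrite in_itv.
exists y; split=> // u uK; rewrite (le_trans (sine_chart_expansive yK' uK))//.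
have -> : 32 * K * `|z - sine_chart u| = 16 * K * (`|z - sine_chart u| + `|z - sine_chart u|) by ring.
rewrite ler_wpM2l//; first by move: K_gt0; lra.
rewrite (le_trans (ler_distD z _ _))// lerD2r (distrC z) ymin//.
by rewrite in_itv/= -ler_norml.
Qed.

End sine_chart.

Section uniform_continuity.
Context (R : realType).

Lemma segment_unif_continuous (g : R -> R) (a b e : R) : continuous g -> 0 < e ->
  exists2 del, 0 < del & forall y z, a <= y <= b -> `|y - z| < del ->
    `|g y - g z| <= e.
Proof.
move=> cg e0.
pose P (del : R) (y : R) := forall z : R, `|y - z| < del -> `|g y - g z| <= e.
have near_P : \forall del \near 0^'+, `[a, b]%classic `<=` P del.
  have := @segment_compact R a b; rewrite compact_near_coveringP; apply => x _.
  have e2 : 0 < e / 2 by lra.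
  have /cvgrPdist_lt/(_ _ e2)/nbhs_ballP[eta /= eta0 hx] := cg x.
  exists (ball x (eta / 2), [set del : R | del < eta / 2]).
    split => /=; first by apply: nbhsx_ballx; lra.
    by apply: nbhs_right_lt; lra.
  move=> [y del] /= [xy dlt] z yz.
  have gy : `|g x - g y| < e / 2.
    by apply: hx; apply: (le_ball _ xy); lra.
  have gz : `|g x - g z| < e / 2.
    apply: hx; rewrite /ball/= in xy *.
    by rewrite (le_lt_trans (ler_distD y _ _))//; lra.
  rewrite (le_trans (ler_distD (g x) _ _))// (distrC (g y)); lra.
have [del del0 abP] : exists2 del, 0 < del & `[a, b]%classic `<=` P del.
  near (0:R)^'+ => del; exists del; first by near: del; exact: nbhs_right_gt.
  by near: del.
exists del => // y z yab; apply: abP.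
by rewrite /= in_itv.
Unshelve. all: end_near. Qed.

End uniform_continuity.

(** * The continuity theorem *)

Section continuity_theorem.
Context (R : realType) d (Om : measurableType d) (Q : probability Om R).
Variables (Y : nat -> Om -> R) (mu : probability (measurableTypeR R) R).
Hypothesis mY : forall n, measurable_fun setT (Y n).

Let cvg_test (psi : R -> R) :=
  \int[Q]_w psi (Y n w) @[n --> \oo] --> \int[mu]_y psi y.

Hypothesis cvg_cos : forall t c, cvg_test (fun y => cos (t * y + c)).

(* Multiplying by an arbitrary cosine strengthens the property so that it becomes stable
under multiplication by a sine. *)
Let trig_test (psi : R -> R) :=
  bounded_mfun (psi : measurableTypeR R -> R) /\
  forall t c, cvg_test (fun y => psi y * cos (t * y + c)).

Let mcos (t c : R) : bounded_mfun (fun y : measurableTypeR R => cos (t * y + c)).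
Proof.
by apply: bounded_mfun_cos; apply: measurable_funD => //; exact: measurable_funM.
Qed.

Let pullY psi n : bounded_mfun (psi : measurableTypeR R -> R) ->
  bounded_mfun (fun w => psi (Y n w)).
Proof. by move=> bpsi; exact: (bounded_mfun_pull bpsi (mY n)). Qed.

Let cvg_test_lin a b psi1 psi2 :
  bounded_mfun (psi1 : measurableTypeR R -> R) ->
  bounded_mfun (psi2 : measurableTypeR R -> R) ->
  cvg_test psi1 -> cvg_test psi2 -> cvg_test (fun y => a * psi1 y + b * psi2 y).
Proof.
move=> b1 b2 c1 c2; rewrite /cvg_test.
rewrite expectD ?expectZ//; [|exact: bounded_mfunZ..].
rewrite (_ : (fun _ => _) = fun n => a * (\int[Q]_w psi1 (Y n w)) +
    b * (\int[Q]_w psi2 (Y n w))); last first.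
  apply/funext => n; have b1n := pullY n b1; have b2n := pullY n b2.
  by rewrite expectD ?expectZ//; exact: bounded_mfunZ.
by apply: cvgD; apply: cvgMr.
Qed.

Let trig_test_cst a : trig_test (fun=> a).
Proof.
split=> [|t c]; first exact: bounded_mfun_cst.
have := cvg_test_lin (a := a) (b := 0) (mcos t c) (mcos t c) (@cvg_cos t c) (@cvg_cos t c).
by rewrite (_ : (fun _ => _) = (fun y => a * cos (t * y + c)))//;
  apply/funext => y; rewrite mul0r addr0.
Qed.

Let trig_test_lin a b psi1 psi2 : trig_test psi1 -> trig_test psi2 ->
  trig_test (fun y => a * psi1 y + b * psi2 y).
Proof.
move=> [b1 c1] [b2 c2]; split=> [|t c].
  by apply: bounded_mfunD; exact: bounded_mfunZ.
have := cvg_test_lin (a := a) (b := b) (bounded_mfunM b1 (mcos t c)) (bounded_mfunM b2 (mcos t c))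
  (c1 t c) (c2 t c).
rewrite (_ : (fun _ => _) = (fun y => (a * psi1 y + b * psi2 y) * cos (t * y + c)))//.
by apply/funext => y; rewrite mulrDl !mulrA.
Qed.

(* The product of a sine and a cosine is half a sum of two sines, and sin v is
cos (v - pi / 2). *)
Let trig_test_sin u psi : trig_test psi -> trig_test (fun y => sin (u * y) * psi y).
Proof.
move=> [bpsi cpsi]; split=> [|t c].
  by apply: bounded_mfunM => //; apply: bounded_mfun_sin; exact: measurable_funM.
pose p := pi / 2 : R.
have := cvg_test_lin (a := 1 / 2) (b := 1 / 2)
  (bounded_mfunM bpsi (mcos (u + t) (c - p)))
  (bounded_mfunM bpsi (mcos (u - t) (- c - p)))
  (cpsi (u + t) (c - p)) (cpsi (u - t) (- c - p)).
rewrite (_ : (fun _ => _) = (fun y => sin (u * y) * psi y * cos (t * y + c)))//.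
apply/funext => y.
have cosp (x : R) : cos (x - p) = sin x.
  by rewrite cosB /p cos_pihalf sin_pihalf mulr0 mulr1 add0r.
have -> : (u + t) * y + (c - p) = (u * y + (t * y + c)) - p by ring.
have -> : (u - t) * y + (- c - p) = (u * y - (t * y + c)) - p by ring.
by rewrite !cosp sinD sinB; field.
Qed.

Let trig_test_bernstein K n (g : nat -> R) :
  trig_test (fun y => bernstein n g (sine_chart K y)).
Proof.
elim: n g => [|n ih] g /=; first exact: trig_test_cst.
have step psi : trig_test psi -> trig_test (fun y => sine_chart K y * psi y).
  move=> tpsi.
  have := trig_test_lin (1 / 2) (1 / 2) tpsi (trig_test_sin (2 * K)^-1 tpsi).
  rewrite (_ : (fun _ => _) = (fun y => sine_chart K y * psi y))//.
  by apply/funext => y; rewrite /sine_chart (mulrC y); field.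
have := trig_test_lin 1 1 (trig_test_lin 1 (-1) (ih g) (step _ (ih g)))
  (step _ (ih (fun k => g k.+1))).
rewrite (_ : (fun _ => _) = (fun y => (1 - sine_chart K y) * bernstein n g (sine_chart K y) +
   sine_chart K y * bernstein n (fun k : nat => g k.+1) (sine_chart K y)))//.
by apply/funext => y; ring.
Qed.

(* A bounded substitute for the probability that |y| > K. *)
Variable C : R.
Let tail K (y : R) := Num.min 1 (`|y| / K).
Hypothesis tail_mu : forall K, 0 < K -> \int[mu]_y tail K y <= C / K.
Hypothesis tail_Y : \forall n \near \oo, forall K, 0 < K ->
  \int[Q]_w tail K (Y n w) <= C / K.

Let tail01 K (y : R) : 0 < K -> 0 <= tail K y <= 1.
Proof.
by move=> K0; rewrite le_min ler01 divr_ge0 ?(ltW K0)//= ge_min lexx.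
Qed.

Let btail K : 0 < K -> bounded_mfun (tail K : measurableTypeR R -> R).
Proof.
move=> K0; split; first by apply: measurable_minr => //; apply: measurable_funM.
by exists 1 => z; have /andP[h1 h2] := tail01 z K0; rewrite ger0_norm.
Qed.

(* On [-K, K], uniform continuity gives |g y - g z| <= e + c' * |y - z|^2, hence a bound
in terms of the squared distance in the chart, to which the estimate of
Bernstein polynomials applies.  Outside, both functions are bounded by M. *)
Let approx (g : R -> R) M e K : continuous g -> (forall y, `|g y| <= M) ->
  0 < e -> 0 < K ->
  exists2 psi, trig_test psi & forall y, `|g y - psi y| <= 2 * e + 2 * M * tail K y.
Proof.
move=> cg gM e0 K0.
have M0 : 0 <= M by rewrite (le_trans _ (gM 0)).
have [del del0 gdel] := segment_unif_continuous (- K) K cg e0.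
pose c := 2 * M * (32 * K / del) ^+ 2.
have c0 : 0 <= c by rewrite mulr_ge0 ?sqr_ge0// mulr_ge0.
have [r rP] := choice (sine_chart_nearest K0).
pose n := (Num.truncn (c / e)).+1.
have n0 : (0 < n)%N by [].
have cn : c / n%:R <= e.
  rewrite ler_pdivrMr// mulrC -ler_pdivrMr//.
  by rewrite ltW// truncnS_gt.
pose gk k := g (r (k%:R / n%:R)).
exists (fun y => bernstein n gk (sine_chart K y)).
  exact: trig_test_bernstein.
move=> y; have /andP[t0 t1] := tail01 y K0.
have [yK|yK] := leP `|y| K; last first.
  have -> : tail K y = 1.
    by rewrite /tail; apply/min_idPl; rewrite ler_pdivlMr// mul1r ltW.
  have := @bernstein_bounded R n gk (sine_chart K y) M (sine_chart01 K y) (fun k => gM _).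
  have := gM y => gMy bM.
  by rewrite (le_trans (ler_normB _ _))//; lra.
have : `|bernstein n gk (sine_chart K y) - g y| <= e + c / n%:R.
  apply: bernstein_approx => // [|k kn]; first exact: sine_chart01.
  have [rK rle] := rP (k%:R / n%:R).
  have [near|far] := ltP `|r (k%:R / n%:R) - y| del.
    have rK' : - K <= r (k%:R / n%:R) <= K by rewrite -ler_norml.
    by rewrite (le_trans (gdel _ _ rK' near))// lerDl mulr_ge0// sqr_ge0.
  apply: (@le_trans _ _ (2 * M)).
    apply: (le_trans (ler_normB _ _)); rewrite /gk.
    by have := gM y; have := gM (r (k%:R / n%:R)); lra.
  apply: (@le_trans _ _ (c * (k%:R / n%:R - sine_chart K y) ^+ 2)); last by rewrite lerDr ltW.
  rewrite /c -mulrA ler_peMr ?mulr_ge0//.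
  rewrite -exprMn -(real_normK (num_real (_ * _))) exprn_ege1//.
  rewrite normrM (gtr0_norm (divr_gt0 (mulr_gt0 _ K0) del0))//.
  rewrite mulrAC ler_pdivlMr// mul1r (le_trans far)//.
  exact: rle.
rewrite distrC => h; rewrite (le_trans h)//.
have : 0 <= 2 * M * tail K y by rewrite !mulr_ge0.
lra.
Qed.

(** Convergence of the characteristic functions (in the form of all the integrals of
cos (t y + c)) and a uniform tail bound of order 1 / K imply convergence in
distribution. *)
Lemma continuity_theorem : cvg_in_distribution Q Y mu.
Proof.
split=> // g cg [M0 [_ gM0]].
pose M := `|M0| + 1.
have gM y : `|g y| <= M by apply: gM0 => //; rewrite /M ltr_pwDr// ler_norm.
have Mg0 : 0 < M by rewrite ltr_pwDr.
have bg : bounded_mfun (g : measurableTypeR R -> R).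
  by split; [exact: continuous_measurable_fun|exists M].
apply/cvgrPdist_le => e e0.
have C0 : 0 <= C.
  have := tail_mu ltr01; rewrite divr1; apply: le_trans.
  by apply: Rintegral_ge0 => y _; have /andP[] := tail01 y ltr01.
pose K := 8 * M * (C + 1) / e.
have K0 : 0 < K by rewrite divr_gt0// mulr_gt0//; lra.
have e10 : 0 < e / 10 by rewrite divr_gt0.
have [psi [bpsi cpsi] gpsi] := approx cg gM e10 K0.
have CK : 2 * M * (C / K) <= e / 4.
  rewrite (_ : 2 * M * (C / K) = e / 4 * (C / (C + 1))); last first.
    by rewrite /K; field; do !(apply/andP; split => //); rewrite gt_eqF//; lra.
  by rewrite ler_piMr ?divr_ge0 ?(ltW e0)// ler_pdivrMr; lra.
have bt := btail K0.
have err d' (T : measurableType d') (P : probability T R) (Z : T -> R) :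
    measurable_fun setT Z -> \int[P]_x tail K (Z x) <= C / K ->
    `|\int[P]_x g (Z x) - \int[P]_x psi (Z x)| <= e / 5 + e / 4.
  move=> mZ tZ.
  have bgZ : bounded_mfun (fun x => g (Z x)) := bounded_mfun_pull bg mZ.
  have bpZ : bounded_mfun (fun x => psi (Z x)) := bounded_mfun_pull bpsi mZ.
  have btZ : bounded_mfun (fun x => tail K (Z x)) := bounded_mfun_pull bt mZ.
  rewrite -expectB//; apply: (le_trans (le_norm_expect P (bounded_mfunB bgZ bpZ))).
  apply: (@le_trans _ _ (\int[P]_x (2 * (e / 10) + 2 * M * tail K (Z x)))).
    apply: le_expect => //; first by apply: bounded_mfun_norm; exact: bounded_mfunB.
    by apply: bounded_mfunD; [exact: bounded_mfun_cst|exact: bounded_mfunZ].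
  rewrite expectD; [|exact: bounded_mfun_cst|exact: bounded_mfunZ].
  rewrite expect_cst expectZ//.
  have : 2 * M * \int[P]_x tail K (Z x) <= 2 * M * (C / K).
    by rewrite ler_wpM2l// mulr_ge0// ltW.
  lra.
have cp : cvg_test psi.
  have := cpsi 0 0; rewrite /cvg_test.
  by under [X in _ --> X]eq_Rintegral do rewrite mul0r add0r cos0 mulr1;
    under eq_fun do under eq_Rintegral do rewrite mul0r add0r cos0 mulr1.
move/cvgrPdist_le : cp => /(_ (e / 20)) cp.
have e20 : 0 < e / 20 by rewrite divr_gt0.
near=> n.
have h1 : `|\int[mu]_y psi y - \int[Q]_w psi (Y n w)| <= e / 20.
  by near: n; exact: cp.
have h2 : `|\int[mu]_y g y - \int[mu]_y psi y| <= e / 5 + e / 4.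
  by apply: (err _ _ mu (fun y => y)) => //; exact: tail_mu.
have hn : forall K', 0 < K' -> \int[Q]_w tail K' (Y n w) <= C / K'.
  by near: n; exact: tail_Y.
have h3 : `|\int[Q]_w g (Y n w) - \int[Q]_w psi (Y n w)| <= e / 5 + e / 4.
  by apply: (err _ _ Q (Y n)) => //; exact: hn.
rewrite (le_trans (ler_distD (\int[mu]_y psi y) _ _))//.
have := ler_distD (\int[Q]_w psi (Y n w)) (\int[mu]_y psi y) (\int[Q]_w g (Y n w)).
rewrite (distrC (\int[Q]_w psi (Y n w)) (\int[Q]_w g (Y n w))).
lra.
Unshelve. all: end_near. Qed.

End continuity_theorem.

(** * Second moments of sums and of degenerate U-statistics *)

Section pair_sums.
Context (R : realFieldType).

(** Every index belongs to n - 1 pairs. *)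
Lemma sum_pairs_add n (a : 'I_n -> R) :
  \sum_(i < n) \sum_(j < n | (i < j)%N) (a i + a j) =
  n.-1%:R * \sum_(i < n) a i.
Proof.
under eq_bigr do rewrite big_split/=.
rewrite big_split/= [X in _ + X](_ : _ =
    \sum_(i < n) \sum_(j < n | (j < i)%N) a i); last first.
  by rewrite (exchange_big_dep xpredT).
rewrite -big_split/= mulr_sumr; apply: eq_bigr => i _.
rewrite [X in X + _]big_mkcond [X in _ + X]big_mkcond -big_split/=.
rewrite (eq_bigr (fun j : 'I_n => if j != i then a i else 0)); last first.
  move=> j _; rewrite -val_eqE neq_ltn.
  by case: (ltngtP i j); rewrite ?addr0 ?add0r.
by rewrite -big_mkcond/= sumr_const cardC1 card_ord mulr_natl.
Qed.

Lemma sum_pairs1 n : \sum_(i < n) \sum_(j < n | (i < j)%N) (1 : R) = 'C(n, 2)%:R.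
Proof.
have := sum_pairs_add (fun _ : 'I_n => 1 / 2 : R).
under eq_bigr do under eq_bigr do rewrite -splitr.
move=> ->; rewrite sumr_const card_ord -mulr_natr.
have : 2 * 'C(n, 2)%:R = (n * n.-1)%:R :> R.
  by rewrite -natrM -mul_bin_diag bin1.
rewrite natrM => h.
have -> : 'C(n, 2)%:R = 2 * 'C(n, 2)%:R / 2 :> R by field.
by rewrite h; ring.
Qed.

End pair_sums.

Section second_moments.
Context (R : realType) d (Om : measurableType d) (Q : probability Om R).
Context d' (T : measurableType d') (P : probability T R).
Variable X : nat -> {RV Q >-> T}.
Hypothesis X_indep : mutually_independent X.
Hypothesis X_law : identically_distributed X P.

Lemma bounded_mfun_coord (phi : T -> R) i :
  bounded_mfun phi -> bounded_mfun (fun w => phi (X i w)).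
Proof. by move=> bphi; apply: bounded_mfun_pull. Qed.

Lemma expect_coord (phi : T -> R) i : bounded_mfun phi ->
  \int[Q]_w phi (X i w) = \int[P]_y phi y.
Proof.
move=> bphi.
have bF : bounded_mfun (fun z : T * measurableTypeR R => phi z.1).
  by apply: (bounded_mfun_pull bphi); exact: measurable_fst.
rewrite (law_coord_past (T2 := measurableTypeR R) X_indep X_law (a := i) (s := [::])
  (W := fun=> 0) (F := fun z => phi z.1))//.
by rewrite expect_cst.
Qed.

Lemma expect_pair (F : T * T -> R) i j : i != j -> bounded_mfun F ->
  \int[Q]_w F (X i w, X j w) = \int[P]_z \int[P]_y F (y, z).
Proof.
move=> ij bF.
rewrite (law_coord_past X_indep X_law (a := i) (s := [:: j]) (W := X j))//=; last 2 first.
- by rewrite inE ij.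
- by apply: measurable_cylinder_coord; rewrite mem_head.
by rewrite (expect_coord j (bounded_mfun_expect P bF)).
Qed.

Lemma expect_sqr_sum (phi : T -> R) n : bounded_mfun phi ->
  \int[P]_y phi y = 0 ->
  \int[Q]_w (\sum_(i < n) phi (X i w)) ^+ 2 = n%:R * \int[P]_y phi y ^+ 2.
Proof.
move=> bphi phi0.
have bp i : bounded_mfun (fun w => phi (X i w)) by exact: bounded_mfun_coord.
under eq_Rintegral do rewrite expr2 big_distrlr/=.
rewrite expect_sum; last by move=> i; apply: bounded_mfun_sum => j; exact: bounded_mfunM.
rewrite (eq_bigr (fun=> \int[P]_y phi y ^+ 2)); last first.
  move=> i _; rewrite expect_sum; last by move=> j; exact: bounded_mfunM.
  rewrite (bigD1 i)//= big1 ?addr0; last first.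
    move=> j ji; rewrite (expect_pair (F := fun z => phi z.1 * phi z.2)) 1?eq_sym//; last first.
      apply: bounded_mfunM; apply: (bounded_mfun_pull bphi).
        exact: measurable_fst.
      exact: measurable_snd.
    transitivity (\int[P]_z (0 : R)); last by rewrite expect_cst.
    apply: eq_Rintegral => z _ /=; under eq_Rintegral do rewrite mulrC.
    by rewrite expectZ// phi0 mulr0.
  under eq_Rintegral do rewrite -expr2.
  by rewrite (expect_coord i (phi := fun y => phi y ^+ 2))//; exact: bounded_mfunX.
by rewrite sumr_const card_ord mulr_natl.
Qed.

End second_moments.

Section hoeffding.
Context (R : realType) d (Om : measurableType d) (Q : probability Om R).
Context d' (T : measurableType d') (P : probability T R).
Variable X : nat -> {RV Q >-> T}.
Hypothesis X_indep : mutually_independent X.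
Hypothesis X_law : identically_distributed X P.

Section degenerate.
Variable g : T * T -> R.
Hypothesis bg : bounded_mfun g.
Hypothesis g_sym : forall y z, g (y, z) = g (z, y).
Hypothesis g_degenerate : forall z, \int[P]_y g (y, z) = 0.

Let bgX i j : bounded_mfun (fun w => g (X i w, X j w)).
Proof. by apply: (bounded_mfun_pull bg); exact: measurable_fun_pair. Qed.

(* The observation X i occurs only once, so that it can be integrated out, and then the
degeneracy of g applies. *)
Let expect_unshared i j k l : i != j -> i != k -> i != l ->
  \int[Q]_w (g (X i w, X j w) * g (X k w, X l w)) = 0.
Proof.
move=> ij ik il.
pose s := undup [:: j; k; l].
have us : uniq (i :: s).
  by rewrite /= undup_uniq mem_undup !inE !negb_or ij ik il.
have sP m : m \in [:: j; k; l] -> m \in s by rewrite mem_undup.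
pose W w := (X j w, (X k w, X l w)).
have mW : measurable_fun setT (W : g_sigma_algebraType (cylinder X s) -> _).
  apply: measurable_fun_pair; first by apply: measurable_cylinder_coord; rewrite sP// !inE eqxx.
  by apply: measurable_fun_pair; apply: measurable_cylinder_coord; rewrite sP// !inE eqxx ?orbT.
pose F (z : T * (T * (T * T))) := g (z.1, z.2.1) * g z.2.2.
have m21 : measurable_fun setT (fun z : T * (T * (T * T)) => z.2.1).
  by apply: (measurableT_comp (f := fst)); [exact: measurable_fst|exact: measurable_snd].
have m22 : measurable_fun setT (fun z : T * (T * (T * T)) => z.2.2).
  by apply: (measurableT_comp (f := snd)); exact: measurable_snd.
have bF : bounded_mfun F.
  apply: bounded_mfunM; apply: (bounded_mfun_pull bg) => //.
  by apply: measurable_fun_pair => //; exact: measurable_fst.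
rewrite (law_coord_past X_indep X_law us mW bF).
transitivity (\int[Q]_w (0 : R)); last by rewrite expect_cst.
apply: eq_Rintegral => w _; rewrite /F/=.
under eq_Rintegral do rewrite mulrC.
rewrite expectZ ?g_degenerate ?mulr0//.
by apply: (bounded_mfun_pull bg); exact: measurable_fun_pair.
Qed.

Let expect_off_diagonal (i j k l : nat) : (i < j)%N -> (k < l)%N -> (i, j) != (k, l) ->
  \int[Q]_w (g (X i w, X j w) * g (X k w, X l w)) = 0.
Proof.
move=> ij kl ijkl; have nij : i != j by rewrite ltn_eqF.
have [ik|ik] := eqVneq i k.
  under eq_Rintegral do rewrite g_sym.
  apply: expect_unshared; first by rewrite eq_sym.
    by rewrite -ik eq_sym.
  by apply: contraNneq ijkl => jl; rewrite ik jl.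
have [il|il] := eqVneq i l; last exact: expect_unshared.
under eq_Rintegral do rewrite g_sym.
apply: expect_unshared; first by rewrite eq_sym.
- by rewrite gtn_eqF// (ltn_trans kl)// -il.
- by rewrite -il eq_sym.
Qed.

(** Two distinct increasing pairs differ by an index that belongs to one of them only: the
terms of the double sum are orthogonal. *)
Lemma expect_sqr_degenerate n :
  \int[Q]_w (\sum_(i < n) \sum_(j < n | (i < j)%N) g (X i w, X j w)) ^+ 2 =
  'C(n, 2)%:R * \int[P]_z \int[P]_y g (y, z) ^+ 2.
Proof.
pose G (p : 'I_n * 'I_n) w := if (p.1 < p.2)%N then g (X p.1 w, X p.2 w) else 0.
have bG p : bounded_mfun (G p).
  by rewrite /G; case: (p.1 < p.2)%N; [exact: bgX|exact: bounded_mfun_cst].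
have GE w : \sum_(i < n) \sum_(j < n | (i < j)%N) g (X i w, X j w) = \sum_p G p w.
  rewrite /G -(pair_bigA _ (fun i j : 'I_n =>
    if (i < j)%N then g (X i w, X j w) else 0))/=.
  by apply: eq_bigr => i _; rewrite big_mkcond.
under eq_Rintegral do rewrite GE expr2 big_distrlr/=.
rewrite expect_sum; last by move=> p; apply: bounded_mfun_sum => q; exact: bounded_mfunM.
rewrite (eq_bigr (fun p : 'I_n * 'I_n =>
    if (p.1 < p.2)%N then \int[P]_z \int[P]_y g (y, z) ^+ 2 else 0)); last first.
  move=> p _; rewrite expect_sum; last by move=> q; exact: bounded_mfunM.
  rewrite (bigD1 p)//= big1 ?addr0; last first.
    move=> q qp; rewrite /G; case: (boolP (p.1 < p.2)%N) => p12; last first.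
      by under eq_Rintegral do rewrite mul0r; rewrite expect_cst.
    case: (boolP (q.1 < q.2)%N) => q12; last first.
      by under eq_Rintegral do rewrite mulr0; rewrite expect_cst.
    apply: expect_off_diagonal => //; apply: contraNneq qp => -[/val_inj e1 /val_inj e2].
    by rewrite (surjective_pairing p) (surjective_pairing q) e1 e2.
  rewrite /G; case: (boolP (p.1 < p.2)%N) => p12; last first.
    by under eq_Rintegral do rewrite mul0r; rewrite expect_cst.
  under eq_Rintegral do rewrite -expr2.
  rewrite (expect_pair X_indep X_law (F := fun z => g z ^+ 2))//.
    by rewrite ltn_eqF.
  exact: bounded_mfunX.
set E := \int[P]_z _.
rewrite -(pair_bigA _ (fun i j : 'I_n => if (i < j)%N then E else 0))/=.
rewrite -(sum_pairs1 R) mulr_suml; apply: eq_bigr => i _.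
by rewrite -big_mkcond/= mulr_suml; apply: eq_bigr => j _; rewrite mul1r.
Qed.

End degenerate.

(** * The Hoeffding decomposition *)

Variable h : T * T -> R.
Hypothesis mh : measurable_fun setT h.
Hypothesis h01 : forall z, 0 <= h z <= 1.
Hypothesis h_sym : forall y z, h (y, z) = h (z, y).

(** The conditional expectation of the kernel given one of its arguments. *)
Definition hoeffding_proj y := \int[P]_z h (z, y).
Let h1 := hoeffding_proj.
Let theta := \int[P]_y h1 y.
Let g z := h z - (h1 z.1 - theta) - (h1 z.2 - theta) - theta.

Let bh : bounded_mfun h.
Proof. by split=> //; exists 1 => z; have /andP[h0 ?] := h01 z; rewrite ger0_norm. Qed.

Let bhy y : bounded_mfun (fun z => h (z, y)).
Proof. by apply: (bounded_mfun_pull bh); exact: measurable_fun_pair. Qed.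

Lemma bounded_mfun_hoeffding_proj : bounded_mfun h1.
Proof. exact: (bounded_mfun_expect P bh). Qed.

Lemma hoeffding_proj01 y : 0 <= h1 y <= 1.
Proof.
apply/andP; split; first by apply: Rintegral_ge0 => z _; have /andP[] := h01 (z, y).
rewrite -(expect_cst P 1); apply: le_expect => //; first exact: bounded_mfun_cst.
by move=> z; have /andP[] := h01 (z, y).
Qed.

Let bh1 := bounded_mfun_hoeffding_proj.

Let theta01 : 0 <= theta <= 1.
Proof.
apply/andP; split; first by apply: Rintegral_ge0 => z _; have /andP[] := hoeffding_proj01 z.
rewrite -(expect_cst P 1); apply: le_expect => //; first exact: bounded_mfun_cst.
by move=> z; have /andP[] := hoeffding_proj01 z.
Qed.

Let h1E z : \int[P]_y h (y, z) = h1 z. Proof. by []. Qed.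

Let thetaE : \int[P]_y h1 y = theta. Proof. by []. Qed.

Let bfst : bounded_mfun (fun z : T * T => h1 z.1).
Proof. by apply: (bounded_mfun_pull bh1); exact: measurable_fst. Qed.

Let bsnd : bounded_mfun (fun z : T * T => h1 z.2).
Proof. by apply: (bounded_mfun_pull bh1); exact: measurable_snd. Qed.

Let bg : bounded_mfun g.
Proof.
have bt := bounded_mfun_cst (T * T)%type theta.
exact: (bounded_mfunB (bounded_mfunB (bounded_mfunB bh (bounded_mfunB bfst bt))
  (bounded_mfunB bsnd bt)) bt).
Qed.

Let g_sym y z : g (y, z) = g (z, y).
Proof. by rewrite /g/= h_sym; ring. Qed.

Let g_degenerate z : \int[P]_y g (y, z) = 0.
Proof.
rewrite (_ : (fun _ => _) = (fun y => (h (y, z) - h1 y) - (h1 z - theta))).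
  rewrite expectB; [|exact: bounded_mfunB|exact: bounded_mfun_cst].
  rewrite expectB// expect_cst h1E thetaE; ring.
by apply/funext => y; rewrite /g/=; ring.
Qed.

(** The degenerate part is a sum of four terms with values in [0, 1] up to sign.  Hence its
square is at most 4 times their sum, whose expectation is 4 theta. *)
Lemma hoeffding_remainder n :
  \int[Q]_w (\sum_(i < n) \sum_(j < n | (i < j)%N) g (X i w, X j w)) ^+ 2 <=
  'C(n, 2)%:R * (16 * theta).
Proof.
rewrite expect_sqr_degenerate// ler_wpM2l//.
have b2 : bounded_mfun (fun z => g z ^+ 2) by exact: bounded_mfunX.
pose k (z : T * T) := 4 * (h z + (h1 z.1 + (h1 z.2 + theta))).
have bk : bounded_mfun k.
  have bt := bounded_mfun_cst (T * T)%type theta.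
  exact: (bounded_mfunZ 4 (bounded_mfunD bh (bounded_mfunD bfst (bounded_mfunD bsnd bt)))).
have gk z : g z ^+ 2 <= k z.
  have /andP[a0 a1] := h01 z; have /andP[b0 b1] := hoeffding_proj01 z.1.
  have /andP[c0 c1] := hoeffding_proj01 z.2; have /andP[d0 d1] := theta01.
  rewrite /g /k; move: (h z) (h1 z.1) (h1 z.2) theta a0 a1 b0 b1 c0 c1 d0 d1 => a b c e *.
  rewrite (_ : a - _ - _ - _ = a - b - c + e); last by ring.
  have := sqr_ge0 (a + b); have := sqr_ge0 (a + c); have := sqr_ge0 (a - e).
  have := sqr_ge0 (b - c); have := sqr_ge0 (b + e); have := sqr_ge0 (c + e).
  nra.
have kE : \int[P]_z \int[P]_y k (y, z) = 16 * theta.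
  transitivity (\int[P]_z (8 * h1 z + 8 * theta)).
    apply: eq_Rintegral => z _; rewrite /k/=.
    have bt (a : R) := bounded_mfun_cst T a.
    have b1 := bounded_mfunD (bt (h1 z)) (bt theta).
    have b12 := bounded_mfunD bh1 b1.
    rewrite expectZ; last exact: (bounded_mfunD (bhy z) b12).
    rewrite (expectD P (bhy z) b12) (expectD P bh1 b1).
    rewrite expect_cst h1E thetaE; ring.
  rewrite expectD; [|exact: bounded_mfunZ|exact: bounded_mfun_cst].
  by rewrite expectZ// expect_cst thetaE; ring.
rewrite -kE; apply: le_expect; [exact: (bounded_mfun_expect P b2)|exact: (bounded_mfun_expect P bk)|].
move=> z; apply: le_expect => [||y]; last exact: gk.
- by apply: (bounded_mfun_pull b2); exact: measurable_fun_pair.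
- by apply: (bounded_mfun_pull bk); exact: measurable_fun_pair.
Qed.

Lemma hoeffding_decomposition n (x : nat -> T) : (1 < n)%N ->
  'C(n, 2)%:R^-1 * (\sum_(i < n) \sum_(j < n | (i < j)%N) h (x i, x j)) - theta =
  2 / n%:R * (\sum_(i < n) (h1 (x i) - theta)) +
  'C(n, 2)%:R^-1 * \sum_(i < n) \sum_(j < n | (i < j)%N) g (x i, x j).
Proof.
move=> n1; have c0 : 'C(n, 2)%:R != 0 :> R by rewrite pnatr_eq0 -lt0n bin_gt0.
have n0 : n%:R != 0 :> R by rewrite pnatr_eq0 -lt0n (ltn_trans _ n1).
have n10 : n.-1%:R != 0 :> R by rewrite pnatr_eq0 -lt0n -subn1 subn_gt0.
have C2 : 2 * 'C(n, 2)%:R = n%:R * n.-1%:R :> R.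
  by rewrite -!natrM -mul_bin_diag bin1.
have -> : \sum_(i < n) \sum_(j < n | (i < j)%N) h (x i, x j) =
    \sum_(i < n) \sum_(j < n | (i < j)%N) g (x i, x j) +
    n.-1%:R * (\sum_(i < n) (h1 (x i) - theta)) + 'C(n, 2)%:R * theta.
  rewrite -(sum_pairs_add (fun i : 'I_n => h1 (x i) - theta)) -(sum_pairs1 R) mulr_suml.
  rewrite -!big_split/=; apply: eq_bigr => i _.
  by rewrite mulr_suml -!big_split/=; apply: eq_bigr => j _; rewrite /g/=; ring.
have -> : 2 / n%:R = 'C(n, 2)%:R^-1 * n.-1%:R :> R.
  have -> : n.-1%:R = 2 * 'C(n, 2)%:R / n%:R :> R by rewrite C2 mulrC mulKf.
  by field; rewrite n0.
by field.
Qed.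

Lemma hoeffding_linear_sqr n :
  \int[Q]_w (\sum_(i < n) (h1 (X i w) - theta)) ^+ 2 =
  n%:R * \int[P]_y (h1 y - theta) ^+ 2.
Proof.
have bc : bounded_mfun (fun y => h1 y - theta).
  by apply: bounded_mfunB => //; exact: bounded_mfun_cst.
rewrite (expect_sqr_sum X_indep X_law (phi := fun y => h1 y - theta))//.
rewrite expectB//; last exact: bounded_mfun_cst.
by rewrite expect_cst subrr.
Qed.

End hoeffding.

(** * Affine changes of variables *)

Section lebesgue_line.
Context (R : realType).
Variables (a t : R).
Hypothesis t_gt0 : 0 < t.
Local Open Scope ereal_scope.

Let s (y : measurableTypeR R) : measurableTypeR R := (t^-1 * (y - a))%R.

Let ms : measurable_fun setT s.
Proof. by apply: measurable_funM => //; exact: measurable_funB. Qed.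

Let pushS : {measure set (measurableTypeR R) -> \bar R} :=
  measure_function_pushforward__canonical__measure_function_Measure
    (@lebesgue_measure R) ms.

Let t_ge0 : (0 <= t)%R. Proof. exact: ltW. Qed.
Let ti_ge0 : (0 <= t^-1)%R. Proof. by rewrite invr_ge0. Qed.

Let mu1 : {measure set (measurableTypeR R) -> \bar R} :=
  mscale (NngNum ti_ge0) pushS.

Let mu1E A : measurable A -> lebesgue_measure A = mu1 A.
Proof.
apply: lebesgue_measure_unique => _ [[u v] _ <-] /=.
rewrite /mu1 /mscale/= /pushforward.
have -> : s @^-1` `]u, v]%classic = `](t * u + a)%R, (t * v + a)%R]%classic.
  apply/seteqP; split=> y /=; rewrite !in_itv/= /s.
    by rewrite ltr_pdivlMl// ler_pdivrMl// ltrBrDr lerBlDr.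
  by rewrite ltr_pdivlMl// ler_pdivrMl// ltrBrDr lerBlDr.
rewrite !lebesgue_measure_itv/= !lte_fin ltrD2r ltr_pM2l//.
case: ifPn => // _; last by rewrite mule0.
by rewrite -!EFinB -EFinM; congr EFin; field; rewrite gt_eqF.
Qed.

Lemma ge0_integral_lebesgue_affine (G : R -> \bar R) :
  measurable_fun setT G -> (forall y, 0 <= G y) ->
  \int[lebesgue_measure]_y G (t^-1 * (y - a))%R =
  t%:E * \int[lebesgue_measure]_y G y.
Proof.
move=> mG G0.
rewrite [in RHS](eq_measure_integral mu1); last by move=> A mA _; exact: mu1E.
rewrite ge0_integral_mscale// (ge0_integral_pushforward ms)//.
by rewrite muleA -EFinM/= divff ?mul1e// gt_eqF.
Qed.

End lebesgue_line.

Section lebesgue_space.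
Context (R : realType).
Local Open Scope ereal_scope.

Lemma measurable_affine p (x : 'rV[R]_p) (t : R) :
  measurable_fun [set: 'rV[R]_p] (fun y => (t^-1 *: (y - x))%R : 'rV[R]_p).
Proof.
apply/measurable_fun_rVP => i.
rewrite (_ : (fun _ => _) = (fun y : 'rV[R]_p => t^-1 * (y ord0 i - x ord0 i))%R).
  by apply: measurable_funM => //; apply: measurable_funB => //; exact: measurable_coord.
by apply/funext => y; rewrite !mxE.
Qed.

(** Induction on the dimension: the measure of a set is the integral of the measures of its
sections along the first coordinate, and the affine map acts on this coordinate
and on the sections separately. *)
Lemma lebesgue_rV_affine p (x : 'rV[R]_p) (t : R) (A : set 'rV[R]_p) :
  (0 < t)%R -> measurable A ->
  lebesgue_rV ((fun y => (t^-1 *: (y - x))%R : 'rV[R]_p) @^-1` A) =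
  (t ^+ p)%:E * lebesgue_rV A.
Proof.
move=> t0; elim: p x A => [|p IH] x A mA.
  rewrite expr0 mul1e /= !diracE; congr (_%:R%:E); congr nat_of_bool.
  by apply/idP/idP; rewrite !inE/=; rewrite (_ : _ *: _ = 0%R)//; apply/rowP; case.
pose x' : 'rV[R]_p := \row_j x ord0 (lift ord0 j).
set sx := (fun y : 'rV[R]_p.+1 => _).
pose B := @cons_rV R p @^-1` A.
have mB : measurable (B : set (measurableTypeR R * 'rV[R]_p)).
  by rewrite -[X in measurable X]setTI; exact: measurable_cons_rV.
have sE (z : R * 'rV[R]_p) : sx (cons_rV z) =
    cons_rV ((t^-1 * (z.1 - x ord0 ord0))%R, (t^-1 *: (z.2 - x'))%R).
  apply/rowP => i; have sxE (y : 'rV[R]_p.+1) : sx y ord0 i = (t^-1 * (y ord0 i - x ord0 i))%R.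
    by rewrite !mxE.
  rewrite sxE; have [j ->|->] := unliftP ord0 i; rewrite ?cons_rVS ?cons_rV0//.
  by rewrite !mxE.
rewrite /= /pushforward.
pose H a := @lebesgue_rV R p (xsection B a).
have mH : measurable_fun setT (H : R -> \bar R).
  exact: (measurable_fun_xsection (@lebesgue_rV R p) mB).
transitivity (\int[@lebesgue_measure R]_a
    ((t ^+ p)%:E * H (t^-1 * (a - x ord0 ord0))%R)).
  apply: eq_integral => a _ /=.
  rewrite -(IH x'); last exact: measurable_xsection.
  congr (lebesgue_rV _); apply/seteqP; split=> b /=.
    by rewrite /xsection/= !inE/= sE.
  by rewrite /xsection/= !inE/= sE.
rewrite ge0_integralZl//; last 2 first.
  - apply: (measurableT_comp (f := H)) => //.
    by apply: measurable_funM => //; exact: measurable_funB.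
  - by rewrite lee_fin exprn_ge0// ltW.
rewrite (ge0_integral_lebesgue_affine (x ord0 ord0) t0 mH)//.
by rewrite muleA -EFinM -exprSr.
Qed.

Lemma ge0_integral_rV_affine p (x : 'rV[R]_p) (t : R) (G : 'rV[R]_p -> \bar R) :
  (0 < t)%R -> measurable_fun setT G -> (forall y, 0 <= G y) ->
  \int[@lebesgue_rV R p]_y G (t^-1 *: (y - x))%R =
  (t ^+ p)%:E * \int[@lebesgue_rV R p]_y G y.
Proof.
move=> t0 mG G0.
have tp0 : (0 <= t ^+ p)%R by rewrite exprn_ge0// ltW.
have ms := measurable_affine x t.
pose S : {mfun 'rV[R]_p >-> 'rV[R]_p} := HB.pack (fun y : 'rV[R]_p => (t^-1 *: (y - x))%R : 'rV[R]_p)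
  (isMeasurableFun.Build _ _ _ _ _ ms).
transitivity (\int[pushforward (@lebesgue_rV R p) S]_y G y).
  by rewrite (ge0_integral_pushforward ms).
rewrite (eq_measure_integral (mscale (NngNum tp0) (@lebesgue_rV R p))).
  by rewrite ge0_integral_mscale.
by move=> A mA _; exact: lebesgue_rV_affine.
Qed.

End lebesgue_space.

(** * Geometry of the lens relation *)

Section lens_geometry.
Context (R : realType) (p : nat).
Implicit Types (x y u v : 'rV[R]_p) (t : R).

Lemma measurable_enorm : measurable_fun setT (@enorm R p).
Proof.
apply: measurableT_comp; first by apply: continuous_measurable_fun; exact: sqrt_continuous.
apply: measurable_sum => i; apply: measurable_funX; exact: measurable_coord.
Qed.

Lemma measurable_rV_sub d (T : measurableType d) (F G : T -> 'rV[R]_p) :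
  measurable_fun setT F -> measurable_fun setT G ->
  measurable_fun setT (fun w => F w - G w).
Proof.
move=> /measurable_fun_rVP mF /measurable_fun_rVP mG.
apply/measurable_fun_rVP => i.
rewrite (_ : (fun _ => _) = (fun w => F w ord0 i - G w ord0 i)).
  exact: measurable_funB.
by apply/funext => w; rewrite !mxE.
Qed.

Lemma measurable_lens_pairs t x : measurable (lens_pairs t%:E x).
Proof.
pose E := ('rV[R]_p * 'rV[R]_p)%type.
have mc y : measurable_fun setT (fun _ : E => y) by exact: measurable_cst.
have mfst : measurable_fun setT (fun z : E => z.1) by exact: measurable_fst.
have msnd : measurable_fun setT (fun z : E => z.2) by exact: measurable_snd.
have m1 : measurable_fun setT (fun z : E => enorm (x - z.1)).
  exact: (measurableT_comp measurable_enorm (measurable_rV_sub (mc x) mfst)).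
have m2 : measurable_fun setT (fun z : E => enorm (x - z.2)).
  exact: (measurableT_comp measurable_enorm (measurable_rV_sub (mc x) msnd)).
have m12 : measurable_fun setT (fun z : E => enorm (z.1 - z.2)).
  exact: (measurableT_comp measurable_enorm (measurable_rV_sub mfst msnd)).
rewrite (_ : lens_pairs _ _ =
  (setT `&` [set z | Num.max (enorm (x - z.1)) (enorm (x - z.2)) <= enorm (z.1 - z.2)]) `&`
  (setT `&` [set z | enorm (z.1 - z.2) <= t])); last first.
  by rewrite !setTI; apply/seteqP; split=> z /=; rewrite /lens_pairs/= lee_fin.
apply: measurableI; apply: measurable_fun_le => //.
exact: measurable_maxr.
Qed.

Lemma enormN x : enorm (- x) = enorm x.
Proof. by rewrite /enorm; congr Num.sqrt; apply: eq_bigr => i _; rewrite mxE sqrrN. Qed.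

Lemma enormZ (a : R) x : 0 <= a -> enorm (a *: x) = a * enorm x.
Proof.
move=> a0; rewrite /enorm.
under eq_bigr do rewrite mxE exprMn.
by rewrite -mulr_sumr sqrtrM ?sqr_ge0// sqrtr_sqr ger0_norm.
Qed.

Lemma coord_le_enorm x i : `|x ord0 i| <= enorm x.
Proof.
rewrite -sqrtr_sqr ler_wsqrtr// (bigD1 i)//= lerDl.
by apply: sumr_ge0 => j _; exact: sqr_ge0.
Qed.

Lemma lens_pairs_sym (t : \bar R) x y v : lens_pairs t x (y, v) = lens_pairs t x (v, y).
Proof.
by rewrite /lens_pairs/= maxC -(enormN (y - v)) opprB.
Qed.

Lemma lens_pairs_affine t x y v : 0 < t ->
  lens_pairs t%:E x (y, v) =
  lens_pairs 1%:E 0 (t^-1 *: (y - x), t^-1 *: (v - x)).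
Proof.
move=> t0; rewrite /lens_pairs/= !sub0r !enormN -scalerBr opprB addrA subrK.
have ti : 0 <= t^-1 by rewrite invr_ge0 ltW.
rewrite !enormZ// !lee_fin -(enormN (x - y)) -(enormN (x - v)) !opprB.
rewrite !ge_max !ler_pM2l ?invr_gt0//.
by rewrite [t^-1 * _]mulrC ler_pdivrMr// mul1r.
Qed.

Lemma lens_pairs_near t x y v : lens_pairs t%:E x (y, v) ->
  forall i, `|y ord0 i - x ord0 i| <= t.
Proof.
move=> [+ +] i /=; rewrite lee_fin ge_max => /andP[h1 _] h2.
rewrite distrC; apply: (le_trans _ (le_trans h1 h2)).
by have := coord_le_enorm (x - y) i; rewrite !mxE.
Qed.

Let mu := @lebesgue_rV R p.

Definition lens_section (u : 'rV[R]_p) : R :=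
  fine (mu (xsection (lens_pairs 1%:E 0) u)).

Let cube : set 'rV[R]_p := [set v | forall i, `[-1, 1]%classic (v ord0 i)].

Let mu_cube : mu cube = (2 ^+ p)%:E.
Proof.
rewrite /mu /cube (@lebesgue_rV_box R p (fun=> `[-1, 1]%classic))//.
rewrite (eq_bigr (fun=> 2%:E)); last first.
  move=> i _; have N11 : -1 < 1 :> R by lra.
  by rewrite lebesgue_measure_itv/= lte_fin N11 -EFinB; congr EFin; ring.
by rewrite prodEFin prodr_const card_ord.
Qed.

Lemma measurable_rV_box (A : 'I_p -> set R) : (forall i, measurable (A i)) ->
  measurable [set v : 'rV[R]_p | forall i, A i (v ord0 i)].
Proof.
move=> mA; rewrite (_ : [set _ | _] = \bigcap_(i in [set: 'I_p])
      ((fun x : 'rV[R]_p => x ord0 i) @^-1` A i)).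
  apply: fin_bigcap_measurable => // i _.
  by rewrite -[X in measurable X]setTI; exact: measurable_coord.
by apply/seteqP; split=> [v vA i _|v vA i]; [exact: vA|exact: (vA i Logic.I)].
Qed.

Let m_cube : measurable cube.
Proof. exact: (@measurable_rV_box (fun=> `[-1, 1]%classic)). Qed.

Let section_cube u : xsection (lens_pairs 1%:E 0) u `<=` cube.
Proof.
move=> v; rewrite /xsection/= inE lens_pairs_sym => uv i /=.
by have := lens_pairs_near uv i; rewrite mxE subr0 in_itv/= ler_norml.
Qed.

Let section_out u : ~ cube u -> xsection (lens_pairs 1%:E 0) u = set0.
Proof.
move=> ncu; apply/seteqP; split=> // v; rewrite /xsection/= inE => uv; apply: ncu => i /=.
by have := lens_pairs_near uv i; rewrite mxE subr0 in_itv/= ler_norml.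
Qed.

Let m_section u : measurable (xsection (lens_pairs 1%:E 0) u).
Proof. by apply: measurable_xsection; exact: measurable_lens_pairs. Qed.

Let section_le u : (mu (xsection (lens_pairs 1%:E 0) u) <= (2 ^+ p)%:E)%E.
Proof. by rewrite -mu_cube le_measure// inE. Qed.

Lemma lens_sectionE u :
  (lens_section u)%:E = mu (xsection (lens_pairs 1%:E 0) u).
Proof.
by rewrite fineK// ge0_fin_numE// (le_lt_trans (section_le u))// ltry.
Qed.

Lemma lens_section_ge0 u : 0 <= lens_section u.
Proof. by rewrite fine_ge0. Qed.

Lemma lens_section_le u : lens_section u <= 2 ^+ p.
Proof. by rewrite -lee_fin lens_sectionE. Qed.

Lemma measurable_lens_section : measurable_fun setT lens_section.
Proof.
apply/measurable_EFinP; rewrite (_ : _ \o _ = mu \o xsection (lens_pairs 1%:E 0)).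
  by apply: measurable_fun_xsection; exact: measurable_lens_pairs.
by apply/funext => u; rewrite /= lens_sectionE.
Qed.

(** Lambda_1 and Lambda_1^{*2} are the first two of these moments. *)
Definition lens_moment k : R := fine (\int[mu]_u (lens_section u ^+ k)%:E).

Lemma lens_moment_integrable k :
  (\int[mu]_u (lens_section u ^+ k.+1)%:E < +oo)%E.
Proof.
apply: (@le_lt_trans _ _ (\int[mu]_(u in cube) (2 ^+ p ^+ k.+1)%:E)%E); last first.
  by rewrite integral_cst//= [X in (_ * X)%E]mu_cube -EFinM ltry.
rewrite [leRHS]integral_mkcond; apply: ge0_le_integral => //.
- by move=> u _; rewrite lee_fin exprn_ge0// lens_section_ge0.
- by apply/measurable_EFinP; apply: measurable_funX; exact: measurable_lens_section.
- by apply/(measurable_restrictT _ m_cube); exact: measurable_cst.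
- move=> u _; rewrite /patch; case: ifPn => [_|].
    by rewrite lee_fin lerXn2r ?nnegrE ?lens_section_ge0 ?exprn_ge0 ?lens_section_le.
  rewrite notin_setE => /section_out u0.
  by rewrite /lens_section u0 (_ : mu set0 = 0%E) ?expr0n//; exact: measure0.
Qed.

Lemma lens_momentE k :
  (lens_moment k.+1)%:E = (\int[mu]_u (lens_section u ^+ k.+1)%:E)%E.
Proof.
rewrite fineK// ge0_fin_numE ?lens_moment_integrable//.
by apply: integral_ge0 => u _; rewrite lee_fin exprn_ge0// lens_section_ge0.
Qed.

Lemma Lambda1_moment : Lambda1 R p = lens_moment 1.
Proof.
congr fine; apply: eq_integral => u _ /=.
by rewrite expr1 lens_sectionE.
Qed.

Lemma Lambda1_star2_moment : Lambda1_star2 R p = lens_moment 2.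
Proof. by []. Qed.

Hypothesis p_gt0 : (0 < p)%N.

Let i0 : 'I_p := Ordinal p_gt0.
(* The unit lens relation contains the product of two boxes of half-side eta, centred at
-1/4 and 1/4 on the first axis: there the norms are about 1/4 and the distance
about 1/2.  The factor 1 / p makes the p - 1 other coordinates negligible. *)
Let eta : R := (16 * p%:R)^-1.
Let box (c : R) : set 'rV[R]_p :=
  [set v | forall i, (if i == i0 then `[c - eta, c + eta]%classic else `[- eta, eta]%classic) (v ord0 i)].

Let p1 : 1 <= p%:R :> R. Proof. by rewrite ler1n. Qed.

Let eta_gt0 : 0 < eta.
Proof. by rewrite invr_gt0 mulr_gt0// (lt_le_trans _ p1). Qed.

Let p_eta : p%:R * eta = 1 / 16.
Proof. by rewrite /eta; field; rewrite gt_eqF// (lt_le_trans _ p1). Qed.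

Let eta_le : eta <= 1 / 16.
Proof. by rewrite -p_eta ler_peMl// ltW. Qed.

Let sum_sqr (w : 'rV[R]_p) (e : R) : 0 <= e ->
  (forall i, i != i0 -> `|w ord0 i| <= e * eta) ->
  w ord0 i0 ^+ 2 <= \sum_i w ord0 i ^+ 2 <= w ord0 i0 ^+ 2 + e ^+ 2 / 256.
Proof.
move=> e0 we; rewrite (bigD1 i0)//= lerDl lerD2l; apply/andP; split.
  by apply: sumr_ge0 => i _; exact: sqr_ge0.
apply: (@le_trans _ _ (\sum_(i < p | i != i0) (e * eta) ^+ 2)).
  apply: ler_sum => i ii0; rewrite -(real_normK (num_real (w _ _))).
  by rewrite lerXn2r ?nnegrE ?mulr_ge0 ?(ltW eta_gt0)// we.
apply: (@le_trans _ _ (\sum_(i < p) (e * eta) ^+ 2)).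
  by rewrite [leRHS](bigD1 i0)//= lerDr sqr_ge0.
rewrite sumr_const card_ord -[leLHS]mulr_natl.
have -> : p%:R * (e * eta) ^+ 2 = e ^+ 2 * (eta * (p%:R * eta)).
  by move: eta => h; ring.
rewrite p_eta ler_wpM2l ?sqr_ge0//; move: eta_le; lra.
Qed.

Let box_pairs u v : box (- (1 / 4)) u -> box (1 / 4) v ->
  lens_pairs 1%:E 0 (u, v).
Proof.
move=> bu bv; have := bu i0; have := bv i0; rewrite /= !in_itv/=.
move=> /andP[v1 v2] /andP[u1 u2].
have ui i : i != i0 -> `|u ord0 i| <= 1 * eta.
  by move=> ii0; have := bu i; rewrite (negbTE ii0)/= in_itv/= mul1r ler_norml.
have vi i : i != i0 -> `|v ord0 i| <= 1 * eta.
  by move=> ii0; have := bv i; rewrite (negbTE ii0)/= in_itv/= mul1r ler_norml.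
have wi i : i != i0 -> `|(u - v) ord0 i| <= 2 * eta.
  move=> ii0; rewrite !mxE (le_trans (ler_normB _ _))//.
  by have := ui i ii0; have := vi i ii0; lra.
have /andP[_ su] := sum_sqr ler01 ui; have /andP[_ sv] := sum_sqr ler01 vi.
have /andP[sw1 sw2] := sum_sqr (ler0n _ 2) wi.
have e16 := eta_le; have e0 := eta_gt0.
have sqr_itv (a l r : R) : 0 <= l -> l <= a <= r -> l ^+ 2 <= a ^+ 2 <= r ^+ 2.
  by move=> l0 /andP[la ar]; rewrite !ler_pXn2r ?nnegrE ?la ?ar//; lra.
have /andP[_ uu] : 0 ^+ 2 <= (- u ord0 i0) ^+ 2 <= (5 / 16) ^+ 2.
  by apply: sqr_itv => //; apply/andP; split; lra.
have /andP[_ vv] : 0 ^+ 2 <= v ord0 i0 ^+ 2 <= (5 / 16) ^+ 2.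
  by apply: sqr_itv => //; apply/andP; split; lra.
have w0 : (u - v) ord0 i0 = u ord0 i0 - v ord0 i0 by rewrite !mxE.
have /andP[ww1 ww2] : (3 / 8) ^+ 2 <= (- (u - v) ord0 i0) ^+ 2 <= (5 / 8) ^+ 2.
  by apply: sqr_itv; [lra|rewrite w0; apply/andP; split; lra].
rewrite !sqrrN in uu ww1 ww2.
rewrite /lens_pairs/= !sub0r !enormN ge_max lee_fin; split.
  by apply/andP; split; apply: ler_wsqrtr; lra.
by rewrite -(sqrtr1 R); apply: ler_wsqrtr; lra.
Qed.

Let m_box c : measurable (box c).
Proof.
apply: (@measurable_rV_box (fun i => if i == i0 then _ else _)) => i.
by case: ifP => _; exact: measurable_itv.
Qed.

Let mu_box c : mu (box c) = ((2 * eta) ^+ p)%:E.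
Proof.
rewrite /mu /box (@lebesgue_rV_box R p (fun i => if i == i0 then _ else _)); last first.
  by move=> i; case: ifP => _; exact: measurable_itv.
rewrite (eq_bigr (fun=> (2 * eta)%:E)); last first.
  move=> i _; have e0 := eta_gt0.
  have h1 : c - eta < c + eta by lra.
  have h2 : - eta < eta by lra.
  by case: ifP => _; rewrite lebesgue_measure_itv/= lte_fin ?h1 ?h2 -EFinB;
    congr EFin; ring.
by rewrite prodEFin prodr_const card_ord.
Qed.

(** On the first box the sections contain the second one, which has positive measure. *)
Lemma lens_moment_gt0 k : 0 < lens_moment k.+1.
Proof.
have b0 : 0 < (2 * eta) ^+ p by rewrite exprn_gt0// mulr_gt0.
have bL u : box (- (1 / 4)) u -> (2 * eta) ^+ p <= lens_section u.
  move=> bu; rewrite -lee_fin lens_sectionE -(mu_box (1 / 4)) le_measure ?inE//.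
  by move=> v bv; rewrite /xsection/= inE; exact: box_pairs.
rewrite -lte_fin lens_momentE.
apply: (@lt_le_trans _ _ (\int[mu]_(u in box (- (1 / 4))) ((2 * eta) ^+ p ^+ k.+1)%:E)%E).
  rewrite integral_cst//= [X in (_ * X)%E]mu_box -EFinM lte_fin.
  by rewrite mulr_gt0// exprn_gt0.
rewrite integral_mkcond; apply: ge0_le_integral => //.
- by move=> u _; apply: erestrict_ge0 => v _; rewrite lee_fin exprn_ge0// ltW.
- by apply/(measurable_restrictT _ (m_box _)); exact: measurable_cst.
- by apply/measurable_EFinP; apply: measurable_funX; exact: measurable_lens_section.
- move=> u _; rewrite /patch; case: ifPn => [|_]; last first.
    by rewrite lee_fin exprn_ge0// lens_section_ge0.
  rewrite inE => /bL h; rewrite lee_fin lerXn2r ?nnegrE// ?lens_section_ge0//.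
  exact: ltW.
Qed.

End lens_geometry.

(** * Asymptotics of the moments of the lens kernel *)

Section lens_asymptotics.
Context (R : realType) (p : nat).
Variables (P : probability 'rV[R]_p R) (f : 'rV[R]_p -> R).
Hypothesis f_density : is_density P f.
Hypothesis f_continuous : continuous f.
Variable x : 'rV[R]_p.
Hypothesis fx_gt0 : 0 < f x.
Implicit Types (t e : R) (y v : 'rV[R]_p).

Definition lens_kernel t : 'rV[R]_p * 'rV[R]_p -> R := \1_(lens_pairs t%:E x).

Lemma measurable_lens_kernel t : measurable_fun setT (lens_kernel t).
Proof. by apply: measurable_indic; exact: measurable_lens_pairs. Qed.

Lemma lens_kernel01 t z : 0 <= lens_kernel t z <= 1.
Proof. by rewrite /lens_kernel indicE; case: (_ \in _); rewrite ?ler01 ?lexx. Qed.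

Lemma bounded_mfun_lens_kernel t : bounded_mfun (lens_kernel t).
Proof.
split; first exact: measurable_lens_kernel.
by exists 1 => z; have /andP[h0 h1] := lens_kernel01 t z; rewrite ger0_norm.
Qed.

Lemma lens_kernel_sym t y v : lens_kernel t (y, v) = lens_kernel t (v, y).
Proof.
rewrite /lens_kernel !indicE; congr (_%:R); congr nat_of_bool.
by apply/idP/idP; rewrite !inE lens_pairs_sym.
Qed.

Let mu := @lebesgue_rV R p.
Let S t y := t^-1 *: (y - x).
Let h1 t := hoeffding_proj P (lens_kernel t).

Lemma LLD_expect t : LLD P x t%:E = \int[P]_y h1 t y.
Proof.
have bk := bounded_mfun_lens_kernel t.
rewrite /LLD /Rintegral -integral21_prod_meas1; last first.
  exact: (bounded_mfun_integrable (P \x P)%E bk).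
congr fine; apply: eq_integral => y _.
rewrite /h1 /hoeffding_proj /fubini_G/= fineK//.
apply: integrable_fin_num => //; apply: bounded_mfun_integrable.
by apply: (bounded_mfun_pull bk); exact: measurable_fun_pair.
Qed.

Let mf : measurable_fun setT f. Proof. by case: f_density. Qed.
Let f_ge0 y : 0 <= f y. Proof. by case: f_density. Qed.
Let PE A : measurable A -> P A = (\int[mu]_(y in A) (f y)%:E)%E.
Proof. by case: f_density => _ _; exact. Qed.

Let m_section t y : measurable (xsection (lens_pairs t%:E x) y).
Proof. by apply: measurable_xsection; exact: measurable_lens_pairs. Qed.

Let lens_projE t y : (h1 t y)%:E = P (xsection (lens_pairs t%:E x) y).
Proof.
have bk := bounded_mfun_lens_kernel t.
rewrite /h1 /hoeffding_proj fineK; last first.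
  apply: integrable_fin_num => //; apply: bounded_mfun_integrable.
  by apply: (bounded_mfun_pull bk); exact: measurable_fun_pair.
rewrite -[X in P X]setIT -integral_indic//.
apply: eq_integral => z _; rewrite lens_kernel_sym /lens_kernel !indicE.
by congr (_%:R%:E); congr nat_of_bool; apply/idP/idP; rewrite /xsection !inE/= ?inE.
Qed.

Let mu_section t y : 0 < t ->
  mu (xsection (lens_pairs t%:E x) y) = (t ^+ p * lens_section (S t y))%:E.
Proof.
move=> t0; rewrite EFinM lens_sectionE -(lebesgue_rV_affine x t0); last first.
  by apply: measurable_xsection; exact: measurable_lens_pairs.
congr (lebesgue_rV _); apply/seteqP; split=> v /=; rewrite /xsection/= !inE;
  by rewrite (lens_pairs_affine x y v t0).
Qed.

(* The canonical norm of row vectors is the supremum norm, whence the coordinates. *)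
Let density_near e : 0 < e -> exists2 del, 0 < del & forall t y, t < del ->
  (forall i, `|y ord0 i - x ord0 i| <= t) -> f x - e <= f y <= f x + e.
Proof.
move=> e0.
have /cvgrPdist_le/(_ _ e0)/nbhs_ballP[del /= del0 fdel] := @f_continuous x.
exists del => // t y tdel yx; have : ball x del y.
  split=> // i j; rewrite (ord1 i) -ball_normE/= distrC.
  exact: le_lt_trans (yx j) tdel.
by move/fdel; rewrite /= distrC ler_distl.
Qed.

Let near_of_section t y : 0 < t -> lens_section (S t y) != 0 ->
  forall i, `|y ord0 i - x ord0 i| <= t.
Proof.
move=> t0 Ly i.
have [v] : xsection (lens_pairs 1%:E 0) (S t y) !=set0.
  apply/set0P; apply: contraNneq Ly => L0.
  by rewrite /lens_section L0 measure0.
rewrite /xsection/= inE => /lens_pairs_near/(_ i).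
rewrite !mxE subr0 normrM gtr0_norm ?invr_gt0//.
by rewrite ler_pdivrMl// mulr1.
Qed.

(** The partners of y all lie within t of x, where f is between f x - e and f x + e; so
the probability of the section at y is its Lebesgue measure times f x, up to e.  If
the section at y is not negligible then y itself is within t of x. *)
Lemma lens_proj_bounds e : 0 < e <= f x -> exists2 del, 0 < del &
  forall t, 0 < t < del -> forall y,
    (f x - e) * (t ^+ p * lens_section (S t y)) <= h1 t y <=
    (f x + e) * (t ^+ p * lens_section (S t y)) /\
    (lens_section (S t y) != 0 -> f x - e <= f y <= f x + e).
Proof.
move=> /andP[e0 ef]; have [del del0 fdel] := density_near e0.
exists del => // t /andP[t0 tdel] y; split; last first.
  by move=> /(near_of_section t0); exact: fdel tdel.
have fs v : xsection (lens_pairs t%:E x) y v -> f x - e <= f v <= f x + e.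
  rewrite /xsection/= inE lens_pairs_sym => /lens_pairs_near; exact: fdel tdel.
have cst c : (\int[mu]_(v in xsection (lens_pairs t%:E x) y) c%:E)%E =
    (c * (t ^+ p * lens_section (S t y)))%:E.
  by rewrite integral_cst// [X in (_ * X)%E]mu_section// -EFinM.
rewrite -!lee_fin lens_projE PE// -!cst.
have mfE : measurable_fun (xsection (lens_pairs t%:E x) y) (EFin \o f).
  by apply: measurable_funTS; exact/measurable_EFinP.
apply/andP; split; apply: ge0_le_integral => //.
- by move=> v _; rewrite lee_fin subr_ge0.
- by move=> v /fs/andP[? _]; rewrite lee_fin.
- by move=> v _; rewrite lee_fin.
- by move=> v /fs/andP[_ ?]; rewrite lee_fin.
Qed.

Let bh1 t : bounded_mfun (h1 t).
Proof.
exact: (bounded_mfun_hoeffding_proj P (@measurable_lens_kernel t) (lens_kernel01 t)).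
Qed.

Let h1_ge0 t y : 0 <= h1 t y.
Proof. by have /andP[] := hoeffding_proj01 P (@measurable_lens_kernel t) (lens_kernel01 t) y. Qed.

Let integral_section t k c : 0 < t -> 0 <= c ->
  (\int[mu]_y (c * (t ^+ p * lens_section (S t y)) ^+ k.+1)%:E)%E =
  (c * (t ^+ p) ^+ k.+2 * lens_moment R p k.+1)%:E.
Proof.
move=> t0 c0; have tp0 : 0 <= t ^+ p by rewrite exprn_ge0// ltW.
under eq_integral do rewrite exprMn mulrA EFinM.
have mL : measurable_fun setT (fun u : 'rV[R]_p => (lens_section u ^+ k.+1)%:E : \bar R).
  by apply/measurable_EFinP; apply: measurable_funX; exact: measurable_lens_section.
have L0 (u : 'rV[R]_p) : (0 <= (lens_section u ^+ k.+1)%:E)%E.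
  by rewrite lee_fin exprn_ge0// lens_section_ge0.
rewrite ge0_integralZl//; last 2 first.
  - exact: (measurableT_comp mL (measurable_affine x t)).
  - by rewrite lee_fin mulr_ge0// exprn_ge0.
rewrite (ge0_integral_rV_affine x t0 mL L0) -lens_momentE -!EFinM; congr EFin.
by rewrite [in RHS]exprS; ring.
Qed.

(** Integrating the k-th power of the projection produces k factors f x from the sections
and one more from the law of y, and as many factors t^p. *)
Lemma lens_moment_bounds e k : 0 < e <= f x -> exists2 del, 0 < del &
  forall t, 0 < t < del ->
    (f x - e) ^+ k.+2 * (t ^+ p) ^+ k.+2 * lens_moment R p k.+1 <=
    \int[P]_y h1 t y ^+ k.+1 <=
    (f x + e) ^+ k.+2 * (t ^+ p) ^+ k.+2 * lens_moment R p k.+1.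
Proof.
move=> ee; have /andP[e0 ef] := ee.
have [del del0 hdel] := lens_proj_bounds ee; exists del => // t tt.
have /andP[t0 tdel] := tt; have {}hdel := hdel t tt.
have fm0 : 0 <= f x - e by rewrite subr_ge0.
have fp0 : 0 <= f x + e by rewrite addr_ge0// ltW.
have L0 y : 0 <= t ^+ p * lens_section (S t y).
  by rewrite mulr_ge0 ?lens_section_ge0// exprn_ge0// ltW.
have bh : bounded_mfun (fun y => h1 t y ^+ k.+1) by exact: bounded_mfunX.
have mh : measurable_fun setT (fun y => (h1 t y ^+ k.+1 * f y)%:E : \bar R).
  by apply/measurable_EFinP; apply: measurable_funM => //; case: bh.
have mcL c : measurable_fun setT
    (fun y => (c * (t ^+ p * lens_section (S t y)) ^+ k.+1)%:E : \bar R).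
  apply/measurable_EFinP; apply: measurable_funM => //.
  apply: measurable_funX; apply: measurable_funM => //.
  exact: (measurableT_comp (measurable_lens_section (p := p)) (measurable_affine x t)).
have ME : (\int[P]_y h1 t y ^+ k.+1)%:E = (\int[mu]_y (h1 t y ^+ k.+1 * f y)%:E)%E.
  rewrite (expect_density (mu := mu) (nu := P) mf f_ge0 PE bh).
  rewrite fineK//; apply: integrable_fin_num => //.
  exact: (integrable_bounded_density (mu := mu) (nu := P) mf f_ge0 PE bh).
have pt y : (f x - e) ^+ k.+2 * (t ^+ p * lens_section (S t y)) ^+ k.+1 <=
    h1 t y ^+ k.+1 * f y <= (f x + e) ^+ k.+2 * (t ^+ p * lens_section (S t y)) ^+ k.+1.
  have [/andP[hl hu] hf] := hdel y.
  have [Ly|Ly] := eqVneq (lens_section (S t y)) 0.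
    have -> : h1 t y = 0.
      by apply/eqP; rewrite eq_le h1_ge0 andbT (le_trans hu)// Ly !mulr0.
    by rewrite Ly mulr0 expr0n/= !mulr0 mul0r lexx.
  have /andP[fl fu] := hf Ly.
  rewrite !(exprSr _ k.+1) !(mulrAC _ _ (_ ^+ k.+1)) -!exprMn.
  have la0 : 0 <= (f x - e) * (t ^+ p * lens_section (S t y)) by rewrite mulr_ge0.
  have ua0 : 0 <= (f x + e) * (t ^+ p * lens_section (S t y)) by rewrite mulr_ge0.
  apply/andP; split; apply: ler_pM => //; rewrite ?exprn_ge0//.
    by rewrite lerXn2r ?nnegrE.
  by rewrite lerXn2r ?nnegrE.
have fm20 : 0 <= (f x - e) ^+ k.+2 by exact: exprn_ge0.
have fp20 : 0 <= (f x + e) ^+ k.+2 by exact: exprn_ge0.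
rewrite -!lee_fin ME -(integral_section k t0 fm20) -(integral_section k t0 fp20).
apply/andP; split; apply: ge0_le_integral => //.
- by move=> y _; rewrite lee_fin mulr_ge0 ?exprn_ge0.
- by move=> y _; rewrite lee_fin; have /andP[] := pt y.
- by move=> y _; rewrite lee_fin mulr_ge0 ?exprn_ge0.
- by move=> y _; rewrite lee_fin; have /andP[] := pt y.
Qed.

Lemma lens_moment_cvg (tau : nat -> R) k : (forall n, (0 < n)%N -> 0 < tau n) ->
  tau n @[n --> \oo] --> 0 ->
  (\int[P]_y h1 (tau n) y ^+ k.+1) / (tau n ^+ p) ^+ k.+2 @[n --> \oo] -->
  f x ^+ k.+2 * lens_moment R p k.+1.
Proof.
move=> tau0 tauc.
pose I := lens_moment R p k.+1.
have cont : (fun e : R => (f x + e) ^+ k.+2 * I) @ (0 : R) --> f x ^+ k.+2 * I.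
  rewrite -{2}(addr0 (f x)); apply: cvgM; last exact: cvg_cst.
  apply: (cvg_comp (fun e => f x + e) (fun u => u ^+ k.+2)); last exact: exprn_continuous.
  by apply: cvgD; [exact: cvg_cst|exact: cvg_id].
apply/cvgrPdist_le => r r0.
move/cvgrPdist_le : cont => /(_ _ r0)/nbhs_ballP[d /= d0 hd].
pose e := Num.min (f x) (d / 2).
have e0 : 0 < e by rewrite lt_min fx_gt0 divr_gt0.
have ed : e < d by rewrite gt_min ltr_pdivrMr// ltr_pMr// ltr1n orbT.
have ef : 0 < e <= f x by rewrite e0 ge_min lexx.
have [del del0 hdel] := lens_moment_bounds k ef.
have hp : `|f x ^+ k.+2 * I - (f x + e) ^+ k.+2 * I| <= r.
  by apply: hd; rewrite -ball_normE/= sub0r normrN gtr0_norm.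
have hm : `|f x ^+ k.+2 * I - (f x - e) ^+ k.+2 * I| <= r.
  by apply: hd; rewrite -ball_normE/= sub0r opprK gtr0_norm.
near=> n.
have n0 : (0 < n)%N by near: n; exact: nbhs_infty_gt.
have t0 := tau0 n n0.
have tdel : tau n < del.
  have : `|tau n| < del by near: n; move/cvgr0_norm_lt : tauc => /(_ _ del0).
  by rewrite gtr0_norm.
have /andP[lo hi] := hdel (tau n) (introT andP (conj t0 tdel)).
have tp0 : 0 < (tau n ^+ p) ^+ k.+2 by rewrite exprn_gt0// exprn_gt0.
move: lo; rewrite mulrAC -(ler_pdivlMr _ _ tp0) -/I => lo.
move: hi; rewrite mulrAC -(ler_pdivrMr _ _ tp0) -/I => hi.
move: hp hm; rewrite !ler_distl => /andP[? ?] /andP[? ?].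
by apply/andP; split; lra.
Unshelve. all: end_near. Qed.

End lens_asymptotics.

(** * A central limit theorem for square roots of U-statistics *)

Section sqrt_linearization.
Context (R : rcfType).

(** The left-hand side equals (sqrt u - sqrt v)^2 / (2 sqrt v), and |sqrt u - sqrt v| is at
most |u - v| / sqrt v. *)
Lemma sqrt_taylor (u v : R) : 0 <= u -> 0 < v ->
  `|Num.sqrt u - Num.sqrt v - (u - v) / (2 * Num.sqrt v)| <=
  (u - v) ^+ 2 / (2 * v * Num.sqrt v).
Proof.
move=> u0 v0; set a := Num.sqrt u; set b := Num.sqrt v.
have a0 : 0 <= a by exact: sqrtr_ge0.
have b0 : 0 < b by rewrite sqrtr_gt0.
have -> : u = a ^+ 2 by rewrite sqr_sqrtr.
have -> : v = b ^+ 2 by rewrite sqr_sqrtr// ltW.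
have -> : a - b - (a ^+ 2 - b ^+ 2) / (2 * b) = - ((a - b) ^+ 2 / (2 * b)).
  by field; rewrite gt_eqF.
rewrite normrN ger0_norm; last by rewrite divr_ge0 ?sqr_ge0// mulr_ge0// ltW.
have -> : (a ^+ 2 - b ^+ 2) ^+ 2 / (2 * b ^+ 2 * b) =
    (a - b) ^+ 2 / (2 * b) * ((a + b) / b) ^+ 2 by field; rewrite gt_eqF.
rewrite ler_peMr ?divr_ge0 ?sqr_ge0 ?mulr_ge0 ?(ltW b0)//.
by rewrite exprn_ege1// ler_pdivlMr// mul1r lerDr.
Qed.

(** Used in place of the Cauchy-Schwarz inequality: if x^2 has expectation of order D
then x has expectation of order sqrt D. *)
Lemma le_sqrt_amgm (x D : R) : 0 < D -> x <= Num.sqrt D + x ^+ 2 / (4 * Num.sqrt D).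
Proof.
move=> D0; have s0 : 0 < Num.sqrt D by rewrite sqrtr_gt0.
rewrite -subr_ge0 (_ : _ - x = (x - 2 * Num.sqrt D) ^+ 2 / (4 * Num.sqrt D)).
  by rewrite divr_ge0 ?sqr_ge0// mulr_ge0// ltW.
by field; rewrite gt_eqF.
Qed.

End sqrt_linearization.

Section ustatistic.
Context (R : realType) d (Om : measurableType d) (Q : probability Om R).
Context d' (T : measurableType d') (P : probability T R).
Variable X : nat -> {RV Q >-> T}.

Definition ustatistic (h : T * T -> R) n w : R :=
  'C(n, 2)%:R^-1 * \sum_(i < n) \sum_(j < n | (i < j)%N) h (X i w, X j w).

Lemma bounded_mfun_ustatistic (h : T * T -> R) n :
  bounded_mfun h -> bounded_mfun (ustatistic h n).
Proof.
move=> bh; apply: bounded_mfunZ; apply: bounded_mfun_sum => i.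
under eq_fun do rewrite big_mkcond/=.
apply: bounded_mfun_sum => j; case: (i < j)%N; last exact: bounded_mfun_cst.
by apply: (bounded_mfun_pull bh); exact: measurable_fun_pair.
Qed.

Lemma ustatistic_ge0 (h : T * T -> R) n w : (forall z, 0 <= h z) -> 0 <= ustatistic h n w.
Proof.
move=> h0; rewrite mulr_ge0 ?invr_ge0//.
by apply: sumr_ge0 => i _; apply: sumr_ge0 => j _.
Qed.

Hypothesis X_indep : mutually_independent X.
Hypothesis X_law : identically_distributed X P.
Variable h : T * T -> R.
Hypothesis mh : measurable_fun setT h.
Hypothesis h01 : forall z, 0 <= h z <= 1.
Hypothesis h_sym : forall y z, h (y, z) = h (z, y).

Let h1 := hoeffding_proj P h.
Let theta := \int[P]_y h1 y.
Let V := \int[P]_y (h1 y - theta) ^+ 2.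

(** The three error terms come from the square of the linear part, from the square of the
degenerate part (both through the Taylor remainder of the square root), and from
the degenerate part itself. *)
Lemma sqrt_ustatistic_linearization n (a : R) : (1 < n)%N -> 0 < theta -> 0 < a ->
  let b := a / Num.sqrt theta in
  let C := 'C(n, 2)%:R in
  bounded_mfun (fun w => a * (Num.sqrt (ustatistic h n w) - Num.sqrt theta)) /\
  \int[Q]_w `|a * (Num.sqrt (ustatistic h n w) - Num.sqrt theta) -
              \sum_(i < n) b / n%:R * (h1 (X i w) - theta)| <=
  4 * (b * V / (n%:R * theta)) + 16 * (b / C) + 2 * Num.sqrt (a ^+ 2 / C).
Proof.
move=> n1 th0 a0 b C.
have bh : bounded_mfun h.
  by split=> //; exists 1 => z; have /andP[h0 ?] := h01 z; rewrite ger0_norm.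
have bh1 : bounded_mfun h1 := bounded_mfun_hoeffding_proj P mh h01.
have bL : bounded_mfun (ustatistic h n) by exact: bounded_mfun_ustatistic.
have C0 : 0 < C by rewrite ltr0n bin_gt0.
have n0 : 0 < n%:R :> R by rewrite ltr0n (ltn_trans _ n1).
have st0 : 0 < Num.sqrt theta by rewrite sqrtr_gt0.
have b0 : 0 < b by rewrite divr_gt0.
pose A w := \sum_(i < n) (h1 (X i w) - theta).
pose g z := h z - (h1 z.1 - theta) - (h1 z.2 - theta) - theta.
pose Rm w := C^-1 * \sum_(i < n) \sum_(j < n | (i < j)%N) g (X i w, X j w).
have LE w : ustatistic h n w - theta = 2 / n%:R * A w + Rm w.
  exact: (hoeffding_decomposition P h (fun i => X i w) n1).
have L0 w : 0 <= ustatistic h n w.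
  by apply: ustatistic_ge0 => z; have /andP[] := h01 z.
pose Y w := a * (Num.sqrt (ustatistic h n w) - Num.sqrt theta).
pose W w := \sum_(i < n) b / n%:R * (h1 (X i w) - theta).
have WE w : W w = b / n%:R * A w by rewrite /W -mulr_sumr.
have bA : bounded_mfun A.
  apply: bounded_mfun_sum => i; apply: bounded_mfunB; last exact: bounded_mfun_cst.
  exact: (bounded_mfun_coord X i bh1).
have bR : bounded_mfun Rm.
  rewrite (_ : Rm = fun w => ustatistic h n w - theta - 2 / n%:R * A w).
    apply: bounded_mfunB; last exact: bounded_mfunZ.
    by apply: bounded_mfunB => //; exact: bounded_mfun_cst.
  by apply/funext => w; rewrite LE addrC addKr.
have bY : bounded_mfun Y.
  apply: bounded_mfunZ; apply: bounded_mfunB; last exact: bounded_mfun_cst.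
  have [mL [M LM]] := bL; split.
    apply: measurableT_comp => //.
    by apply: continuous_measurable_fun; exact: sqrt_continuous.
  exists (Num.sqrt M) => w; rewrite ger0_norm ?sqrtr_ge0// ler_wsqrtr//.
  by rewrite (le_trans (ler_norm _)).
split=> //.
have bW : bounded_mfun W by rewrite (_ : W = fun w => b / n%:R * A w);
  [exact: bounded_mfunZ|exact/funext].
pose D := a ^+ 2 / C.
have D0 : 0 < D by rewrite divr_gt0// exprn_gt0.
have sD0 : 0 < Num.sqrt D by rewrite sqrtr_gt0.
pose k1 := b * 4 / (n%:R ^+ 2 * theta).
pose k2 := b / theta + b ^+ 2 / (16 * Num.sqrt D).
have pt w : `|Y w - W w| <= k1 * A w ^+ 2 + (k2 * Rm w ^+ 2 + Num.sqrt D).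
  have -> : Y w - W w = a * (Num.sqrt (ustatistic h n w) - Num.sqrt theta -
      (ustatistic h n w - theta) / (2 * Num.sqrt theta)) + b / 2 * Rm w.
    by rewrite LE WE /Y /b; field; rewrite !gt_eqF.
  rewrite (le_trans (ler_normD _ _))//.
  have h1' : `|a * (Num.sqrt (ustatistic h n w) - Num.sqrt theta -
      (ustatistic h n w - theta) / (2 * Num.sqrt theta))| <=
      k1 * A w ^+ 2 + b / theta * Rm w ^+ 2.
    rewrite normrM (gtr0_norm a0).
    apply: (@le_trans _ _ (a * ((ustatistic h n w - theta) ^+ 2 / (2 * theta * Num.sqrt theta)))).
      by rewrite ler_wpM2l ?(ltW a0)// sqrt_taylor.
    rewrite LE (_ : a * _ = b / (2 * theta) * (2 / n%:R * A w + Rm w) ^+ 2); last first.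
      by rewrite /b; field; rewrite !gt_eqF.
    rewrite (_ : k1 * _ + _ = b / (2 * theta) * (2 * (2 / n%:R * A w) ^+ 2 + 2 * Rm w ^+ 2)); last first.
      by rewrite /k1; field; rewrite !gt_eqF.
    have k0 : 0 <= b / (2 * theta) by rewrite divr_ge0 ?(ltW b0)// mulr_ge0// ltW.
    rewrite (ler_wpM2l k0)//.
    move: (2 / n%:R * A w) (Rm w) => u v.
    by have := sqr_ge0 (u - v); rewrite sqrrB sqrrD; lra.
  have h2' : `|b / 2 * Rm w| <= Num.sqrt D + b ^+ 2 / (16 * Num.sqrt D) * Rm w ^+ 2.
    rewrite (le_trans (le_sqrt_amgm _ D0))// lerD2l real_normK ?num_real//.
    rewrite le_eqVlt; apply/orP; left; apply/eqP; field; by rewrite gt_eqF.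
  by rewrite (le_trans (lerD h1' h2'))// le_eqVlt /k2; apply/orP; left; apply/eqP; ring.
apply: (@le_trans _ _ (\int[Q]_w (k1 * A w ^+ 2 + (k2 * Rm w ^+ 2 + Num.sqrt D)))).
  have bA2 := bounded_mfunX 2 bA; have bR2 := bounded_mfunX 2 bR.
  apply: le_expect => //.
    by apply: bounded_mfun_norm; exact: bounded_mfunB.
  apply: bounded_mfunD; first exact: bounded_mfunZ.
  by apply: bounded_mfunD; [exact: bounded_mfunZ|exact: bounded_mfun_cst].
have bA2 := bounded_mfunX 2 bA; have bR2 := bounded_mfunX 2 bR.
have bkR := bounded_mfunZ k2 bR2; have bkA := bounded_mfunZ k1 bA2.
have bsD := bounded_mfun_cst Om (Num.sqrt D).
rewrite (expectD Q bkA (bounded_mfunD bkR bsD)) (expectD Q bkR bsD).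
rewrite (expectZ Q k1 bA2) (expectZ Q k2 bR2) expect_cst.
have EA : \int[Q]_w A w ^+ 2 = n%:R * V.
  exact: (hoeffding_linear_sqr X_indep X_law mh h01).
have ER : \int[Q]_w Rm w ^+ 2 <= 16 * theta / C.
  have bS : bounded_mfun (fun w => \sum_(i < n) \sum_(j < n | (i < j)%N) g (X i w, X j w)).
    rewrite (_ : (fun _ => _) = fun w => C * Rm w); first exact: bounded_mfunZ.
    by apply/funext => w; rewrite /Rm mulVKf// gt_eqF.
  under eq_Rintegral do rewrite /Rm exprMn.
  rewrite expectZ; last exact: bounded_mfunX.
  have := hoeffding_remainder X_indep X_law mh h01 h_sym n.
  rewrite -/C -/theta => hR.
  rewrite (le_trans (ler_wpM2l _ hR)) ?exprn_ge0 ?invr_ge0 ?(ltW C0)//.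
  by rewrite le_eqVlt; apply/orP; left; apply/eqP; rewrite -/theta; field; rewrite gt_eqF.
have k20 : 0 <= k2.
  by rewrite addr_ge0// divr_ge0 ?exprn_ge0 ?mulr_ge0// ltW.
rewrite EA (le_trans (lerD (lexx _) (lerD (ler_wpM2l k20 ER) (lexx _))))//.
have sD : Num.sqrt D ^+ 2 = D by rewrite sqr_sqrtr// ltW.
have st : Num.sqrt theta ^+ 2 = theta by rewrite sqr_sqrtr// ltW.
have -> : k1 * (n%:R * V) = 4 * (b * V / (n%:R * theta)).
  by rewrite /k1; field; rewrite !gt_eqF.
have -> : k2 * (16 * theta / C) = 16 * (b / C) + b ^+ 2 * theta / C / Num.sqrt D.
  by rewrite /k2; field; rewrite !gt_eqF.
have -> : b ^+ 2 * theta / C / Num.sqrt D = Num.sqrt D.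
  have -> : b ^+ 2 * theta = a ^+ 2.
    by rewrite /b expr_div_n st; field; rewrite gt_eqF.
  by rewrite -/D -{1}sD; field; rewrite gt_eqF.
rewrite -/D; lra.
Qed.

End ustatistic.

Section ustatistic_clt.
Context (R : realType) d (Om : measurableType d) (Q : probability Om R).
Context d' (T : measurableType d') (P : probability T R).
Variable X : nat -> {RV Q >-> T}.
Hypothesis X_indep : mutually_independent X.
Hypothesis X_law : identically_distributed X P.
Variable h : nat -> T * T -> R.
Hypothesis mh : forall n, measurable_fun setT (h n).
Hypothesis h01 : forall n z, 0 <= h n z <= 1.
Hypothesis h_sym : forall n y z, h n (y, z) = h n (z, y).
Variables (a E : nat -> R) (s : R).

Let h1 n := hoeffding_proj P (h n).
Let theta n := \int[P]_y h1 n y.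
Let V n := \int[P]_y (h1 n y - theta n) ^+ 2.
Let b n := a n / Num.sqrt (theta n).

Hypothesis s_gt0 : 0 < s.
Hypothesis pos : \forall n \near \oo, 0 < theta n /\ 0 < a n.
Hypothesis proj_bound : \forall n \near \oo, forall y, `|h1 n y - theta n| <= E n.
Hypothesis cvg_sup : b n / n%:R * E n @[n --> \oo] --> 0.
Hypothesis cvg_var : b n ^+ 2 * V n / n%:R @[n --> \oo] --> s ^+ 2.
Hypothesis cvg_rem1 : b n * V n / (n%:R * theta n) @[n --> \oo] --> 0.
Hypothesis cvg_rem2 : b n / 'C(n, 2)%:R @[n --> \oo] --> 0.
Hypothesis cvg_rem3 : a n ^+ 2 / 'C(n, 2)%:R @[n --> \oo] --> 0.

Let Y n w := a n * (Num.sqrt (ustatistic X (h n) n w) - Num.sqrt (theta n)).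
(* Below, rem n bounds the L^1 distance between Y n and W n, nv n is the variance of W n,
and small n bounds its summands. *)
Let phi n y := b n / n%:R * (h1 n y - theta n).
Let W n w := \sum_(i < n) phi n (X i w).
Let rem n := 4 * (b n * V n / (n%:R * theta n)) + 16 * (b n / 'C(n, 2)%:R) +
  2 * Num.sqrt (a n ^+ 2 / 'C(n, 2)%:R).
Let nv n := b n ^+ 2 * V n / n%:R.
Let small n := b n / n%:R * E n.

Let bh n : bounded_mfun (h n).
Proof.
by split=> //; exists 1 => z; have /andP[h0 ?] := h01 n z; rewrite ger0_norm.
Qed.

Let bh1 n : bounded_mfun (h1 n).
Proof. exact: (bounded_mfun_hoeffding_proj P (mh n) (h01 n)). Qed.

Let bphi n : bounded_mfun (phi n).
Proof.
by apply: bounded_mfunZ; apply: bounded_mfunB => //; exact: bounded_mfun_cst.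
Qed.

Let bW n : bounded_mfun (W n).
Proof. by apply: bounded_mfun_sum => i; exact: bounded_mfun_coord. Qed.

Let mY n : measurable_fun setT (Y n).
Proof.
apply: measurable_funM => //; apply: measurable_funB => //.
apply: (measurableT_comp (f := @Num.sqrt R)).
  by apply: continuous_measurable_fun; exact: sqrt_continuous.
by have [] := bounded_mfun_ustatistic X n (bh n).
Qed.

Let cvg_rem : rem n @[n --> \oo] --> 0.
Proof.
have -> : 0 = 4 * 0 + 16 * 0 + 2 * Num.sqrt 0 :> R by rewrite sqrtr0 !mulr0 !addr0.
apply: cvgD; first by apply: cvgD; apply: cvgMr.
by apply: cvgMr; apply: cvg_comp cvg_rem3 _; exact: sqrt_continuous.
Qed.

Let phi0 n : \int[P]_y phi n y = 0.
Proof.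
have bt := bounded_mfun_cst T (theta n).
rewrite expectZ; last exact: (bounded_mfunB (bh1 n) bt).
by rewrite (expectB P (bh1 n) bt) expect_cst subrr mulr0.
Qed.

Let phi_sqr n : (0 < n)%N -> n%:R * \int[P]_y phi n y ^+ 2 = nv n.
Proof.
move=> n0; have n0' : n%:R != 0 :> R by rewrite pnatr_eq0 -lt0n.
have bt := bounded_mfun_cst T (theta n).
under eq_Rintegral do rewrite /phi exprMn.
rewrite expectZ; last exact: (bounded_mfunX 2 (bounded_mfunB (bh1 n) bt)).
by rewrite -/(V n) /nv; field.
Qed.

Let linearization : \forall n \near \oo,
  bounded_mfun (Y n) /\ \int[Q]_w `|Y n w - W n w| <= rem n.
Proof.
near=> n.
have [th0 a0] : 0 < theta n /\ 0 < a n by near: n; exact: pos.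
have n1 : (1 < n)%N by near: n; exact: nbhs_infty_gt.
exact: (sqrt_ustatistic_linearization X_indep X_law (mh n) (h01 n) (@h_sym n) n1 th0 a0).
Unshelve. all: end_near. Qed.

Let char_fun_W t : \forall n \near \oo,
  let err := nv n * (t ^+ 4 * small n ^+ 2 + `|t| ^+ 3 * small n) in
  `|\int[Q]_w cos (t * W n w) - expR (- (t ^+ 2 * nv n / 2))| <= err /\
  `|\int[Q]_w sin (t * W n w)| <= err.
Proof.
near=> n.
have [th0 a0] : 0 < theta n /\ 0 < a n by near: n; exact: pos.
have n0 : (0 < n)%N by near: n; exact: nbhs_infty_gt.
have hE : forall y, `|h1 n y - theta n| <= E n by near: n; exact: proj_bound.
have phiE y : `|phi n y| <= small n.
  rewrite /phi normrM ger0_norm; last by rewrite !divr_ge0 ?sqrtr_ge0 ?(ltW a0).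
  by rewrite ler_wpM2l// !divr_ge0 ?sqrtr_ge0 ?(ltW a0).
have [mphi _] := bphi n.
have := char_fun_sum_small X_indep X_law t n mphi phiE (phi0 n).
by rewrite /= phi_sqr.
Unshelve. all: end_near. Qed.

Let cvg_cos t c : \int[Q]_w cos (t * Y n w + c) @[n --> \oo] -->
  \int[normal_prob 0 s]_y cos (t * y + c).
Proof.
rewrite char_fun_normal//.
pose err n := nv n * (t ^+ 4 * small n ^+ 2 + `|t| ^+ 3 * small n).
have cvg_err : `|t| * rem n + (err n + err n) @[n --> \oo] --> 0.
  have cerr : err n @[n --> \oo] --> 0.
    have -> : 0 = s ^+ 2 * (t ^+ 4 * 0 ^+ 2 + `|t| ^+ 3 * 0) :> R.
      by rewrite expr0n/= !mulr0 addr0 mulr0.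
    apply: cvgM => //; apply: cvgD; apply: cvgMr => //.
    by apply: cvgM.
  have -> : 0 = `|t| * 0 + (0 + 0) :> R by rewrite mulr0 !addr0.
  by apply: cvgD; [exact: cvgMr|exact: cvgD].
have cvg_main : cos c * expR (- (t ^+ 2 * nv n / 2)) @[n --> \oo] -->
    cos c * expR (- (t ^+ 2 * s ^+ 2 / 2)).
  apply: cvgMr; apply: (cvg_comp (fun n => - (t ^+ 2 * nv n / 2)) expR).
    apply: cvgN; apply: cvgMl. apply: cvgMr; exact: cvg_var.
  exact: continuous_expR.
apply: (cvg_sub0 _ cvg_main).
apply: norm_cvg0.
apply: (@squeeze_cvgr _ _ _ _ (cst 0) _ _ _ _ _ cvg_err); last exact: cvg_cst.
near=> n.
have [bY YW] : bounded_mfun (Y n) /\ \int[Q]_w `|Y n w - W n w| <= rem n.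
  by near: n; exact: linearization.
have [hC hS] : `|\int[Q]_w cos (t * W n w) - expR (- (t ^+ 2 * nv n / 2))| <= err n /\
    `|\int[Q]_w sin (t * W n w)| <= err n.
  by near: n; exact: char_fun_W.
rewrite /= normr_ge0 /=.
have mtY : measurable_fun setT (fun w => t * Y n w + c).
  by apply: measurable_funD => //; exact: measurable_funM.
have [mW _] := bW n.
have mtW : measurable_fun setT (fun w => t * W n w) by exact: measurable_funM.
have mtWc : measurable_fun setT (fun w => t * W n w + c) by exact: measurable_funD.
have bcY := bounded_mfun_cos mtY.
have bcWc := bounded_mfun_cos mtWc.
have bcW := bounded_mfun_cos mtW.
have bsW := bounded_mfun_sin mtW.
have bYW := bounded_mfun_norm (bounded_mfunB bY (bW n)).
have step1 : `|\int[Q]_w cos (t * Y n w + c) - \int[Q]_w cos (t * W n w + c)| <= `|t| * rem n.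
  rewrite -expectB//; apply: (le_trans (le_norm_expect Q (bounded_mfunB bcY bcWc))).
  apply: (@le_trans _ _ (\int[Q]_w (`|t| * `|Y n w - W n w|))).
    apply: le_expect; [exact: (bounded_mfun_norm (bounded_mfunB bcY bcWc))|exact: bounded_mfunZ|].
    move=> w; rewrite (le_trans (norm_cos_lip _ _))//.
    by rewrite opprD addrACA subrr addr0 -mulrBr normrM.
  by rewrite expectZ// ler_wpM2l.
have step2 : \int[Q]_w cos (t * W n w + c) =
    cos c * \int[Q]_w cos (t * W n w) - sin c * \int[Q]_w sin (t * W n w).
  rewrite -!expectZ// -expectB; [|exact: bounded_mfunZ..].
  by apply: eq_Rintegral => w _; rewrite cosD mulrC (mulrC (sin _)).
rewrite [X in `|X|](_ : _ =
  (\int[Q]_w cos (t * Y n w + c) - \int[Q]_w cos (t * W n w + c)) +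
  (cos c * (\int[Q]_w cos (t * W n w) - expR (- (t ^+ 2 * nv n / 2))) -
   sin c * \int[Q]_w sin (t * W n w))); last by rewrite step2 !fctE; ring.
rewrite (le_trans (ler_normD _ _))// lerD//.
rewrite (le_trans (ler_normB _ _))// lerD// normrM.
  by rewrite (le_trans _ hC)// ler_piMl// norm_cos_le1.
by rewrite (le_trans _ hS)// ler_piMl// norm_sin_le1.
Unshelve. all: end_near. Qed.

Let tail_Y : \forall n \near \oo, forall K, 0 < K ->
  \int[Q]_w Num.min 1 (`|Y n w| / K) <= (s ^+ 2 + 3) / K.
Proof.
near=> n => K K0.
have [bY YW] : bounded_mfun (Y n) /\ \int[Q]_w `|Y n w - W n w| <= rem n.
  by near: n; exact: linearization.
have n0 : (0 < n)%N by near: n; exact: nbhs_infty_gt.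
have rem1 : rem n <= 1 by near: n; move/cvgr_le : (cvg_rem) => /(_ _ ltr01).
have nv1 : nv n <= s ^+ 2 + 1.
  near: n; move/cvgr_le : (cvg_var); apply.
  by rewrite ltrDl.
have bYW := bounded_mfun_norm (bounded_mfunB bY (bW n)).
have bW2 := bounded_mfunX 2 (bW n).
have bsum := bounded_mfunD (bounded_mfunD (bounded_mfun_cst Om 1) bW2) bYW.
have EY : \int[Q]_w `|Y n w| <= s ^+ 2 + 3.
  apply: (@le_trans _ _ (\int[Q]_w (1 + W n w ^+ 2 + `|Y n w - W n w|))).
    apply: le_expect => //; first exact: bounded_mfun_norm.
    move=> w; rewrite -{1}(subrK (W n w) (Y n w)) (le_trans (ler_normD _ _))//.
    rewrite addrC lerD2r -(real_normK (num_real (W n w))).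
    have := sqr_ge0 (`|W n w| - 1); have := normr_ge0 (W n w); nra.
  rewrite expectD//; last by apply: bounded_mfunD => //; exact: bounded_mfun_cst.
  rewrite expectD//; last exact: bounded_mfun_cst.
  rewrite expect_cst (expect_sqr_sum X_indep X_law n (bphi n) (phi0 n)) phi_sqr//.
  lra.
have baY := bounded_mfun_norm bY.
apply: (@le_trans _ _ (\int[Q]_w (K^-1 * `|Y n w|))).
  have [mYn _] := baY.
  apply: le_expect; [|exact: bounded_mfunZ|].
    split.
      apply: measurable_minr => //; apply: measurable_funM => //.
    exists 1 => w; rewrite ger0_norm ?ge_min ?lexx//.
    by rewrite le_min ler01 divr_ge0// ltW.
  by move=> w; rewrite mulrC ge_min lexx orbT.
by rewrite expectZ// mulrC ler_wpM2r// invr_ge0 ltW.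
Unshelve. all: end_near. Qed.

(** The hypotheses say that the summands of the linear part are uniformly small, that its
variance converges to s^2, and that the three error terms of the linearization
vanish. *)
Theorem ustatistic_sqrt_clt : cvg_in_distribution Q Y (normal_prob 0 s).
Proof.
have [C hC] := normal_tail s_gt0.
apply: (continuity_theorem mY cvg_cos (C := Num.max C (s ^+ 2 + 3))).
- move=> K K0; rewrite (le_trans (hC K K0))// ler_wpM2r ?invr_ge0 ?(ltW K0)//.
  by rewrite le_max lexx.
- near=> n => K K0.
  have tY : forall K, 0 < K -> \int[Q]_w Num.min 1 (`|Y n w| / K) <= (s ^+ 2 + 3) / K.
    by near: n; exact: tail_Y.
  rewrite (le_trans (tY K K0))// ler_wpM2r ?invr_ge0 ?(ltW K0)//.
  by rewrite le_max lexx orbT.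
Unshelve. all: end_near. Qed.

End ustatistic_clt.

(** * Rates for the lens kernel, and the theorem *)

Lemma cvg_near_eq (R : realType) (u v : nat -> R) (l : R) :
  (\forall n \near \oo, u n = v n) -> v n @[n --> \oo] --> l ->
  u n @[n --> \oo] --> l.
Proof.
by move=> uv vl; apply: cvg_trans vl; apply: near_eq_cvg; apply: filterS uv => n ->.
Qed.

Lemma cvg_div_bin2 (R : realType) :
  n%:R / 'C(n, 2)%:R @[n --> \oo] --> (0 : R).
Proof.
apply: (@cvg_near_eq _ _ (fun n => 2 * (n.-1%:R)^-1)).
  near=> n; have n1 : (1 < n)%N by near: n; exact: nbhs_infty_gt.
  have n0 : n%:R != 0 :> R by rewrite pnatr_eq0 -lt0n (ltn_trans _ n1).
  have n10 : n.-1%:R != 0 :> R by rewrite pnatr_eq0 -lt0n -subn1 subn_gt0.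
  have C2 : 'C(n, 2)%:R = n%:R * n.-1%:R / 2 :> R.
    by have := mul_bin_diag n 1; rewrite bin1 -natrM => ->; rewrite natrM; field.
  by rewrite C2; field; rewrite ?n0 ?n10.
rewrite -(mulr0 2); apply: cvgMr.
rewrite -(cvg_shiftS (fun n => (n.-1%:R)^-1 : R)) -(cvg_shiftS (fun n => n.+1.-1%:R^-1 : R)).
exact: cvg_harmonic.
Unshelve. all: end_near. Qed.

(** The square root of tau n ^+ p: all the rates are monomials in it and in sqrt n. *)
Definition half_power (R : realType) (p : nat) (tau : nat -> R) n : R :=
  tau n `^ (1 / 2 * p%:R).

Section lens_clt_rates.
Context (R : realType).
Variables (p : nat) (tau : nat -> R).
Hypothesis p_gt0 : (0 < p)%N.
Hypothesis tau_gt0 : forall n, (0 < n)%N -> 0 < tau n.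
Hypothesis tau_cvg0 : tau n @[n --> \oo] --> 0.
Hypothesis tau_rate :
  Num.sqrt n%:R * tau n `^ (3 / 2 * p%:R) @[n --> \oo] --> +oo.

Let r := half_power p tau.

Lemma half_power_sqr n : (0 < n)%N -> r n ^+ 2 = tau n ^+ p.
Proof.
move=> n0; rewrite /r /half_power -powR_mulrn ?powR_ge0// -powRrM.
by rewrite (_ : 1 / 2 * p%:R * 2 = p%:R) ?powR_mulrn ?ltW ?tau_gt0//; field.
Qed.

Lemma half_power_cube n : r n ^+ 3 = tau n `^ (3 / 2 * p%:R).
Proof.
rewrite /r /half_power -powR_mulrn ?powR_ge0// -powRrM; congr (_ `^ _).
by field.
Qed.

Lemma half_power_gt0 n : (0 < n)%N -> 0 < r n.
Proof. by move=> n0; rewrite powR_gt0// tau_gt0. Qed.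

Lemma cvg_half_power_sqr : r n ^+ 2 @[n --> \oo] --> 0.
Proof.
apply: (@cvg_near_eq _ _ (fun n => tau n ^+ p)).
  by near=> n; apply: half_power_sqr; near: n; exact: nbhs_infty_gt.
have -> : 0 = (0 : R) ^+ p by rewrite expr0n gtn_eqF.
apply: (cvg_comp tau (fun u => u ^+ p) tau_cvg0).
exact: (@exprn_continuous R p 0).
Unshelve. all: end_near. Qed.

Lemma cvg_rate : (Num.sqrt n%:R * r n ^+ 3)^-1 @[n --> \oo] --> 0.
Proof.
under eq_fun do rewrite half_power_cube.
apply/gtr0_cvgV0 => //; near=> n.
have n0 : (0 < n)%N by near: n; exact: nbhs_infty_gt.
by rewrite mulr_gt0 ?sqrtr_gt0 ?ltr0n// powR_gt0// tau_gt0.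
Unshelve. all: end_near. Qed.

End lens_clt_rates.

Section lens_clt.
Context (R : realType) (p : nat) (p_gt0 : (0 < p)%N).
Variables (P : probability 'rV[R]_p R) (f : 'rV[R]_p -> R).
Hypothesis f_density : is_density P f.
Hypothesis f_continuous : continuous f.
Variable x : 'rV[R]_p.
Hypothesis fx_gt0 : 0 < f x.
Variable tau : nat -> R.
Hypothesis tau_gt0 : forall n, (0 < n)%N -> 0 < tau n.
Hypothesis tau_cvg0 : tau n @[n --> \oo] --> 0.
Hypothesis tau_rate :
  Num.sqrt n%:R * tau n `^ (3 / 2 * p%:R) @[n --> \oo] --> +oo.

Let h n := lens_kernel x (tau n).
Let h1 n := hoeffding_proj P (h n).
Let theta n := \int[P]_y h1 n y.
Let V n := \int[P]_y (h1 n y - theta n) ^+ 2.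
Let r := half_power p tau.
Let L1 := Lambda1 R p.
Let L2 := Lambda1_star2 R p.
Let a n := Num.sqrt n%:R * r n / (tau n ^+ p * Num.sqrt L1).
Let b n := a n / Num.sqrt (theta n).
Let s := Num.sqrt (L2 / L1 ^+ 2 * f x).

Let L1_gt0 : 0 < L1. Proof. by rewrite /L1 Lambda1_moment lens_moment_gt0. Qed.
Let L2_gt0 : 0 < L2. Proof. by rewrite /L2 Lambda1_star2_moment lens_moment_gt0. Qed.

Let s_gt0 : 0 < s.
Proof. by rewrite sqrtr_gt0 mulr_gt0// divr_gt0// exprn_gt0. Qed.

(* Normalized quantities with a finite limit; every rate below is a product of these and
of powers of r. *)
Let T n := theta n / r n ^+ 4.
Let G n := V n / r n ^+ 6.
Let z n := (Num.sqrt n%:R * r n ^+ 3)^-1.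
Let q n : R := n%:R / 'C(n, 2)%:R.
Let T0 := f x ^+ 2 * L1.

Let T0_gt0 : 0 < T0. Proof. by rewrite mulr_gt0// exprn_gt0. Qed.

Let r_gt0 n : (0 < n)%N -> 0 < r n. Proof. exact: half_power_gt0. Qed.

Let rE n : (0 < n)%N -> tau n ^+ p = r n ^+ 2.
Proof. by move=> n0; rewrite half_power_sqr. Qed.

Let cvg_T : T n @[n --> \oo] --> T0.
Proof.
have := lens_moment_cvg f_density f_continuous fx_gt0 (k := 0) tau_gt0 tau_cvg0.
rewrite -Lambda1_moment; apply: cvg_near_eq.
near=> n; have n0 : (0 < n)%N by near: n; exact: nbhs_infty_gt.
rewrite rE// /T; under [in RHS]eq_Rintegral do rewrite expr1.
by rewrite -exprM.
Unshelve. all: end_near. Qed.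

Let cvg_r2 : r n ^+ 2 @[n --> \oo] --> 0.
Proof. exact: cvg_half_power_sqr. Qed.

Let cvg_z : z n @[n --> \oo] --> 0.
Proof. exact: cvg_rate. Qed.

Let bh1 n : bounded_mfun (h1 n).
Proof.
exact: (bounded_mfun_hoeffding_proj P (measurable_lens_kernel x (tau n)) (lens_kernel01 x (tau n))).
Qed.

Let VE n : V n = \int[P]_y h1 n y ^+ 2 - theta n ^+ 2.
Proof.
have b2 := bounded_mfunX 2 (bh1 n).
have bc := bounded_mfunZ (2 * theta n) (bh1 n).
have bt := bounded_mfun_cst 'rV[R]_p (theta n ^+ 2).
rewrite (_ : V n = \int[P]_y (h1 n y ^+ 2 - 2 * theta n * h1 n y + theta n ^+ 2)).
  rewrite (expectD P (bounded_mfunB b2 bc) bt) (expectB P b2 bc) (expectZ P _ (bh1 n)).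
  by rewrite expect_cst -/(theta n); ring.
by apply: eq_Rintegral => y _; ring.
Qed.

Let cvg_G : G n @[n --> \oo] --> f x ^+ 3 * L2.
Proof.
have M2 := lens_moment_cvg f_density f_continuous fx_gt0 (k := 1) tau_gt0 tau_cvg0.
rewrite -Lambda1_star2_moment -/L2 in M2.
rewrite -(subr0 (f x ^+ 3 * L2)) -(mulr0 (T0 ^+ 2)).
apply: (@cvg_near_eq _ _ (fun n => (\int[P]_y h1 n y ^+ 2) / (tau n ^+ p) ^+ 3 -
   T n ^+ 2 * r n ^+ 2)).
  near=> n; have n0 : (0 < n)%N by near: n; exact: nbhs_infty_gt.
  by rewrite rE// /G VE /T; field; rewrite gt_eqF// r_gt0.
apply: cvgB => //; apply: cvgM => //.
by apply: (cvg_comp T (fun u => u ^+ 2) cvg_T); exact: exprn_continuous.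
Unshelve. all: end_near. Qed.

Let near_pos : \forall n \near \oo, [/\ (1 < n)%N, 0 < r n & 0 < T n].
Proof.
near=> n; have n1 : (1 < n)%N by near: n; exact: nbhs_infty_gt.
split=> //; first by rewrite r_gt0// (ltn_trans _ n1).
by near: n; move/cvgr_gt : (cvg_T) => /(_ _ T0_gt0).
Unshelve. all: end_near. Qed.

Let c n := (Num.sqrt L1 * Num.sqrt (T n))^-1.

Let cvg_c : c n @[n --> \oo] --> (Num.sqrt L1 * Num.sqrt T0)^-1.
Proof.
apply: cvgV; first by rewrite gt_eqF// mulr_gt0// sqrtr_gt0.
by apply: cvgMr; apply: cvg_comp cvg_T _; exact: sqrt_continuous.
Qed.

(* Expressions of a, b, theta and V in terms of the normalized quantities.  The square root N
of n is abstract, so that n can be rewritten as N^2. *)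
Let forms n : (1 < n)%N -> 0 < r n -> 0 < T n -> exists N : R,
  [/\ [/\ 0 < N, N ^+ 2 = n%:R, 0 < 'C(n, 2)%:R :> R & z n = (N * r n ^+ 3)^-1],
     a n = N / (r n * Num.sqrt L1), b n = c n * N / r n ^+ 3,
     theta n = T n * r n ^+ 4 & V n = G n * r n ^+ 6].
Proof.
move=> n1 r0 Tn; pose N : R := Num.sqrt n%:R; exists N.
have n0 : (0 < n)%N by rewrite (ltn_trans _ n1).
have N0 : 0 < N by rewrite sqrtr_gt0 ltr0n.
have sL : 0 < Num.sqrt L1 by rewrite sqrtr_gt0.
have aE : a n = N / (r n * Num.sqrt L1).
  by rewrite /a rE// -/N; field; rewrite !gt_eqF.
have tE : theta n = T n * r n ^+ 4 by rewrite /T; field; rewrite gt_eqF.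
split=> //.
- by split=> //; [rewrite sqr_sqrtr|rewrite ltr0n bin_gt0].
- have sT : 0 < Num.sqrt (T n) by rewrite sqrtr_gt0.
  have -> : b n = a n / (Num.sqrt (T n) * r n ^+ 2).
    rewrite /b tE sqrtrM ?(ltW Tn)// (_ : r n ^+ 4 = (r n ^+ 2) ^+ 2) ?sqrtr_sqr -?exprM//.
    by rewrite ger0_norm// exprn_ge0// ltW.
  by rewrite aE /c; field; rewrite !gt_eqF.
- by rewrite /G; field; rewrite gt_eqF.
Qed.

Lemma lens_rate_var : b n ^+ 2 * V n / n%:R @[n --> \oo] --> s ^+ 2.
Proof.
have -> : s ^+ 2 = (Num.sqrt L1 * Num.sqrt T0)^-1 ^+ 2 * (f x ^+ 3 * L2).
  rewrite sqr_sqrtr; last by rewrite mulr_ge0 ?(ltW fx_gt0)// divr_ge0 ?exprn_ge0// ltW.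
  rewrite exprVn exprMn !sqr_sqrtr ?(ltW L1_gt0) ?(ltW T0_gt0)//.
  by rewrite /T0; field; rewrite !gt_eqF.
apply: (@cvg_near_eq _ _ (fun n => c n ^+ 2 * G n)).
  near=> n; have [n1 r0 Tn] : [/\ (1 < n)%N, 0 < r n & 0 < T n] by near: n; exact: near_pos.
  have [N [[N0 N2 C0 zE] aE bE tE VEn]] := forms n1 r0 Tn.
  by rewrite bE VEn -N2; field; rewrite !gt_eqF.
apply: cvgM => //; apply: (cvg_comp c (fun u => u ^+ 2) cvg_c).
exact: exprn_continuous.
Unshelve. all: end_near. Qed.

Lemma lens_rate_sup K : b n / n%:R * (K * r n ^+ 2) @[n --> \oo] --> 0.
Proof.
apply: (@cvg_near_eq _ _ (fun n => c n * K * (z n * r n ^+ 2))).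
  near=> n; have [n1 r0 Tn] : [/\ (1 < n)%N, 0 < r n & 0 < T n] by near: n; exact: near_pos.
  have [N [[N0 N2 C0 zE] aE bE tE VEn]] := forms n1 r0 Tn.
  by rewrite bE -N2 zE; field; rewrite !gt_eqF.
rewrite -(mulr0 ((Num.sqrt L1 * Num.sqrt T0)^-1 * K)) -[X in _ * X](mulr0 0).
by apply: cvgM; [exact: cvgMl|exact: cvgM].
Unshelve. all: end_near. Qed.

Lemma lens_rate_rem1 : b n * V n / (n%:R * theta n) @[n --> \oo] --> 0.
Proof.
apply: (@cvg_near_eq _ _ (fun n => c n * G n / T n * (z n * r n ^+ 2))).
  near=> n; have [n1 r0 Tn] : [/\ (1 < n)%N, 0 < r n & 0 < T n] by near: n; exact: near_pos.
  have [N [[N0 N2 C0 zE] aE bE tE VEn]] := forms n1 r0 Tn.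
  by rewrite bE tE VEn -N2 zE; field; rewrite !gt_eqF.
rewrite -(mulr0 ((Num.sqrt L1 * Num.sqrt T0)^-1 * (f x ^+ 3 * L2) / T0)) -[X in _ * X](mulr0 0).
apply: cvgM; last exact: cvgM.
by apply: cvgM; [exact: cvgM|apply: cvgV => //; rewrite gt_eqF].
Unshelve. all: end_near. Qed.

Lemma lens_rate_rem2 : b n / 'C(n, 2)%:R @[n --> \oo] --> 0.
Proof.
apply: (@cvg_near_eq _ _ (fun n => c n * (z n * q n))).
  near=> n; have [n1 r0 Tn] : [/\ (1 < n)%N, 0 < r n & 0 < T n] by near: n; exact: near_pos.
  have [N [[N0 N2 C0 zE] aE bE tE VEn]] := forms n1 r0 Tn.
  by rewrite bE /q -N2 zE; field; rewrite !gt_eqF.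
rewrite -(mulr0 ((Num.sqrt L1 * Num.sqrt T0)^-1)) -[X in _ * X](mulr0 0).
by apply: cvgM => //; apply: cvgM => //; exact: cvg_div_bin2.
Unshelve. all: end_near. Qed.

Lemma lens_rate_rem3 : a n ^+ 2 / 'C(n, 2)%:R @[n --> \oo] --> 0.
Proof.
apply: (@cvg_near_eq _ _ (fun n => L1^-1 * ((2 + q n) * (z n * r n ^+ 2) ^+ 2))).
  near=> n; have [n1 r0 Tn] : [/\ (1 < n)%N, 0 < r n & 0 < T n] by near: n; exact: near_pos.
  have [N [[N0 N2 C0 zE] aE bE tE VEn]] := forms n1 r0 Tn.
  have sL : 0 < Num.sqrt L1 by rewrite sqrtr_gt0.
  have nC : n%:R ^+ 2 = 2 * 'C(n, 2)%:R + n%:R :> R.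
    rewrite -natrM -[2%N in LHS]/2%N -(mul_bin_diag n 1) bin1 -natrX -natrD.
    by congr _%:R; rewrite -mulnSr prednK// (ltn_trans _ n1).
  have -> : 2 + q n = n%:R ^+ 2 / 'C(n, 2)%:R.
    by rewrite nC /q; field; rewrite gt_eqF.
  rewrite aE -[in L1^-1](sqr_sqrtr (ltW L1_gt0)) zE -N2; field.
  by rewrite !gt_eqF.
have -> : 0 = L1^-1 * ((2 + 0) * (0 * 0) ^+ 2) :> R.
  by rewrite mul0r expr0n/= !mulr0.
apply: cvgMr; apply: cvgM.
  by apply: cvgD; [exact: cvg_cst|exact: cvg_div_bin2].
apply: (cvg_comp (fun n => z n * r n ^+ 2) (fun u => u ^+ 2)); last exact: exprn_continuous.
exact: cvgM.
Unshelve. all: end_near. Qed.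

(* The constant is the bound 2^p on the measure of the sections of the unit lens relation,
times the bound 2 * f x on f at small scales. *)
Let near_bound : \forall n \near \oo, forall y,
  `|h1 n y - theta n| <= 2 * f x * 2 ^+ p * r n ^+ 2.
Proof.
have ee : 0 < f x <= f x by rewrite fx_gt0 lexx.
have [del del0 hdel] := lens_proj_bounds f_density f_continuous ee.
near=> n => y.
have n0 : (0 < n)%N by near: n; exact: nbhs_infty_gt.
have t0 := tau_gt0 n0.
have tdel : tau n < del.
  have : `|tau n| < del by near: n; move/cvgr0_norm_lt : (tau_cvg0) => /(_ _ del0).
  by rewrite gtr0_norm.
have hb v : 0 <= h1 n v <= 2 * f x * 2 ^+ p * r n ^+ 2.
  have /andP[-> _] := hoeffding_proj01 P (measurable_lens_kernel x (tau n)) (lens_kernel01 x (tau n)) v.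
  have [/andP[_ hu] _] := hdel (tau n) (introT andP (conj t0 tdel)) v.
  rewrite (le_trans hu)// rE//; set L := lens_section _.
  have -> : (f x + f x) * (r n ^+ 2 * L) = 2 * f x * r n ^+ 2 * L by ring.
  have -> : 2 * f x * 2 ^+ p * r n ^+ 2 = 2 * f x * r n ^+ 2 * 2 ^+ p by ring.
  have c0 : 0 <= 2 * f x * r n ^+ 2.
    by apply: mulr_ge0; [apply: mulr_ge0 => //; exact: ltW|exact: sqr_ge0].
  exact: (ler_wpM2l c0 (lens_section_le _)).
have tb : 0 <= theta n <= 2 * f x * 2 ^+ p * r n ^+ 2.
  apply/andP; split; first by apply: Rintegral_ge0 => u _; have /andP[] := hb u.
  rewrite -(expect_cst P (2 * f x * 2 ^+ p * r n ^+ 2)).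
  apply: le_expect => //; first exact: bounded_mfun_cst.
  by move=> u; have /andP[] := hb u.
have /andP[? ?] := hb y; have /andP[? ?] := tb.
by rewrite ler_norml; apply/andP; split; lra.
Unshelve. all: end_near. Qed.

Context d (Om : measurableType d) (Q : probability Om R).
Variable X : nat -> {RV Q >-> 'rV[R]_p}.
Hypothesis X_indep : mutually_independent X.
Hypothesis X_law : identically_distributed X P.

Let near_pos_theta : \forall n \near \oo, 0 < theta n /\ 0 < a n.
Proof.
near=> n; have [n1 r0 Tn] : [/\ (1 < n)%N, 0 < r n & 0 < T n] by near: n; exact: near_pos.
have [N [[N0 N2 C0 zE] aE bE tE VEn]] := forms n1 r0 Tn.
have sL : 0 < Num.sqrt L1 by rewrite sqrtr_gt0.
rewrite aE tE; split; first by rewrite mulr_gt0// exprn_gt0.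
by rewrite divr_gt0// mulr_gt0.
Unshelve. all: end_near. Qed.

Lemma lens_density_clt : cvg_in_distribution Q
    (fun n w => a n * (Num.sqrt (ustatistic X (h n) n w) - Num.sqrt (theta n)))
    (normal_prob 0 s).
Proof.
exact: (ustatistic_sqrt_clt X_indep X_law
  (fun n => measurable_lens_kernel x (tau n)) (fun n => lens_kernel01 x (tau n))
  (fun n => lens_kernel_sym x (tau n)) s_gt0 near_pos_theta near_bound
  (lens_rate_sup _) lens_rate_var lens_rate_rem1 lens_rate_rem2 lens_rate_rem3).
Qed.

End lens_clt.

Theorem theorem2p5 (R : realType) (p : nat) (p_gt0 : (0 < p)%N)
    (P : probability 'rV[R]_p R) (f : 'rV[R]_p -> R)
    (f_density : is_density P f) (f_continuous : continuous f)
    (d : measure_display) (Om : measurableType d) (Q : probability Om R)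
    (X : nat -> {RV Q >-> 'rV[R]_p})
    (X_indep : mutually_independent X)
    (X_law : identically_distributed X P)
    (x : 'rV[R]_p) (xS : x \in [set y | 0 < f y])
    (tau : nat -> R) (tau_gt0 : forall n, (0 < n)%N -> 0 < tau n)
    (tau_cvg0 : tau n @[n --> \oo] --> 0)
    (tau_rate :
      Num.sqrt n%:R * tau n `^ (3 / 2 * p%:R) @[n --> \oo] --> +oo) :
  cvg_in_distribution Q
    (fun n w => Num.sqrt n%:R * tau n `^ (1 / 2 * p%:R) *
       (sample_lens_density n (fun i => X i w) (tau n) x -
        lens_density P (tau n) x))
    (normal_prob 0
       (Num.sqrt (Lambda1_star2 R p / Lambda1 R p ^+ 2 * f x))).
Proof.
have fx_gt0 : 0 < f x by move: xS; rewrite inE.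
have clt := lens_density_clt p_gt0 f_density f_continuous fx_gt0 tau_gt0 tau_cvg0
  tau_rate X_indep X_law.
apply: (eq_ind _ (fun Y => cvg_in_distribution Q Y _) clt).
apply/funext => n; apply/funext => w.
rewrite /sample_lens_density /lens_density (LLD_expect P x).
by rewrite /ustatistic /sample_LLD -mulrBl [LHS]mulrAC [RHS]mulrA.
Qed.
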